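(* Let $n,k\ge 1$. As maps on $k$-chains of non-crossing partitions of $[n]$, $$\mathrm{Rot}\sim\partial^{k+1},\qquad \mathrm{SU}\sim\mathrm{ev}\circ\partial,\qquad \mathrm{LK}\sim\mathrm{ev}\circ\partial^{-k},$$ where $X\sim Y$ means $X=\theta^{-1}\circ Y\circ\theta$, with $\theta$ the bijection (denoted $\mathrm{NCPtoDyck}$) from $k$-chains of non-crossing partitions of $[n]$ to $k$-Dyck paths of size $n$ described in the context.
   Context: $k$-Dyck paths. A $k$-Dyck path of size $n$ is a lattice path from $(0,0)$ to $(kn,n)$ with steps $U=(0,1)$, $R=(1,0)$, weakly above $y=x/k$, identified with its word of length $N=(k+1)n$. Its step sequence is the set of positions of its $n$ letters $U$. For $k=1$ these are Dyck paths. Promotion and evacuation. Products are compositions, rightmost factor first. The toggle $t_i$ ($1\le i\le N-1$) exchanges the $i$-th and $(i+1)$-st letters if the result is a $k$-Dyck path, and otherwise fixes the path. $\partial=t_{N-1}\cdots t_2t_1$, $\mathrm{ev}=t_1(t_2t_1)\cdots(t_{N-1}\cdots t_2t_1)$. $k$-chains. A partition of $[n]$ is non-crossing if there are no $i<j<l<m$ with $i,l$ in one block and $j,m$ in another; $\mathrm{NC}(n)$ is the set of these. A $k$-chain (weighted non-crossing partition) is $\pi=(\pi_1,\dots,\pi_k)$, $\pi_i\in\mathrm{NC}(n)$, with $\pi_{i+1}$ a refinement of $\pi_i$ for all $i$. The bijection $\theta=\mathrm{NCPtoDyck}$ is defined recursively (a chain on any finite set of integers is relabelled order-preservingly by $[r]$).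 (i) If all $\pi_i$ are the partition of $[r]$ into singletons, $\theta(\pi)=(UR^k)^r$. (ii) If $\pi_1=\{[r]\}$ and $r\geq 2$, let $\pi'=(\pi_2,\dots,\pi_k,\hat 1)$ with $\hat 1$ the partition into singletons; the step sequence of $\theta(\pi)$ is $\{1\}\cup\{u-1: u\ge 2,\ u \text{ in the step sequence of }\theta(\pi')\}$. (iii) In general let $B_1,\dots,B_h$ be the blocks of $\pi_1$ ordered by their minima and let $\mu_i$ be the path of the chain restricted to $B_i$. Start with $\mu_1$; for $i=2,\dots,h$ insert $\mu_i$ into the current path right after its first $(k+1)j$ steps, $j=\#\{p\in B_1\cup\dots\cup B_{i-1}:p<\min B_i\}$. The result is $\theta(\pi)$. Maps on $\mathrm{NC}(n)$ (points $1,\dots,n$ clockwise on a circle). $\mathrm{Rot}$: replace $i$ by $i-1$ ($1\mapsto n$). $\mathrm{SU}$: put $i'$ between $n+1-i$ and $n+2-i$ (indices mod $n$; so $1'$ is between $n$ and $1$ and labels proceed counterclockwise), and put $i',j'$ in the same block iff they lie in the same region of the disc cut out by the blocks of $\pi$; drop primes. $\mathrm{LK}:=\theta_1^{-1}\circ\widehat{RSK}\circ \mathrm{Dyck}_2\circ\widehat{RSK}^{-1}\circ\theta_1$, where $\theta_1$ is $\theta$ for $k=1$, and $\widehat{RSK},\mathrm{Dyck}_2$ are the following maps on Dyck paths of size $n$. For a $321$-avoiding $w\in S_n$ let $p(w)$ be the Dyck path whose peaks (corners $UR$) are exactly the points $(i-1,w_i)$ with $w_i\ge i$ (a bijection), and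 $q(w)$ the Dyck path whose valleys (corners $RU$) are exactly the points $(w_i,i-1)$ with $w_i<i$; $\mathrm{Dyck}_2(p(w)):=q(w)$. If $(A,B)$ is the (insertion, recording) tableau pair of $w$ under Robinson--Schensted row insertion, $\widehat{RSK}(p(w))$ is the Dyck path whose $i$-th step ($1\le i\le n$) is $U$ if $i$ is in the first row of $A$ and $R$ if in the second, and whose $(2n+1-i)$-th step is $R$ if $i$ is in the first row of $B$ and $U$ if in the second. Maps on $k$-chains: $\mathrm{Rot}(\pi_1,\dots,\pi_k)=(\mathrm{Rot}(\pi_1),\dots,\mathrm{Rot}(\pi_k))$, and for $X\in\{\mathrm{SU},\mathrm{LK}\}$ (which reverse refinement) $X(\pi_1,\dots,\pi_k)=(X(\pi_k),\dots,X(\pi_1))$. *)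

(* Defs.v *)
From HB Require Import structures.
From mathcomp Require Import all_boot all_fingroup.
From mathcomp Require Import zify.

Set Implicit Arguments.
Unset Strict Implicit.
Unset Printing Implicit Defensive.

(* Words over [bool]: [true] is the step U = (0,1), [false] is R = (1,0). *)
Definition is_kdyck (k n : nat) (w : seq bool) : bool :=
  [&& count_mem true w == n, count_mem false w == k * n
    & all (fun i => count_mem false (take i w) <= k * count_mem true (take i w))
          (iota 0 (size w).+1)].

Record kdyck (n k : nat) := KDyck {
  kdyck_word :> (k.+1 * n).-tuple bool;
  kdyckP : is_kdyck k n kdyck_word }.

HB.instance Definition _ n k := [isSub for @kdyck_word n k].
HB.instance Definition _ n k := [Finite of kdyck n k by <:].

(* The path with word [s], or [D] if [s] is not the word of a k-Dyck path. *)
Definition path_of_word n k (D : kdyck n k) (s : seq bool) : kdyck n k :=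
  odflt D [pick D' : kdyck n k | D' == s :> seq bool].

(* Positions of steps are numbered from 1. *)
Definition step_seq (w : seq bool) : seq nat :=
  [seq u <- iota 1 (size w) | nth false w u.-1].

Definition word_of_steps (N : nat) (S : seq nat) : seq bool :=
  [seq u \in S | u <- iota 1 N].

Definition swap_letters (i : nat) (w : seq bool) : seq bool :=
  take i.-1 w ++ [:: nth false w i; nth false w i.-1] ++ drop i.+1 w.

Definition toggle n k (i : nat) (D : kdyck n k) : kdyck n k :=
  path_of_word D (swap_letters i D).

(* t_m ... t_2 t_1, rightmost factor applied first *)
Definition sweep n k (m : nat) (D : kdyck n k) : kdyck n k :=
  foldl (fun D' i => toggle i D') D (iota 1 m).

Definition promotion n k (D : kdyck n k) : kdyck n k :=
  sweep (k.+1 * n).-1 D.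

(* t_1 (t_2 t_1) ... (t_(N-1) ... t_2 t_1): the longest sweep acts first *)
Definition evacuation n k (D : kdyck n k) : kdyck n k :=
  foldl (fun D' m => sweep m D') D (rev (iota 1 (k.+1 * n).-1)).

(* The point i of [n] is the ordinal of value i - 1. *)
Definition noncrossing n (P : {set {set 'I_n}}) : bool :=
  [forall B in P, forall C in P, forall i in B, forall j in C,
   forall l in B, forall m in C, [&& i < j, j < l & l < m] ==> (B == C)].

Definition is_nc n (P : {set {set 'I_n}}) : bool :=
  partition P [set: 'I_n] && noncrossing P.

Record nc (n : nat) := NC {
  nc_part :> {set {set 'I_n}};
  ncP : is_nc nc_part }.

HB.instance Definition _ n := [isSub for @nc_part n].
HB.instance Definition _ n := [Finite of nc n by <:].

Definition refines n (Q P : {set {set 'I_n}}) : bool :=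
  [forall B in Q, exists C in P, B \subset C].

Record kchain (n k : nat) := KChain {
  kchain_tuple :> k.-tuple (nc n);
  kchainP : sorted (fun P Q : nc n => refines Q P) kchain_tuple }.

HB.instance Definition _ n k := [isSub for @kchain_tuple n k].
HB.instance Definition _ n k := [Finite of kchain n k by <:].

Definition singletons r : {set {set 'I_r}} := [set [set i] | i : 'I_r].

(* [enum_val] is the increasing bijection from 'I_#|B| to B. *)
Definition restrict r (B : {set 'I_r}) (P : {set {set 'I_r}}) :
    {set {set 'I_#|B|}} :=
  [set [set x : 'I_#|B| | enum_val x \in C] | C : {set 'I_r} in P
    & C :&: B != set0].

Definition block_min r (B : {set 'I_r}) : nat :=
  \big[minn/r]_(i in B) (i : nat).

Definition blocks_by_min r (P : {set {set 'I_r}}) : seq {set 'I_r} :=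
  sort (fun B C => block_min B <= block_min C) (enum P).

Definition shift_steps (w : seq bool) : seq bool :=
  word_of_steps (size w) (1 :: [seq u.-1 | u <- step_seq w & 2 <= u]).

Definition insert_at (p : nat) (mu w : seq bool) : seq bool :=
  take p w ++ mu ++ drop p w.

(* Insertion of the path [mu] of the block [B]; [st] consists of the union of
   the blocks already treated and the current path. *)
Definition insert_block k r (mu : {set 'I_r} -> seq bool)
    (st : {set 'I_r} * seq bool) (B : {set 'I_r}) : {set 'I_r} * seq bool :=
  (st.1 :|: B,
   insert_at (k.+1 * #|[set p in st.1 | p < block_min B]|) (mu B) st.2).

Fixpoint theta_rec (fuel k r : nat) (c : seq {set {set 'I_r}}) : seq bool :=
  if fuel isn't fuel'.+1 then [::] else
  if all (pred1 (singletons r)) c then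
    flatten (nseq r (true :: nseq k false))
  else if (head set0 c == [set [set: 'I_r]]) && (2 <= r) then
    shift_steps (theta_rec fuel' k (rcons (behead c) (singletons r)))
  else
    (foldl (insert_block k
        (fun B => theta_rec fuel' k [seq restrict B P | P <- c]))
      (set0, [::]) (blocks_by_min (head set0 c))).2.

(* 2k+1 levels of recursion suffice: the second case decreases the number of
   components other than [singletons], and the blocks of the third case fall
   under one of the first two. *)
Definition theta_word n k (c : kchain n k) : seq bool :=
  theta_rec (2 * k).+1 k [seq nc_part P | P <- c].

Lemma is_kdyckP k n w :
  reflect [/\ count_mem true w = n, count_mem false w = k * n
            & forall i, count_mem false (take i w) <= k * count_mem true (take i w)]
          (is_kdyck k n w).
Proof.
apply: (iffP and3P) => [[/eqP hU /eqP hR /allP h]|[hU hR h]]; split=> //.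
- move=> i; case: (leqP i (size w)) => [le_iw|/ltnW/take_oversize->].
    by apply: h; rewrite mem_iota /= add0n ltnS.
  by rewrite hU hR.
- exact/eqP.
- exact/eqP.
- by apply/allP => i _.
Qed.

Lemma size_kdyck k n w : is_kdyck k n w -> size w = k.+1 * n.
Proof.
case/is_kdyckP=> hU hR _.
have <- : count_mem true w + count_mem false w = size w.
  by elim: w {hU hR} => //= -[] w <- /=; lia.
by rewrite hU hR; lia.
Qed.

Lemma kdyck_nil k : is_kdyck k 0 [::].
Proof. by apply/is_kdyckP; split=> //=; rewrite muln0. Qed.

Lemma count_mem_nseq (b c : bool) m : count_mem b (nseq m c) = (b == c) * m.
Proof. by rewrite count_nseq /= eq_sym. Qed.

Lemma kdyck_peak k : is_kdyck k 1 (true :: nseq k false).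
Proof.
apply/is_kdyckP; split=> [||[|i]] //=; rewrite ?count_mem_nseq //=; try lia.
case: (leqP i k) => [le_ik|/ltnW lt_ki].
  by rewrite take_nseq // !count_mem_nseq /=; lia.
by rewrite take_oversize ?size_nseq // !count_mem_nseq /=; lia.
Qed.

Lemma kdyck_insert k a b p mu w :
  is_kdyck k a w -> is_kdyck k b mu -> is_kdyck k (a + b) (insert_at p mu w).
Proof.
case/is_kdyckP=> wU wR wP /is_kdyckP[mU mR mP].
have cP (c : bool) : count_mem c (insert_at p mu w) = count_mem c w + count_mem c mu.
  have := congr1 (count_mem c) (cat_take_drop p w).
  rewrite count_cat => <-; rewrite /insert_at !count_cat.
  by rewrite -addnA [count_mem c mu + _]addnC addnA.
apply/is_kdyckP; split; rewrite ?cP; [lia|lia|] => i.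
rewrite /insert_at take_cat; case: ifP => _; first by rewrite -take_min; exact: wP.
rewrite take_cat; set j := i - _; case: ifP => _.
  by rewrite !count_cat mulnDr leq_add.
set l := j - _; have := wP (p + l); rewrite takeD !count_cat !mulnDr mU mR.
by rewrite addnCA [X in _ -> _ <= X]addnCA leq_add2l.
Qed.

Lemma kdyck_peaks k r : is_kdyck k r (flatten (nseq r (true :: nseq k false))).
Proof.
elim: r => [|r IHr]; first exact: kdyck_nil.
have := kdyck_insert 0 IHr (kdyck_peak k).
by rewrite /insert_at take0 drop0 addn1.
Qed.

Lemma shift_stepsE w :
  shift_steps (true :: false :: w) = true :: rcons w false.
Proof.
have memS v u : 0 < u -> (u \in 1 :: [seq x.-1 | x <- step_seq v & 2 <= x])
                       = (u == 1) || nth false v u.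
  move=> u0; rewrite inE; case: eqP => //= u1.
  apply/mapP/idP => [[x]|vu].
    rewrite mem_filter mem_filter => /andP[x2 /andP[+ _]] ->.
    by [].
  have lt_u : u < size v.
    by rewrite ltnNge; apply/negP => /(nth_default false); rewrite vu.
  exists u.+1 => //; rewrite mem_filter ltnS u0 mem_filter mem_iota [_.-1]/= vu.
  by rewrite add1n !ltnS lt_u.
rewrite /shift_steps /word_of_steps; apply: (@eq_from_nth _ false).
  by rewrite size_map size_iota /= size_rcons.
move=> i; rewrite size_map size_iota => lt_i.
rewrite (nth_map 0) ?size_iota // nth_iota // add1n memS //.
case: i lt_i => [//|i]; rewrite /= ltnS => lt_i.
rewrite nth_rcons; case: ltngtP => //=; first by move: lt_i; rewrite ltnS; lia.
by move->; rewrite nth_default.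
Qed.

Lemma kdyck_shift k r w : is_kdyck k r (true :: false :: w) ->
  is_kdyck k r (true :: rcons w false).
Proof.
case/is_kdyckP=> /= wU wR wP.
apply/is_kdyckP; rewrite -cats1 /= !count_cat /=; split=> [||[|i]] //=; try lia.
rewrite take_cat; case: ifP => _; first by have /= := wP i.+2; lia.
by case: (i - _) => [|j]; rewrite /= !count_cat /=; lia.
Qed.

Definition starts_UR (m : nat) (w : seq bool) : bool :=
  take m.+1 w == true :: nseq m false.

Lemma starts_shift m w : starts_UR m.+1 w ->
  exists2 v, w = true :: false :: v & starts_UR m (true :: rcons v false).
Proof.
rewrite /starts_UR; case: w => [|a [|b v]] //= /eqP e; first by case: e.
case: e => -> -> hv; exists v => //.
apply/eqP; congr cons.
have le_mv: m <= size v by rewrite -(size_nseq m false) -hv size_take; case: ltnP; lia.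
by rewrite -cats1 takel_cat.
Qed.

Lemma starts_peaks k m r : m <= k -> 0 < r ->
  starts_UR m (flatten (nseq r (true :: nseq k false))).
Proof.
case: r => // r le_mk _; rewrite /starts_UR /=; apply/eqP; congr cons.
by rewrite takel_cat ?size_nseq // take_nseq.
Qed.

Lemma starts_insert m p mu w : m < p -> m < size w ->
  starts_UR m w -> starts_UR m (insert_at p mu w).
Proof.
move=> lt_mp lt_mw; rewrite /starts_UR /insert_at => /eqP <-; apply/eqP.
rewrite takel_cat; last by rewrite size_take; case: ifP.
rewrite take_takel //.
Qed.

Lemma mem_singletons r (B : {set 'I_r}) : B \in singletons r -> #|B| = 1.
Proof. by case/imsetP=> i _ ->; rewrite cards1. Qed.

Lemma partition_singletons r : partition (singletons r) [set: 'I_r].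
Proof.
apply/and3P; split.
- apply/eqP/setP=> i; rewrite inE; apply/bigcupP; exists [set i]; last exact: set11.
  exact: imset_f.
- apply/trivIsetP=> _ _ /imsetP[i _ ->] /imsetP[j _ ->] ne_ij.
  by rewrite disjoints1 inE; apply: contra ne_ij => /eqP->.
- by apply/negP=> /mem_singletons; rewrite cards0.
Qed.

Lemma partition_ord1 r (P : {set {set 'I_r}}) :
  r <= 1 -> partition P [set: 'I_r] -> P = singletons r.
Proof.
case: r P => [|[|r]] // P _ /and3P[/eqP cP tP P0].
- have e0 (B : {set 'I_0}) : B = set0 by apply/setP=> -[].
  apply/setP=> B; rewrite (e0 B) (negbTE P0); apply/esym/negP.
  by move/mem_singletons; rewrite cards0.
- have eT (B : {set 'I_1}) : B != set0 -> B = [set: 'I_1].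
    by case/set0Pn=> i iB; apply/setP=> j; rewrite (ord1 j) -(ord1 i) iB inE.
  have sT : [set ord0] = [set: 'I_1] by apply: eT; apply/set0Pn; exists ord0; rewrite set11.
  have -> : singletons 1 = [set [set: 'I_1]].
    apply/setP=> B; rewrite inE; apply/imsetP/eqP => [[i _ ->]|->].
      by rewrite (ord1 i) sT.
    by exists ord0; rewrite ?sT.
  apply/setP=> B; rewrite inE; apply/idP/eqP => [BP|->].
    by apply: eT; apply: contraNneq P0 => <-.
  have: ord0 \in cover P by rewrite cP inE.
  case/bigcupP=> C CP _; rewrite -(eT C) //.
  by apply: contraNneq P0 => <-.
Qed.

Lemma mem_restrict r (B : {set 'I_r}) (P : {set {set 'I_r}}) (C : {set 'I_r}) : C \in P ->
  C :&: B != set0 -> [set x : 'I_#|B| | enum_val x \in C] \in restrict B P.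
Proof. by move=> CP CB; apply/imsetP; exists C; rewrite ?inE ?CP. Qed.

Lemma partition_restrict r (B : {set 'I_r}) (P : {set {set 'I_r}}) :
  partition P [set: 'I_r] -> partition (restrict B P) [set: 'I_#|B|].
Proof.
case/and3P=> /eqP cP tP P0; apply/and3P; split.
- apply/eqP/setP=> x; rewrite inE.
  have: enum_val x \in cover P by rewrite cP inE.
  case/bigcupP=> C CP xC; apply/bigcupP.
  exists [set y : 'I_#|B| | enum_val y \in C]; last by rewrite inE.
  apply: mem_restrict => //; apply/set0Pn; exists (enum_val x).
  by rewrite inE xC enum_valP.
- apply/trivIsetP=> _ _ /imsetP[C + ->] /imsetP[D + ->].
  rewrite !inE => /andP[CP _] /andP[DP _] neCD.
  have dCD : [disjoint C & D].
    by apply: (trivIsetP tP) => //; apply: contraNneq neCD => ->.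
  rewrite -setI_eq0; apply/eqP/setP=> x; rewrite !inE; apply/negP=> /andP[xC xD].
  by have /setP/(_ (enum_val x)) := disjoint_setI0 dCD; rewrite !inE xC xD.
- apply/negP=> /imsetP[C]; rewrite inE => /andP[CP /set0Pn[y]].
  rewrite inE => /andP[yC yB] /setP/(_ (enum_rank_in yB y)).
  by rewrite !inE enum_rankK_in ?yC.
Qed.

Lemma restrict_singletons r (B : {set 'I_r}) :
  restrict B (singletons r) = singletons #|B|.
Proof.
have e (x : 'I_#|B|) : [set y : 'I_#|B| | enum_val y \in [set enum_val x]] = [set x].
  by apply/setP=> y; rewrite !inE (inj_eq enum_val_inj).
apply/setP=> C; apply/imsetP/imsetP => [[_ /setIdP[/imsetP[i _ ->]] +] -> | [x _ ->]].
  case/set0Pn=> j; rewrite !inE => /andP[/eqP-> iB].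
  exists (enum_rank_in iB i) => //; rewrite -e enum_rankK_in //.
exists [set enum_val x]; last by rewrite e.
rewrite inE imset_f //=; apply/set0Pn; exists (enum_val x).
by rewrite !inE eqxx enum_valP.
Qed.

Lemma restrict_block r (B : {set 'I_r}) (P : {set {set 'I_r}}) :
  partition P [set: 'I_r] -> B \in P -> restrict B P = [set [set: 'I_#|B|]].
Proof.
case/and3P=> _ tP P0 BP.
have e : [set x : 'I_#|B| | enum_val x \in B] = [set: 'I_#|B|].
  by apply/setP=> x; rewrite !inE enum_valP.
apply/setP=> C; rewrite inE; apply/imsetP/eqP => [[D /setIdP[DP DB] ->]|->].
  suff -> : D = B by rewrite e.
  apply/eqP/negP=> /negP ne_DB; case/negP: DB.
  by rewrite setI_eq0; apply: (trivIsetP tP).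
exists B => //; rewrite inE BP setIid.
by apply: contraNneq P0 => <-.
Qed.

Lemma block_min_le r (B : {set 'I_r}) (i : 'I_r) : i \in B -> block_min B <= i.
Proof.
rewrite /block_min -big_filter => iB.
have: i \in [seq j <- index_enum 'I_r | j \in B] by rewrite mem_filter iB mem_index_enum.
elim: (filter _ _) => // j s IHs; rewrite inE big_cons geq_min.
by case/predU1P=> [<-|/IHs->]; rewrite ?leqnn ?orbT.
Qed.

Lemma block_min_in r (B : {set 'I_r}) : B != set0 ->
  exists2 i : 'I_r, i \in B & block_min B = i.
Proof.
case/set0Pn=> i0 i0B; have := block_min_le i0B.
have : block_min B = r \/ exists2 i : 'I_r, i \in B & block_min B = i.
  rewrite /block_min; elim/big_ind: _ => [|x y|i iB]; [by left| |by right; exists i].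
  by rewrite /minn; case: ifP.
by case=> // ->; rewrite leqNgt ltn_ord.
Qed.

Lemma insert_blocks k d r (mu : {set 'I_r} -> seq bool) (P : {set {set 'I_r}}) :
  partition P [set: 'I_r] -> d <= k ->
  (forall B, B \in P -> is_kdyck k #|B| (mu B) /\ starts_UR (k - d) (mu B)) ->
  let w := (foldl (insert_block k mu) (set0, [::]) (blocks_by_min P)).2 in
  is_kdyck k r w /\ (0 < r -> starts_UR (k - d) w).
Proof.
move=> partP le_dk muP.
have [/eqP cP tP P0] := and3P partP.
have srt : sorted (fun B C : {set 'I_r} => block_min B <= block_min C) (blocks_by_min P).
  by apply: sort_sorted => B C; exact: leq_total.
have memP B : (B \in blocks_by_min P) = (B \in P) by rewrite mem_sort mem_enum.
have unP : uniq (blocks_by_min P) by rewrite sort_uniq enum_uniq.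
have cvP : \bigcup_(B <- blocks_by_min P) B = [set: 'I_r].
  by rewrite -cP /cover -big_enum; apply: perm_big; rewrite perm_sort.
have {srt} srt : pairwise (fun B C : {set 'I_r} => block_min B <= block_min C) (blocks_by_min P).
  by rewrite -sorted_pairwise // => B C D; exact: leq_trans.
have {memP} memP : {subset blocks_by_min P <= P} by move=> B; rewrite memP.
have key s : uniq s -> {subset s <= P} ->
   pairwise (fun B C : {set 'I_r} => block_min B <= block_min C) s ->
   let st := foldl (insert_block k mu) (set0, [::]) s in
   [/\ st.1 = \bigcup_(B <- s) B, is_kdyck k #|st.1| st.2
     & s != [::] -> starts_UR (k - d) st.2].
  elim/last_ind: s => [|s B IHs].
    by move=> _ _ _ /=; rewrite big_nil cards0; split=> //; exact: kdyck_nil.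
  rewrite rcons_uniq => /andP[Bs us] sP; rewrite pairwise_rcons => /andP[/allP hB ps].
  have {IHs} := IHs us _ ps.
  case=> [C Cs|]; first by apply: sP; rewrite mem_rcons inE Cs orbT.
  rewrite foldl_rcons /=; case: (foldl _ _ s) => cov w /= -> dw sw.
  have BP : B \in P by apply: sP; rewrite mem_rcons inE eqxx.
  have [dB sB] := muP B BP.
  have dis C : C \in s -> [disjoint C & B].
    move=> Cs; apply: (trivIsetP tP) => //; last by apply: contraNneq Bs => <-.
    by apply: sP; rewrite mem_rcons inE Cs orbT.
  split; first by rewrite -cats1 big_cat big_seq1.
    rewrite cardsU disjoint_setI0 ?cards0 ?subn0; first exact: kdyck_insert.
    rewrite big_seq; elim/big_ind: _ => [|C D dC dD|C]; last exact: dis.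
      by rewrite disjoint_sym; apply/pred0P=> x /=; rewrite inE andbF.
    by rewrite -setI_eq0 setIUl (disjoint_setI0 dC) (disjoint_setI0 dD) setU0.
  move=> _; case: s => [|C s] in us sP ps Bs hB dw sw dis *.
    by rewrite big_nil (_ : [set p in set0 | _] = set0) ?cards0 ?muln0 /insert_at
      /=; [move: dw; rewrite big_nil cards0 => /size_kdyck; rewrite muln0 => /size0nil->;
       rewrite /= cats0|apply/setP=> x; rewrite !inE].
  have CP : C \in P by apply: sP; rewrite mem_rcons inE mem_head orbT.
  have [i iC mC] : exists2 i : 'I_r, i \in C & block_min C = i.
    by apply: block_min_in; apply: contraNneq P0 => <-.
  have [j jB mB] : exists2 j : 'I_r, j \in B & block_min B = j.
    by apply: block_min_in; apply: contraNneq P0 => <-.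
  have iCov : i \in \bigcup_(B <- C :: s) B by rewrite big_cons inE iC.
  apply: starts_insert; last exact: sw.
    set S := [set _ in _ | _]; suff S0 : 0 < #|S|.
      by apply: leq_trans (leq_pmulr k.+1 S0); rewrite ltnS leq_subr.
    rewrite card_gt0; apply/set0Pn; exists i; rewrite !inE iCov /=.
    rewrite ltn_neqAle -{2}mC hB ?mem_head // mB andbT.
    apply/negP=> /eqP/val_inj e; have /setP/(_ i) := disjoint_setI0 (dis C (mem_head _ _)).
    by rewrite !inE iC e jB.
  rewrite (size_kdyck dw); set S := \bigcup_(_ <- _) _; suff S0 : 0 < #|S|.
    by apply: leq_trans (leq_pmulr k.+1 S0); rewrite ltnS leq_subr.
  by rewrite card_gt0; apply/set0Pn; exists i.
have [] := key _ unP memP srt.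
rewrite cvP => -> + sw; rewrite cardsT card_ord => dw; split=> // r0.
apply: sw; apply/negP=> /eqP e; move: cvP; rewrite e big_nil => /setP/(_ (Ordinal r0)).
by rewrite !inE.
Qed.

Lemma theta_recP d f k r (c : seq {set {set 'I_r}}) :
  size c = k -> d <= k -> 2 * d < f ->
  all (fun P => partition P [set: 'I_r]) c ->
  all (pred1 (singletons r)) (drop d c) ->
  let w := theta_rec f k c in
  is_kdyck k r w /\ (0 < r -> starts_UR (k - d) w).
Proof.
elim: d => [|d IHd] in f r c *.
  case: f => // f sc _ _ _; rewrite drop0 /= => ->.
  by split=> [|r0]; [exact: kdyck_peaks|apply: starts_peaks; rewrite ?leq_subr].
have prime f' r' (c' : seq {set {set 'I_r'}}) :
  size c' = k -> d < k -> 2 * d < f' -> 0 < r' ->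
  all (fun P => partition P [set: 'I_r']) c' ->
  all (pred1 (singletons r')) (drop d.+1 c') ->
  let w := shift_steps (theta_rec f' k (rcons (behead c') (singletons r'))) in
  is_kdyck k r' w /\ starts_UR (k - d.+1) w.
  move=> sc lt_dk lt_f r0 pc tc.
  have [|||||dw /(_ r0)] := IHd f' r' (rcons (behead c') (singletons r')).
  - by rewrite size_rcons size_behead sc; case: (k) lt_dk.
  - exact: ltnW.
  - exact: lt_f.
  - rewrite all_rcons partition_singletons /=; apply/allP => P /mem_behead.
    exact: (allP pc).
  - rewrite drop_rcons; last by rewrite size_behead sc; case: (k) lt_dk.
    rewrite all_rcons /= eqxx /=; move: tc; case: (c') => [|P c''] //=.
  rewrite -(subnSK lt_dk) => /starts_shift[v vE sv].
  by rewrite vE in dw *; rewrite shift_stepsE; split=> //; exact: kdyck_shift.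
move=> sc lt_dk lt_f pc tc; case: f lt_f => [|f] // lt_f.
rewrite /=; case: ifP => [_|ntriv].
  by split=> [|r0]; [exact: kdyck_peaks|apply: starts_peaks; rewrite ?leq_subr].
case: ifP => [/andP[_ r2]|_].
  have [||//|//|dw sw] := prime f r c sc lt_dk; [lia|lia|].
  by split.
apply: insert_blocks => //.
  case: c sc pc {tc ntriv} => [|P c] /=; first by move=> k0; move: lt_dk; rewrite -k0.
  by move=> _ /andP[].
move=> B; case: c sc pc tc {ntriv} => [|P c] sc pc tc BP.
  by move: BP; rewrite inE.
have pP : partition P [set: 'I_r] by case/andP: pc.
set cB := [seq restrict B Q | Q <- P :: c].
have B0 : 0 < #|B|.
  by case/and3P: pP => _ _; rewrite card_gt0; apply: contraNneq => <-.
have pcB : all (fun Q => partition Q [set: 'I_#|B|]) cB.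
  by rewrite all_map; apply/allP=> Q /(allP pc); exact: partition_restrict.
have tcB : all (pred1 (singletons #|B|)) (drop d.+1 cB).
  rewrite -map_drop all_map; apply/allP=> Q /(allP tc) /= /eqP->.
  by rewrite restrict_singletons.
case: f lt_f => [|f] lt_f; first by move: lt_f; lia.
rewrite /=; case: ifP => [_|ntriv].
  by split; [exact: kdyck_peaks|apply: starts_peaks; rewrite ?leq_subr].
rewrite restrict_block // eqxx /=; case: ifP => [B2|B1].
  apply: (prime f #|B| cB) => //; first by rewrite size_map.
  by move: lt_f; lia.
case/negP: ntriv; rewrite -[X in is_true X]/(all (pred1 (singletons #|B|)) cB).
apply/allP=> Q /(allP pcB) /= pQ; apply/eqP/partition_ord1 => //.
by rewrite leqNgt B1.
Qed.

Lemma theta_word_kdyck n k (c : kchain n k) : is_kdyck k n (theta_word c).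
Proof.
have sc : size [seq nc_part P | P <- c] = k by rewrite size_map size_tuple.
case: (@theta_recP k (2 * k).+1 k n [seq nc_part P | P <- c]) => //.
  by rewrite all_map; apply/allP=> P _; case/andP: (ncP P).
by rewrite -{1}sc drop_size.
Qed.

Lemma size_theta_word n k (c : kchain n k) : size (theta_word c) == k.+1 * n.
Proof. by rewrite (size_kdyck (theta_word_kdyck c)). Qed.

Definition theta n k (c : kchain n k) : kdyck n k :=
  @KDyck n k (Tuple (size_theta_word c)) (theta_word_kdyck c).

Definition rot_part n (P : {set {set 'I_n}}) : {set {set 'I_n}} :=
  [set [set ord_pred i | i in B] | B : {set 'I_n} in P].

(* The primed point i' lies just after the point n + 1 - i, which is the ordinal
   [rev_ord i].  The chord i'j' separates the points x for which this is true
   from those for which it is false. *)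
Definition side n (i j x : 'I_n) : bool := (rev_ord i < x) (+) (rev_ord j < x).

(* i' and j' lie in the same region iff no block meets the chord i'j', i.e. has
   points on both sides of it. *)
Definition same_region n (P : {set {set 'I_n}}) (i j : 'I_n) : bool :=
  [forall B in P, forall x in B, forall y in B, side i j x == side i j y].

Definition su_part n (P : {set {set 'I_n}}) : {set {set 'I_n}} :=
  equivalence_partition (same_region P) [set: 'I_n].

Lemma noncrossingP n (P : {set {set 'I_n}}) :
  reflect (forall B C i j l m, B \in P -> C \in P -> i \in B -> j \in C ->
             l \in B -> m \in C -> [&& i < j, j < l & l < m] -> B = C)
          (noncrossing P).
Proof.
apply: (iffP forall_inP) => [h B C i j l m BP CP iB jC lB mC lt_ijlm|h B BP].
  move/forall_inP: (h B BP) => /(_ C CP)/forall_inP/(_ i iB)/forall_inP/(_ j jC).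
  by move/forall_inP=> /(_ l lB)/forall_inP/(_ m mC)/implyP/(_ lt_ijlm)/eqP.
apply/forall_inP=> C CP; apply/forall_inP=> i iB; apply/forall_inP=> j jC.
apply/forall_inP=> l lB; apply/forall_inP=> m mC; apply/implyP=> lt_ijlm.
by apply/eqP; exact: (h B C i j l m).
Qed.

Lemma val_ord_pred n (i : 'I_n) :
  ord_pred i = (if i == 0 :> nat then n.-1 else i.-1) :> nat.
Proof.
case: i => i lt_in /=; case: eqP => [->|/eqP i0].
  by rewrite add0n modn_small // prednK //; case: n lt_in.
have -> : (i + n).-1 = i.-1 + n by lia.
by rewrite modnDr modn_small; lia.
Qed.

Lemma rot_nc n (P : nc n) : is_nc (rot_part P).
Proof.
have /andP[partP /noncrossingP ncrP] := ncP P.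
have injf : injective (@ord_pred n) by exact: ord_pred_inj.
apply/andP; split.
  suff <- : @ord_pred n @: [set: 'I_n] = [set: 'I_n] by rewrite imset_partition.
  apply/setP=> x; rewrite inE; apply/imsetP; exists (ordS x) => //.
  by rewrite ordSK.
apply/noncrossingP=> _ _ _ _ _ _ /imsetP[B BP ->] /imsetP[C CP ->]
  /imsetP[i iB ->] /imsetP[j jC ->] /imsetP[l lB ->] /imsetP[m mC ->].
rewrite !val_ord_pred => lt_ijlm; congr (_ @: _).
have := ltn_ord i; have := ltn_ord j; have := ltn_ord l; have := ltn_ord m => ? ? ? ?.
case: (eqVneq (m : nat) 0) lt_ijlm => m0 lt_ijlm.
  rewrite (ncrP _ _ _ _ _ _ CP BP mC iB jC lB) //.
  by move: lt_ijlm; do !case: eqP; lia.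
rewrite (ncrP _ _ _ _ _ _ BP CP iB jC lB mC) //.
by move: lt_ijlm; do !case: eqP; lia.
Qed.

Definition Rot n (P : nc n) : nc n := NC (rot_nc P).

Lemma same_regionP n (P : {set {set 'I_n}}) (i j : 'I_n) :
  reflect (forall B x y, B \in P -> x \in B -> y \in B -> side i j x = side i j y)
          (same_region P i j).
Proof.
apply: (iffP forall_inP) => [h B x y BP xB yB|h B BP].
  by move/forall_inP: (h B BP) => /(_ x xB)/forall_inP/(_ y yB)/eqP.
by apply/forall_inP=> x xB; apply/forall_inP=> y yB; rewrite (h B x y).
Qed.

Lemma same_region_equiv n (P : {set {set 'I_n}}) :
  {in [set: 'I_n] & &, equivalence_rel (same_region P)}.
Proof.
move=> i j l _ _ _; split; first by apply/same_regionP=> B x y _ _ _; rewrite /side !addbb.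
move/same_regionP=> ij; apply/same_regionP/same_regionP => h B x y BP xB yB.
  have := ij B x y BP xB yB; have := h B x y BP xB yB; rewrite /side.
  by do 6!case: (_ < _).
have := ij B x y BP xB yB; have := h B x y BP xB yB; rewrite /side.
by do 6!case: (_ < _).
Qed.

Lemma su_nc n (P : nc n) : is_nc (su_part P).
Proof.
have eqR := @same_region_equiv n P.
rewrite /is_nc equivalence_partitionP //=.
apply/noncrossingP=> _ _ i j l m /imsetP[b _ ->] /imsetP[c _ ->].
rewrite !inE /= => bi cj bl cm lt_ijlm.
have R3 x y z : same_region P x y -> same_region P x z = same_region P y z.
  by move=> xy; have [_ ->] := eqR x y z (in_setT _) (in_setT _) (in_setT _).
have il : same_region P i l by rewrite -(R3 b).
have jm : same_region P j m by rewrite -(R3 c).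
suff ij : same_region P i j.
  by apply/setP=> x; rewrite !inE /= (R3 _ _ _ bi) (R3 _ _ _ cj) (R3 _ _ _ ij).
apply/same_regionP=> B x y BP xB yB.
have := same_regionP _ _ _ il B x y BP xB yB.
have := same_regionP _ _ _ jm B x y BP xB yB.
have mono z : [/\ (rev_ord i < z) ==> (rev_ord j < z),
    (rev_ord j < z) ==> (rev_ord l < z) & (rev_ord l < z) ==> (rev_ord m < z)].
  by split; apply/implyP; apply: leq_ltn_trans; rewrite /= leq_sub2l // ltnS;
    case/and3P: lt_ijlm => *; apply: ltnW.
have [] := mono x; have [] := mono y; rewrite /side.
by do 8!case: (_ < _).
Qed.

Definition SU n (P : nc n) : nc n := NC (su_nc P).

(* The point (x, y) reached after the first [t] steps. *)
Definition path_point (w : seq bool) (t : nat) : nat * nat :=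
  (count_mem false (take t w), count_mem true (take t w)).

Definition corners (a b : bool) (w : seq bool) : seq (nat * nat) :=
  [seq path_point w t | t <- iota 1 (size w).-1
    & (nth false w t.-1 == a) && (nth false w t == b)].

Definition peaks : seq bool -> seq (nat * nat) := corners true false.
Definition valleys : seq bool -> seq (nat * nat) := corners false true.

Definition avoids321 n (s : 'S_n) : bool :=
  [forall i : 'I_n, forall j : 'I_n, forall l : 'I_n,
    ~~ [&& i < j, j < l, s j < s i & s l < s j]].

(* For [i : 'I_n] the one-line notation of [s] has the letter [(s i).+1] in
   position [i.+1]. *)
Definition p_points n (s : 'S_n) : seq (nat * nat) :=
  [seq (val i, (s i).+1) | i : 'I_n <- enum 'I_n & i <= s i].

Definition q_points n (s : 'S_n) : seq (nat * nat) :=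
  [seq ((s i).+1, val i) | i : 'I_n <- enum 'I_n & s i < i].

(* p and q are bijections from 321-avoiding permutations to Dyck paths, and
   [rsk_word s] is a Dyck word for [s] avoiding 321: the default values in
   [p_inv], [Dyck2] and [RSKhat] are never used. *)
Definition p_inv n (D : kdyck n 1) : 'S_n :=
  odflt 1%g [pick s : 'S_n | avoids321 s && perm_eq (peaks D) (p_points s)].

Definition Dyck2 n (D : kdyck n 1) : kdyck n 1 :=
  odflt D [pick D' : kdyck n 1 | perm_eq (valleys D') (q_points (p_inv D))].

Fixpoint row_insert (x : nat) (row : seq nat) : seq nat * option nat :=
  if row is y :: row' then
    if x < y then (x :: row', Some y)
    else let: (row'', bumped) := row_insert x row' in (y :: row'', bumped)
  else ([:: x], None).

(* Insertion of [x] into the tableau [A], [i] being the new entry of the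
   recording tableau [B]; tableaux are lists of rows. *)
Fixpoint rs_insert (x i : nat) (A B : seq (seq nat)) :
    seq (seq nat) * seq (seq nat) :=
  if A is row :: A' then
    match row_insert x row with
    | (row', None) => (row' :: A', rcons (head [::] B) i :: behead B)
    | (row', Some y) =>
        let: (A'', B'') := rs_insert y i A' (behead B) in
        (row' :: A'', head [::] B :: B'')
    end
  else ([:: [:: x]], [:: [:: i]]).

Definition RS (s : seq nat) : seq (seq nat) * seq (seq nat) :=
  foldl (fun AB xi => rs_insert xi.1 xi.2 AB.1 AB.2) ([::], [::])
    (zip s (iota 1 (size s))).

Definition rsk_word n (s : 'S_n) : seq bool :=
  let: (A, B) := RS [seq (s i).+1 | i <- enum 'I_n] in
  [seq i \in nth [::] A 0 | i <- iota 1 n]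
    ++ [seq i \in nth [::] B 1 | i <- rev (iota 1 n)].

Definition RSKhat n (D : kdyck n 1) : kdyck n 1 :=
  path_of_word D (rsk_word (p_inv D)).

Definition chain1 n (P : nc n) : kchain n 1 := @KChain n 1 [tuple P] isT.

Definition theta1 n (P : nc n) : kdyck n 1 := theta (chain1 P).

(* [theta1] is a bijection, so that the default value [P] is never used;
   [finv] is the library's inverse of an injective self-map of a finite type. *)
Definition LK n (P : nc n) : nc n :=
  odflt P [pick Q : nc n |
    theta1 Q == RSKhat (Dyck2 (finv (@RSKhat n) (theta1 P)))].

Definition map_chain n k (X : nc n -> nc n) (c : kchain n k) : k.-tuple (nc n) :=
  map_tuple X c.

Definition rev_map_chain n k (X : nc n -> nc n) (c : kchain n k) :
    k.-tuple (nc n) :=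
  rev_tuple (map_tuple X c).

(* Main.v *)
Require Import Defs.
From HB Require Import structures.
From mathcomp Require Import all_boot all_fingroup.
From mathcomp Require Import zify.

Set Implicit Arguments.
Unset Strict Implicit.
Unset Printing Implicit Defensive.

(** The first two identities become visible once a chain is written as a word
    of labels.  For a non-crossing partition [P] let [nx P p] be the next point
    clockwise in the block of [p].  To a chain [(P_1, ..., P_k)] of partitions of
    [n] attach the word [L] of length [(k+1)n] obtained by writing, for [p] from
    the first point to the last, [p] and then [nx P_k p, ..., nx P_1 p].  Every
    label occurs [k+1] times in [L], and no two labels [x], [y] occur in the
    order [x y x y].  Two facts carry everything.

    - [theta_labels]: the [i]-th step of [theta c] is up if and only if the
      [i]-th letter of [L] occurs there for the first time.  The recursion of
      [theta] acts on label words: putting the one-block partition in front of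
      a chain that ended in the singletons rotates [L] by one letter, and
      inserting the path of a block inserts the label word of that block.
    - [promotion_firsts], [evacuation_firsts]: read through first occurrences,
      promotion rotates a label word by one letter and evacuation reverses it.

    Rotating the partitions rotates [L] by [k+1] letters up to a renaming of the
    labels ([labels_rot]), and the Simion-Ullman complement reverses
    [rot 1 L] up to a renaming ([labels_su]); this gives the first two
    identities.  A word of first occurrences determines its label word up to
    renaming ([firsts_iso]) and every path is such a word ([kdyck_firsts]), so
    [theta] is bijective; promotion is then injective because its
    [(k+1)n]-th power is the identity.

    For the third identity write [c = Rot d].  Then [theta c] is the
    [(k+1)]-fold promotion of [theta d], so that the right-hand side is
    evacuation after promotion of [theta d], that is [SU d].  It remains to see
    [LK (Rot P) = SU P] for one partition ([LK_Rot]), where [k = 1].  Let [s]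
    avoid 321.  Its insertion tableaux have at most two rows, and the second
    rows come from a matching between the weak excedances of [s] and its other
    entries, found by a greedy pass ([rsk_word_greedy]).  Exchanging the two
    tableaux reverses the path and exchanges the two kinds of steps, which for
    [k = 1] is the reversal of the label word.  The map [Dyck2] turns [s] into a
    permutation whose items are those of the inverse of [s] with all positions
    moved by one place, and the greedy matching reacts to this move by a change
    in exactly one letter, the one at the first return of the path to the
    diagonal ([greedy_shift_flip]).  Changing that letter is promotion
    ([promotion_rsk_word]), so conjugation by [RSKhat] makes [Dyck2] a reversal
    followed by a promotion, and on label words this is the complement of
    [Rot^-1]. *)

(** * Labelled words and their first occurrences *)

Section Words.
Variable T : eqType.
Implicit Types (s t seen : seq T) (x y : T).

Fixpoint firsts_after seen s : seq bool :=
  if s is x :: s' then (x \notin seen) :: firsts_after (rcons seen x) s' else [::].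

(** A path is encoded by labelling its steps: a step is up when its label is new. *)
Definition firsts s := firsts_after [::] s.

Lemma eq_firsts_after S1 S2 s : S1 =i S2 -> firsts_after S1 s = firsts_after S2 s.
Proof.
elim: s S1 S2 => //= x s IH S1 S2 e; rewrite e; congr cons; apply: IH => y.
by rewrite !mem_rcons !inE e.
Qed.

Lemma firsts_after_cat S s t :
  firsts_after S (s ++ t) = firsts_after S s ++ firsts_after (S ++ s) t.
Proof.
by elim: s S => [|x s IH] S /=; rewrite ?cats0 // IH cat_rcons.
Qed.

Lemma firsts_cat s t : firsts (s ++ t) = firsts s ++ firsts_after s t.
Proof. exact: firsts_after_cat. Qed.

Lemma size_firsts_after S s : size (firsts_after S s) = size s.
Proof. by elim: s S => //= x s IH S; rewrite IH. Qed.

Lemma size_firsts s : size (firsts s) = size s.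
Proof. exact: size_firsts_after. Qed.

Lemma firsts_rcons s x : firsts (rcons s x) = rcons (firsts s) (x \notin s).
Proof. by rewrite -!cats1 firsts_cat. Qed.

Lemma firsts_after_disjoint S1 S2 s :
  (forall x, x \in s -> x \notin S2) -> firsts_after (S1 ++ S2) s = firsts_after S1 s.
Proof.
elim: s S1 => //= x s IH S1 sS.
rewrite mem_cat (negbTE (sS x (mem_head _ _))) orbF; congr cons.
rewrite -[RHS]IH => [|y ys]; last by apply: sS; rewrite inE ys orbT.
by apply: eq_firsts_after => y; rewrite !(mem_rcons, mem_cat, inE) orbA.
Qed.

Lemma firsts_disjoint S s : (forall x, x \in s -> x \notin S) -> firsts_after S s = firsts s.
Proof. by move=> sS; rewrite -[S]cat0s firsts_after_disjoint. Qed.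

Lemma firsts_after_sub S s : {subset s <= S} -> firsts_after S s = nseq (size s) false.
Proof.
elim: s S => //= x s IH S sS; rewrite sS ?mem_head //=; congr cons; apply: IH.
by move=> y ys; rewrite mem_rcons inE sS ?orbT // inE ys orbT.
Qed.

Lemma take_firsts i s : take i (firsts s) = firsts (take i s).
Proof.
rewrite -{1}(cat_take_drop i s) firsts_cat.
case: (leqP i (size s)) => [le_is|/ltnW le_si].
  by rewrite take_size_cat // size_firsts size_takel.
by rewrite (take_oversize le_si) (drop_oversize le_si) cats0 take_oversize // size_firsts.
Qed.

Lemma count_firsts s : count_mem true (firsts s) = size (undup s).
Proof.
elim/last_ind: s => // s x IH; rewrite firsts_rcons -cats1 count_cat IH /=.
rewrite -[size (undup (rcons s x))]size_rev.
rewrite addn0 size_rev; have -> : size (undup (rcons s x)) = size (undup (x :: s)).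
  by apply/perm_size/perm_undup => y; rewrite mem_rcons.
by rewrite /=; case: (x \in s); rewrite /= ?addn0 ?addn1.
Qed.

Lemma count_firstsF s : count_mem false (firsts s) + size (undup s) = size s.
Proof.
rewrite -count_firsts addnC -(size_firsts s).
by elim: (firsts s) => //= -[] w <-; rewrite ?addnS.
Qed.

Lemma size_undup_count s : size s = \sum_(x <- undup s) count_mem x s.
Proof.
rewrite -sum1_size -[LHS]big_undup_iterop_count; apply: eq_bigr => x _.
by rewrite /iterop; elim: (count_mem _ _) => //= -[|m] //= ->.
Qed.

Lemma leq_size_undup k s : (forall x, x \in s -> count_mem x s <= k.+1) ->
  size s <= k.+1 * size (undup s).
Proof.
move=> h; rewrite size_undup_count mulnC -sum1_size big_distrl /= big_seq [X in _ <= X]big_seq.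
by apply: leq_sum => x; rewrite mem_undup mul1n; exact: h.
Qed.

Lemma size_undup_full k s : (forall x, x \in s -> count_mem x s = k.+1) ->
  size s = k.+1 * size (undup s).
Proof.
move=> h; rewrite size_undup_count mulnC -sum1_size big_distrl /= big_seq [X in _ = X]big_seq.
by apply: eq_bigr => x; rewrite mem_undup mul1n; exact: h.
Qed.

(** One up step and [k] right steps for each label. *)
Definition full k s := forall x, x \in s -> count_mem x s = k.+1.

(** The partition of the positions of [s] according to their labels is
    non-crossing. *)
Definition noncr s := forall x y, x != y -> ~~ subseq [:: x; y; x; y] s.

Lemma noncr_cat s1 s2 s3 s4 x y : noncr (s1 ++ s2 ++ s3 ++ s4) ->
  x \in s1 -> y \in s2 -> x \in s3 -> y \in s4 -> x = y.
Proof.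
move=> ncs x1 y2 x3 y4; apply/eqP; apply: contraT => ne_xy.
have /negP := ncs x y ne_xy; case.
by rewrite -[[:: x; y; x; y]]/([:: x] ++ [:: y] ++ [:: x] ++ [:: y]) !cat_subseq ?sub1seq.
Qed.

Lemma noncr_subseq s t : subseq s t -> noncr t -> noncr s.
Proof. by move=> st nct x y ne; apply: contra (nct x y ne) => /subseq_trans; apply. Qed.

Lemma noncr_rev s : noncr s -> noncr (rev s).
Proof.
move=> ncs x y ne; rewrite -[[:: x; y; x; y]]revK subseq_rev.
by apply: (ncs y x); rewrite eq_sym.
Qed.

Lemma subseq_rcons_l (u : seq T) x s : subseq (rcons u x) (rcons s x) = subseq u s.
Proof. by rewrite -subseq_rev !rev_rcons /= eqxx subseq_rev. Qed.

(** Being non-crossing is a cyclic condition, since the pattern [x y x y] becomes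
    [y x y x] when it is rotated. *)
Lemma noncr_rot s : noncr s -> noncr (rot 1 s).
Proof.
case: s => [|z s] // ncs; rewrite rot1_cons => x y ne.
have [eyz|ne_yz] := eqVneq y z.
  rewrite -[[:: x; y; x; y]]/(rcons [:: x; y; x] y) eyz subseq_rcons_l -eyz.
  have := ncs y x; rewrite eq_sym ne => /(_ isT).
  by rewrite -eyz /= eqxx.
rewrite -subseq_rev rev_rcons /= (negbTE ne_yz) -subseq_rev.
have := ncs x y ne; apply: contra => h; rewrite !revK in h.
by apply: (subseq_trans h); apply: subseq_cons.
Qed.

Lemma subseq_notin x u s t : x \notin s -> subseq (x :: u) (s ++ t) = subseq (x :: u) t.
Proof.
elim: s => //= y s IH; rewrite inE negb_or => /andP[/negbTE-> xs].
exact: IH.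
Qed.

Lemma subseq_notin_r x u s t : x \notin t -> subseq (rcons u x) (s ++ t) = subseq (rcons u x) s.
Proof.
move=> xt; rewrite -subseq_rev rev_cat rev_rcons subseq_notin ?mem_rev //.
by rewrite -rev_rcons subseq_rev.
Qed.

Lemma subseq_mem_filter (p : pred T) u s : all p u -> subseq u s -> subseq u (filter p s).
Proof. by move=> pu us; rewrite subseq_filter pu. Qed.

(** The labels of [m] are private to an interval, so a crossing would have to lie
    entirely inside or entirely outside of [m]. *)
Lemma noncr_insert a m b : noncr (a ++ b) -> noncr m ->
  (forall x, x \in m -> x \notin a ++ b) -> noncr (a ++ m ++ b).
Proof.
move=> ncab ncm dis x y ne; apply/negP=> h.
have aba u v s : u \in m -> v \notin m -> ~~ subseq [:: u; v; u] (a ++ m ++ b).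
  move=> um vm; have := dis u um; rewrite mem_cat negb_or => /andP[ua ub].
  rewrite subseq_notin // -[[:: u; v; u]]/(rcons [:: u; v] u) subseq_notin_r //.
  by apply: contra vm => /mem_subseq; apply; rewrite !inE eqxx orbT.
have [xm|xm] := boolP (x \in m); have [ym|ym] := boolP (y \in m).
- case/negP: (ncm x y ne); have := subseq_mem_filter (p := mem m) _ h.
  rewrite /= xm ym => /(_ isT); rewrite !filter_cat.
  rewrite [filter _ m](all_filterP _); last exact/allP.
  have -> : [seq z <- a | mem m z] = [::].
    apply/eqP; rewrite -(negbK (_ == _)) -has_filter; apply/hasPn => z za.
    by apply/negP=> /= /dis; rewrite mem_cat za.
  have -> : [seq z <- b | mem m z] = [::].
    apply/eqP; rewrite -(negbK (_ == _)) -has_filter; apply/hasPn => z za.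
    by apply/negP=> /= /dis; rewrite mem_cat za orbT.
  by rewrite cats0.
- case/negP: (aba x y [::] xm ym); apply: subseq_trans h.
  exact: (prefix_subseq [:: x; y; x] [:: y]).
- case/negP: (aba y x [::] ym xm); apply: subseq_trans h; exact: subseq_cons.
- case/negP: (ncab x y ne); have := subseq_mem_filter (p := fun z => z \notin m) _ h.
  rewrite /= xm ym => /(_ isT); rewrite !filter_cat.
  have -> : [seq z <- m | z \notin m] = [::].
    by apply/eqP; rewrite -(negbK (_ == _)) -has_filter; apply/hasPn => z zm; rewrite negbK.
  rewrite cat0s -filter_cat => hs; apply: subseq_trans hs _; exact: filter_subseq.
Qed.

Lemma full_rot k i s : full k s -> full k (rot i s).
Proof.
by move=> fs x; rewrite mem_rot => /fs <-; have /seq.permP-> : perm_eq (rot i s) s by rewrite perm_rot.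
Qed.

Lemma full_rev k s : full k s -> full k (rev s).
Proof. by move=> fs x; rewrite mem_rev count_rev => /fs. Qed.

Lemma full_insert k a m b : full k (a ++ b) -> full k m ->
  (forall x, x \in m -> x \notin a ++ b) -> full k (a ++ m ++ b).
Proof.
move=> fab fm dis x; rewrite !mem_cat !count_cat.
have [xm _|xm] := boolP (x \in m).
  have := dis x xm; rewrite mem_cat negb_or => /andP[xa xb].
  by rewrite fm // !(count_memPn _) // addn0.
rewrite orFb -mem_cat => /fab; rewrite count_cat => <-.
by rewrite (count_memPn xm).
Qed.

Lemma full_nseq k x : full k (nseq k.+1 x).
Proof. by move=> y; rewrite mem_nseq /= => /eqP->; rewrite count_nseq /= eqxx mul1n. Qed.

Lemma noncr_nseq k x : noncr (nseq k x).
Proof.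
move=> y z ne; apply/negP=> /mem_subseq h.
have := h y; have := h z; rewrite !inE !eqxx !orbT !mem_nseq => /(_ isT)/andP[_ /eqP ez] /(_ isT)/andP[_ /eqP ey].
by rewrite ey ez eqxx in ne.
Qed.

End Words.

Section Maps.
Variables (T U : eqType) (f : T -> U).
Implicit Types s : seq T.

Lemma firsts_after_map S s : {in S ++ s &, injective f} ->
  firsts_after (map f S) (map f s) = firsts_after S s.
Proof.
elim: s S => //= x s IH S injf; congr (~~ _ :: _).
  apply/mapP/idP => [[y yS e]|xS]; last by exists x.
  by rewrite (injf x y) // mem_cat ?inE ?eqxx ?yS ?orbT.
by rewrite -map_rcons IH // cat_rcons.
Qed.

Lemma firsts_map s : {in s &, injective f} -> firsts (map f s) = firsts s.
Proof. exact: (@firsts_after_map [::]). Qed.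

Lemma noncr_map s : injective f -> noncr s -> noncr (map f s).
Proof.
move=> injf ncs x y ne; apply/negP=> h.
have /mapP[x' _ ex] : x \in map f s by apply: (mem_subseq h); rewrite inE eqxx.
have /mapP[y' _ ey] : y \in map f s by apply: (mem_subseq h); rewrite !inE eqxx orbT.
have ne' : x' != y' by apply: contraNneq ne => e; rewrite ex ey e.
case/negP: (ncs _ _ ne'); move: h; rewrite ex ey.
rewrite -[[:: f x'; _; _; _]]/(map f [:: x'; y'; x'; y']).
case/subseqP=> m sm e; apply/subseqP; exists m; first by rewrite size_map in sm.
by apply: (inj_map injf); rewrite map_mask.
Qed.

Lemma full_map k s : injective f -> full k s -> full k (map f s).
Proof.
move=> injf fs _ /mapP[x xs ->]; rewrite count_map -(fs x xs).
by apply: eq_count => y /=; rewrite (inj_eq injf).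
Qed.

End Maps.

(** * A word of first occurrences determines its labelled word *)
Section Leaf.
Variable T : eqType.
Implicit Types (s a b r : seq T) (x y : T).

Lemma last_new s : s != [::] ->
  exists a x r, [/\ s = a ++ x :: r, x \notin a & {subset r <= rcons a x}].
Proof.
elim/last_ind: s => // s y IH _; have [ys|ys] := boolP (y \in s); last first.
  by exists s, y, [::]; split; rewrite ?cats1.
have [|a [x [r [es xa ra]]]] := IH; first by case: (s) ys.
exists a, x, (rcons r y); split=> //; first by rewrite es rcons_cat.
move=> z; rewrite mem_rcons inE => /orP[/eqP->|/ra//].
move: ys; rewrite es mem_cat inE => /or3P[ya|/eqP->|/ra//].
  by rewrite mem_rcons inE ya orbT.
by rewrite mem_rcons mem_head.
Qed.

Lemma leading_run x r : exists m b, r = nseq m x ++ b /\ ohead b != Some x.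
Proof.
elim: r => [|y r [m [b [-> hb]]]]; first by exists 0, [::].
have [->|ne] := eqVneq y x; first by exists m.+1, b.
exists 0, (y :: nseq m x ++ b); split=> //=.
Qed.

(** Take the last label [x] to appear.  Letters between or after its copies are
    older labels; one of them between two copies of [x] would produce a
    crossing.  Hence the copies of [x] are contiguous and can be removed, which
    makes induction on labelled words possible. *)
Lemma leafP k s : noncr s -> full k s -> s != [::] ->
  exists a x b, [/\ s = a ++ nseq k.+1 x ++ b, x \notin a, x \notin b & {subset b <= a}].
Proof.
move=> ncs fs s0; have [a [x [r [es xa ra]]]] := last_new s0.
have [m [b [er hb]]] := leading_run x r.
have xb : x \notin b.
  case: b er hb => // y b er hb; have ne : y != x by apply: contra hb => /eqP->.
  have ya : y \in a.
    have := ra y; rewrite er mem_cat mem_head orbT => /(_ isT).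
    by rewrite mem_rcons inE (negbTE ne).
  rewrite inE eq_sym negb_or ne /=; apply/negP=> xb.
  have := @noncr_cat _ a [:: x] (rcons (nseq m x) y) b y x.
  rewrite cat_rcons /= -er -es ya mem_head mem_rcons mem_head xb.
  by move=> /(_ ncs isT isT isT isT) e; rewrite e eqxx in ne.
have em : m = k.
  have := fs x; rewrite es er mem_cat mem_head orbT => /(_ isT).
  rewrite count_cat /= count_cat count_nseq /= eqxx mul1n.
  by rewrite (count_memPn xa) (count_memPn xb) add0n addn0 => -[].
exists a, x, b; split=> //; first by rewrite es er em.
move=> y yb; have := ra y; rewrite er mem_cat yb orbT => /(_ isT).
rewrite mem_rcons inE => /orP[/eqP e|//].
by rewrite e (negbTE xb) in yb.
Qed.

Lemma noncr_leaf_rest k a x b : noncr (a ++ nseq k x ++ b) -> noncr (a ++ b).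
Proof. by apply: noncr_subseq; rewrite cat_subseq ?suffix_subseq. Qed.

Lemma full_leaf_rest k a x b : x \notin a -> x \notin b ->
  full k (a ++ nseq k.+1 x ++ b) -> full k (a ++ b).
Proof.
move=> xa xb fs y yab; rewrite -(fs y); last first.
  by move: yab; rewrite !mem_cat => /orP[->|->]; rewrite ?orbT.
rewrite !count_cat count_nseq /= (_ : (x == y) = false) ?mul0n //.
by apply/negP=> /eqP e; move: yab; rewrite -e mem_cat (negbTE xa) (negbTE xb).
Qed.

Lemma firsts_leaf k a x b : x \notin a -> {subset b <= a} ->
  firsts (a ++ nseq k.+1 x ++ b) = firsts a ++ true :: nseq (k + size b) false.
Proof.
move=> xa ba; rewrite firsts_cat /= xa; congr (_ ++ _ :: _).
rewrite firsts_after_sub ?size_cat ?size_nseq // => y; rewrite mem_cat mem_rcons inE.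
by rewrite mem_nseq => /orP[/andP[_ ->]//|/ba->]; rewrite orbT.
Qed.

End Leaf.

Lemma last_true_inj (u v : seq bool) p q :
  u ++ true :: nseq p false = v ++ true :: nseq q false -> u = v /\ p = q.
Proof.
have key w m : index true (rev (w ++ true :: nseq m false)) = m.
  rewrite rev_cat rev_cons cat_rcons index_cat mem_rev mem_nseq andbF size_rev size_nseq.
  by rewrite /= addn0.
move=> e; have epq : p = q by rewrite -(key u p) e key.
have es : size u = size v.
  by have := congr1 size e; rewrite epq !size_cat => /addIn.
split=> //; move: e => /eqP; rewrite eqseq_cat // => /andP[/eqP//].
Qed.

(** The last up step of the path marks the leaf of [leafP] in both words; after
    its removal the words of first occurrences still agree. *)
Lemma firsts_iso (T U : eqType) (u0 : U) k (s : seq T) (t : seq U) :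
  noncr s -> full k s -> noncr t -> full k t -> firsts s = firsts t ->
  exists2 f : T -> U, {in s &, injective f} & t = map f s.
Proof.
have [m] := ubnP (size s); elim: m s t => // m IH s t lt_sm ncs fs nct ft e.
have sz : size s = size t by rewrite -size_firsts e size_firsts.
have [s0|s0] := eqVneq s [::].
  by exists (fun=> u0); rewrite s0 //; apply: size0nil; rewrite -sz s0.
have t0 : t != [::] by rewrite -size_eq0 -sz size_eq0.
have [a [x [b [es xa xb ba]]]] := leafP ncs fs s0.
have [a' [x' [b' [et xa' xb' ba']]]] := leafP nct ft t0.
move: e; rewrite es et !firsts_leaf // => /last_true_inj[ea /addnI eb].
have sa : size a = size a' by rewrite -size_firsts ea size_firsts.
have [] := IH (a ++ b) (a' ++ b').
- by move: lt_sm; rewrite es !size_cat size_nseq; lia.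
- by rewrite es in ncs; exact: noncr_leaf_rest ncs.
- by rewrite es in fs; exact: full_leaf_rest fs.
- by rewrite et in nct; exact: noncr_leaf_rest nct.
- by rewrite et in ft; exact: full_leaf_rest ft.
- by rewrite !firsts_cat !firsts_after_sub // ea eb.
move=> f injf /eqP; rewrite map_cat eqseq_cat ?size_map // => /andP[/eqP ea' /eqP eb'].
have xab : x \notin a ++ b by rewrite mem_cat negb_or xa.
have xab' : x' \notin a' ++ b' by rewrite mem_cat negb_or xa'.
pose g y := if y == x then x' else f y.
have gf r : x \notin r -> map g r = map f r.
  move=> xr; apply/eq_in_map => y yr; rewrite /g; case: eqP => // exy.
  by rewrite -exy yr in xr.
have fab y : y \in a ++ b -> f y \in a' ++ b'.
  by rewrite ea' eb' -map_cat; exact: map_f.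
exists g; last first.
  by rewrite !map_cat map_nseq !gf // -ea' -eb' /g eqxx.
have sub y : y \in s -> y != x -> y \in a ++ b.
  by rewrite es !mem_cat mem_nseq => /or3P[->|/andP[_ ->]|->]; rewrite ?orbT.
rewrite -es => y z ys zs; rewrite /g; case: (eqVneq y x) => [->|yx]; case: (eqVneq z x) => [->|zx] //.
- by move=> e; rewrite e fab ?sub in xab'.
- by move=> e; rewrite -e fab ?sub in xab'.
- by apply: injf; rewrite sub.
Qed.

(** * Promotion and evacuation of labelled words *)
Definition above k (w : seq bool) := count_mem false w <= k * count_mem true w.

Definition toggle_word k n i w :=
  if is_kdyck k n (swap_letters i w) then swap_letters i w else w.

Definition sweep_word k n m w := foldl (fun v i => toggle_word k n i v) w (iota 1 m).

Lemma path_of_wordE n k (D : kdyck n k) w :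
  path_of_word D w = (if is_kdyck k n w then w else D) :> seq bool.
Proof.
rewrite /path_of_word; case: pickP => [D' /eqP e|no] /=.
  by rewrite -e (kdyckP D').
case: ifP => // dw; have sw : size w == k.+1 * n by rewrite (size_kdyck dw).
by have := no (@KDyck n k (Tuple sw) dw); rewrite eqxx.
Qed.

Lemma toggleE n k i (D : kdyck n k) : toggle i D = toggle_word k n i D :> seq bool.
Proof. exact: path_of_wordE. Qed.

Lemma sweepE n k m (D : kdyck n k) : sweep m D = sweep_word k n m D :> seq bool.
Proof.
rewrite /sweep /sweep_word; elim: (iota 1 m) D => //= i r IH D.
by rewrite IH toggleE.
Qed.

Lemma toggle_kdyck k n i w : is_kdyck k n w -> is_kdyck k n (toggle_word k n i w).
Proof. by rewrite /toggle_word; case: ifP. Qed.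

Lemma sweep_kdyck k n m w : is_kdyck k n w -> is_kdyck k n (sweep_word k n m w).
Proof.
rewrite /sweep_word; elim: (iota 1 m) w => //= i r IH w dw.
by apply: IH; exact: toggle_kdyck.
Qed.

Lemma above_prefix k n w v : is_kdyck k n (w ++ v) -> above k w.
Proof. by case/is_kdyckP=> _ _ /(_ (size w)); rewrite take_size_cat. Qed.

Lemma swap_lettersE a b (u v : seq bool) :
  swap_letters (size u).+1 (u ++ a :: b :: v) = u ++ b :: a :: v.
Proof.
rewrite /swap_letters /= take_size_cat // !nth_cat ltnn subnn ltnNge leqnSn /= subSnn /=.
rewrite drop_cat (_ : (size u).+2 < size u = false); last by lia.
by rewrite (_ : (size u).+2 - size u = 2) /= ?drop0; last by lia.
Qed.

Lemma kdyck_swap k n a b u v : is_kdyck k n (u ++ a :: b :: v) ->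
  is_kdyck k n (u ++ b :: a :: v) = above k (rcons u b).
Proof.
move=> dw; apply/idP/idP => [|ok].
  by rewrite -cat_rcons; exact: above_prefix.
have [wU wR wP] := is_kdyckP _ _ _ dw.
apply/is_kdyckP; split.
- by rewrite -wU !count_cat /=; congr (_ + _); rewrite addnCA.
- by rewrite -wR !count_cat /=; congr (_ + _); rewrite addnCA.
move=> i; have := wP i; rewrite !take_cat; case: ltnP => // le_ui.
case: (i - size u) => [|[|j]] /=; rewrite ?take0 //.
  by move=> _; move: ok; rewrite /above -cats1.
by rewrite !count_cat /=; lia.
Qed.

Lemma toggle_wordE k n a b u v : is_kdyck k n (u ++ a :: b :: v) ->
  toggle_word k n (size u).+1 (u ++ a :: b :: v) =
  if above k (rcons u b) then u ++ b :: a :: v else u ++ a :: b :: v.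
Proof. by move=> dw; rewrite /toggle_word swap_lettersE kdyck_swap. Qed.

(** The up step travels to the right as long as what it passes stays above the
    line without it. *)
Lemma carry_up k n u m v : is_kdyck k n (u ++ true :: m ++ v) ->
  (forall i, above k (u ++ take i m)) ->
  foldl (fun w i => toggle_word k n i w) (u ++ true :: m ++ v) (iota (size u).+1 (size m))
  = u ++ m ++ true :: v.
Proof.
elim: m u => //= b m IH u dw ok.
rewrite toggle_wordE //; have -> : above k (rcons u b) by have := ok 1; rewrite /= take0 cats1.
have e x : u ++ b :: x = rcons u b ++ x by rewrite cat_rcons.
have dw' : is_kdyck k n (rcons u b ++ true :: m ++ v).
  by have := ok 1; rewrite /= take0 cats1 -e kdyck_swap.
rewrite e -(size_rcons u b) (IH _ dw') ?cat_rcons // => i.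
by have := ok i.+1; rewrite /= e.
Qed.

Lemma carry_right k n u m v : is_kdyck k n (u ++ false :: m ++ v) ->
  foldl (fun w i => toggle_word k n i w) (u ++ false :: m ++ v) (iota (size u).+1 (size m))
  = u ++ m ++ false :: v.
Proof.
elim: m u => //= b m IH u dw.
have ok : above k (rcons u b).
  have := dw; case: b {dw} => dw.
    have := above_prefix dw; rewrite /above -cats1 !count_cat /=; lia.
  by apply: (@above_prefix k n _ (false :: m ++ v)); rewrite cat_rcons.
have e x : u ++ b :: x = rcons u b ++ x by rewrite cat_rcons.
have dw' : is_kdyck k n (rcons u b ++ false :: m ++ v) by rewrite -e kdyck_swap.
by rewrite toggle_wordE // ok e -(size_rcons u b) (IH _ dw') cat_rcons.
Qed.

Lemma sweep_open k n v z : is_kdyck k n (true :: v ++ z) ->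
  (forall i, above k (take i v)) ->
  sweep_word k n (size v) (true :: v ++ z) = v ++ true :: z.
Proof. exact: (@carry_up k n [::]). Qed.

(** The up step is stopped where [u] returns to the line.  The toggle at that
    place fixes the path, and from then on the right step is carried along. *)
Lemma sweep_close k n u v z : is_kdyck k n (true :: u ++ false :: v ++ z) ->
  (forall i, above k (take i u)) -> count_mem false u = k * count_mem true u ->
  sweep_word k n (size u + size v).+1 (true :: u ++ false :: v ++ z)
  = u ++ true :: v ++ false :: z.
Proof.
move=> dw ok bal.
have es : sweep_word k n (size u) (true :: u ++ false :: v ++ z) = u ++ true :: false :: v ++ z.
  exact: sweep_open.
have dw' : is_kdyck k n (u ++ true :: false :: v ++ z) by rewrite -es sweep_kdyck.
rewrite /sweep_word -addnS iotaD foldl_cat -/(sweep_word _ _ _ _) es add1n /=.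
rewrite toggle_wordE // /above -cats1 !count_cat /= bal addn0 mulnDr muln0 addn0 addn1 ltnn.
rewrite -cat_rcons -(size_rcons u true) carry_right ?cat_rcons //.
Qed.

Lemma first_split (T : eqType) (x : T) s : x \in s -> exists t r, s = t ++ x :: r /\ x \notin t.
Proof.
elim: s => // y s IH; have [->|ne] := eqVneq x y; first by exists [::], s.
rewrite inE (negbTE ne) => /IH[t [r [-> xt]]]; exists (y :: t), r.
by rewrite inE negb_or ne.
Qed.

Section Labels.
Variables (T : eqType) (k n : nat).
Implicit Types (s pre : seq T) (x : T).

Lemma above_firsts s : (forall x, x \in s -> count_mem x s <= k.+1) -> above k (firsts s).
Proof.
move=> h; have := leq_size_undup h; have := count_firstsF s; rewrite /above count_firsts; lia.
Qed.

Lemma above_firsts_sub s t : subseq s t -> full k t -> above k (firsts s).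
Proof.
move=> st ft; apply: above_firsts => x xs; rewrite -(ft x (mem_subseq st xs)).
exact: leq_count_subseq.
Qed.

Lemma bal_firsts s : full k s -> count_mem false (firsts s) = k * count_mem true (firsts s).
Proof.
move=> h; have := size_undup_full h; have := count_firstsF s; rewrite count_firsts; lia.
Qed.

(** A sweep moves the first letter [x] to the end of [s].  If [x] recurs, the
    stretch [t] before its second copy shares no label with the rest, because
    the word is non-crossing; so the path returns to the line exactly before
    that copy, which takes over the role of first occurrence.  The word [pre]
    consists of the letters still to be reached by no sweep: longer sweeps have
    moved them beyond [z]. *)
Lemma sweep_firsts pre x s z : noncr (pre ++ x :: s) -> full k (pre ++ x :: s) ->
  is_kdyck k n (firsts (x :: s) ++ z) ->
  sweep_word k n (size s) (firsts (x :: s) ++ z) = firsts s ++ (x \notin s) :: z.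
Proof.
move=> nc fu; have [xs|xs] := boolP (x \in s); last first.
  have -> : firsts (x :: s) = true :: firsts s.
    rewrite /firsts /= (@firsts_disjoint _ [:: x]) // => y ys.
    by rewrite inE; apply: contraNneq xs => <-.
  move=> dw; rewrite -(size_firsts s) sweep_open // => i.
  rewrite take_firsts; apply: above_firsts_sub fu.
  apply: subseq_trans (suffix_subseq _ _); apply: subseq_trans (subseq_cons _ _).
  exact: take_subseq.
have [t [r [es xt]]] := first_split xs.
have ncx : noncr ((pre ++ [:: x]) ++ t ++ [:: x] ++ r) by rewrite -catA /= -es.
have tpre y : y \in t -> y \notin pre.
  move=> yt; apply/negP=> ypre; have := @noncr_cat _ pre [:: x] t (x :: r) y x.
  by rewrite /= -es ypre yt !mem_head => /(_ nc isT isT isT isT) e; rewrite -e yt in xt.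
have tr y : y \in t -> y \notin r.
  move=> yt; apply/negP=> yr; have := noncr_cat ncx _ yt (mem_head _ _) yr.
  by rewrite mem_cat mem_head orbT => /(_ isT) e; rewrite e yt in xt.
have ft : full k t.
  move=> y yt; have yx : (x == y) = false by apply: contraNF xt => /eqP->.
  rewrite -(fu y); last by rewrite es mem_cat inE mem_cat yt !orbT.
  rewrite es !count_cat /= !count_cat /= yx (count_memPn (tpre y yt)) (count_memPn (tr y yt)).
  by lia.
have e1 : firsts (x :: s) = true :: firsts t ++ false :: firsts_after (x :: t) r.
  rewrite /firsts es /= firsts_after_cat /= mem_head.
  rewrite (@firsts_disjoint _ [:: x]) => [|y yt]; last by rewrite inE; apply: contraNneq xt => <-.
  congr (_ :: _ ++ _ :: _); apply: eq_firsts_after => y.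
  by rewrite !(mem_rcons, inE); case: (y == x).
have e2 : firsts s = firsts t ++ true :: firsts_after (x :: t) r.
  rewrite es firsts_cat /= xt; congr (_ ++ _ :: _); apply: eq_firsts_after => y.
  by rewrite mem_rcons.
have sz : size s = (size (firsts t) + size (firsts_after (x :: t) r)).+1.
  by rewrite es size_cat /= addnS size_firsts size_firsts_after.
rewrite e1 e2 sz /= -catA /= => dw; rewrite sweep_close // -?catA //; last exact: bal_firsts.
move=> i; rewrite take_firsts; apply: above_firsts_sub fu.
apply: subseq_trans (suffix_subseq _ _); apply: subseq_trans (subseq_cons _ _).
by rewrite es; apply: subseq_trans (take_subseq _ _) (prefix_subseq _ _).
Qed.

Lemma promotion_firsts (D : kdyck n k) s : noncr s -> full k s -> D = firsts s :> seq bool ->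
  promotion D = firsts (rot 1 s) :> seq bool.
Proof.
move=> nc fu eD; rewrite /promotion sweepE eD.
have sD := size_kdyck (kdyckP D); have dD := kdyckP D; rewrite eD in sD dD.
rewrite -sD size_firsts; case: s nc fu {eD sD} dD => [|x s] // nc fu dD.
have := @sweep_firsts [::] x s [::] nc fu; rewrite cats0 => /(_ dD) /= ->.
by rewrite rot1_cons firsts_rcons cats1.
Qed.

(** Sweeps of decreasing lengths move the letters to the end one after the other,
    each stopping before those already moved: the word is reversed. *)
Lemma sweeps_firsts pre s z : noncr (pre ++ s) -> full k (pre ++ s) ->
  is_kdyck k n (firsts s ++ z) ->
  foldl (fun w m => sweep_word k n m w) (firsts s ++ z) (rev (iota 1 (size s).-1))
  = firsts (rev s) ++ z.
Proof.
elim: s pre z => // x s IH pre z nc fu dw.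
have sw := sweep_firsts nc fu dw.
have dw' : is_kdyck k n (firsts s ++ (x \notin s) :: z) by rewrite -sw sweep_kdyck.
rewrite rev_cons firsts_rcons mem_rev cat_rcons -(IH (rcons pre x)) ?cat_rcons // {IH}.
case: s nc fu dw dw' sw => [|y s] // nc fu dw dw' sw.
by rewrite -[(size (x :: y :: s)).-1]addn1 iotaD rev_cat foldl_cat add1n /= -/(iota 1 _) -[(size s).+1]/(size (y :: s)) sw.
Qed.

Lemma evacuationE (D : kdyck n k) :
  evacuation D = foldl (fun w m => sweep_word k n m w) D (rev (iota 1 (k.+1 * n).-1)) :> seq bool.
Proof.
by rewrite /evacuation; elim: (rev _) D => //= m r IH D; rewrite IH sweepE.
Qed.

Lemma evacuation_firsts (D : kdyck n k) s : noncr s -> full k s -> D = firsts s :> seq bool ->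
  evacuation D = firsts (rev s) :> seq bool.
Proof.
move=> nc fu eD; rewrite evacuationE.
have sD := size_kdyck (kdyckP D); have dD := kdyckP D; rewrite eD in sD dD.
rewrite eD -sD size_firsts -[firsts s]cats0 -[RHS]cats0.
by apply: (@sweeps_firsts [::]); rewrite ?cats0.
Qed.
End Labels.

Lemma promotion_close n k (D : kdyck n k) u v : D = true :: u ++ false :: v :> seq bool ->
  (forall i, above k (take i u)) -> count_mem false u = k * count_mem true u ->
  promotion D = u ++ true :: rcons v false :> seq bool.
Proof.
move=> eD ok bal; rewrite /promotion sweepE.
have dD := kdyckP D; have := size_kdyck dD; rewrite eD => <- /=.
have := @sweep_close k n u v [::]; rewrite !cats0 -eD => /(_ dD ok bal).
by rewrite size_cat /= addnS cats1.
Qed.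

(** * Blocks and cyclic successors *)
Definition same r (P : {set {set 'I_r}}) : rel 'I_r := fun x y => y \in pblock P x.

(** The number of points strictly between [p] and [x] clockwise, where [p] counts
    as the farthest point from itself. *)
Definition cdist r (p x : nat) := if p < x then x - p.+1 else x + r - p.+1.

(** The permutation whose cycles are the blocks of [P], run through clockwise. *)
Definition nx r (P : {set {set 'I_r}}) (p : 'I_r) : 'I_r :=
  [arg min_(x < p | same P p x) cdist r p x].

Lemma cdist_inj r (p x y : 'I_r) : cdist r p x = cdist r p y -> x = y.
Proof.
rewrite /cdist => e; apply: val_inj => /=; have := ltn_ord p; have := ltn_ord x.
have := ltn_ord y; move: e; do ?case: ifP; lia.
Qed.

(** The right-hand side involves comparisons only, so strictly increasing maps
    preserve the order by [cdist], whatever the distances. *)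
Lemma cdist_leE r (p x y : 'I_r) : (cdist r p x <= cdist r p y) =
  if p < x then ~~ (p < y) || ~~ (y < x) else ~~ (p < y) && ~~ (y < x).
Proof.
rewrite /cdist; have := ltn_ord p; have := ltn_ord x; have := ltn_ord y.
case: (ltnP p x) => px; case: (ltnP p y) => py /= ly lx lp; rewrite -?leqNgt; apply/idP/idP; lia.
Qed.

Section Same.
Variables (r : nat) (P : {set {set 'I_r}}).
Hypothesis pP : partition P [set: 'I_r].
Let cP : cover P = [set: 'I_r]. Proof. by case/and3P: pP => /eqP. Qed.
Let tP : trivIset P. Proof. by case/and3P: pP. Qed.

Lemma same_pblockE x y : same P x y = (pblock P x == pblock P y).
Proof. by rewrite eq_pblock ?cP ?inE. Qed.

Lemma same_refl x : same P x x.
Proof. by rewrite same_pblockE. Qed.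

Lemma same_sym x y : same P x y = same P y x.
Proof. by rewrite !same_pblockE eq_sym. Qed.

Lemma same_trans x y z : same P x y -> same P y z -> same P x z.
Proof. by rewrite !same_pblockE => /eqP->. Qed.

Lemma pblock_in x : pblock P x \in P.
Proof. by rewrite pblock_mem // cP inE. Qed.

Lemma sameP x y : reflect (exists2 B, B \in P & (x \in B) && (y \in B)) (same P x y).
Proof.
apply: (iffP idP) => [xy|[B BP /andP[xB yB]]].
  by exists (pblock P x); rewrite ?pblock_in // mem_pblock cP inE.
by rewrite /same (def_pblock tP BP xB).
Qed.

Lemma same_block B x y : B \in P -> x \in B -> (y \in B) = same P x y.
Proof. by move=> BP xB; rewrite /same (def_pblock tP BP xB). Qed.

Lemma nx_same p : same P p (nx P p).
Proof. by rewrite /nx; case: arg_minnP => //; exact: same_refl. Qed.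

Lemma nx_min p x : same P p x -> cdist r p (nx P p) <= cdist r p x.
Proof. by rewrite /nx; case: arg_minnP => [|i _ h /h//]; exact: same_refl. Qed.

Lemma nxE p q : same P p q -> (forall x, same P p x -> cdist r p q <= cdist r p x) ->
  nx P p = q.
Proof.
move=> pq h; apply: (@cdist_inj r p); apply/eqP.
by rewrite eqn_leq nx_min // h // nx_same.
Qed.

Lemma noncrossing_same (i j l m : 'I_r) : noncrossing P -> i < j -> j < l -> l < m ->
  same P i l -> same P j m -> same P i j.
Proof.
move=> /noncrossingP nc ij jl lm /sameP[B BP /andP[iB lB]] /sameP[C CP /andP[jC mC]].
apply/sameP; exists B => //; rewrite iB /=.
by rewrite (nc B C i j l m) // ij jl lm.
Qed.

End Same.

Lemma same_noncrossing r (P : {set {set 'I_r}}) : partition P [set: 'I_r] ->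
  (forall i j l m : 'I_r, i < j -> j < l -> l < m -> same P i l -> same P j m -> same P i j) ->
  noncrossing P.
Proof.
move=> pP h; apply/noncrossingP => B C i j l m BP CP iB jC lB mC /and3P[ij jl lm].
have := h i j l m ij jl lm; rewrite -!(same_block pP _ BP iB) -!(same_block pP _ CP jC) lB mC.
move=> /(_ isT isT) jB; have /and3P[_ tP _] := pP.
by rewrite -(def_pblock tP BP jB) (def_pblock tP CP jC).
Qed.

Lemma eq_same r (P Q : {set {set 'I_r}}) : partition P [set: 'I_r] ->
  partition Q [set: 'I_r] -> same P =2 same Q -> P = Q.
Proof.
move=> pP pQ e; have sub (P1 Q1 : {set {set 'I_r}}) : partition P1 [set: 'I_r] ->
    partition Q1 [set: 'I_r] -> same P1 =2 same Q1 -> P1 \subset Q1.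
  move=> p1 q1 e1; apply/subsetP => B BP; have /and3P[_ t1 n1] := p1.
  have /set0Pn[x xB] : B != set0 by apply: contraNneq n1 => <-.
  suff -> : B = pblock Q1 x by apply: pblock_in.
  by apply/setP => y; rewrite -/(same Q1 x y) -e1 -(same_block p1 _ BP).
by apply/eqP; rewrite eqEsubset !sub // => x y; rewrite e.
Qed.

Lemma refinesE r (P Q : {set {set 'I_r}}) : partition P [set: 'I_r] ->
  partition Q [set: 'I_r] -> reflect (forall x y, same Q x y -> same P x y) (refines Q P).
Proof.
move=> pP pQ; apply: (iffP forall_inP) => [h x y /(sameP pQ)[B /h/exists_inP[C CP /subsetP BC] /andP[xB yB]]|h B BQ].
  by apply/(sameP pP); exists C; rewrite ?BC.
have /and3P[_ _ n0] := pQ; have /set0Pn[x xB] : B != set0 by apply: contraNneq n0 => <-.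
apply/exists_inP; exists (pblock P x); first exact: pblock_in.
by apply/subsetP => y; rewrite (same_block pQ _ BQ xB) => /h.
Qed.

(** The iterates of [nx P] reach every point of a block, by induction on the
    distance that remains. *)
Lemma nx_inj r (P Q : {set {set 'I_r}}) : partition P [set: 'I_r] ->
  partition Q [set: 'I_r] -> nx P =1 nx Q -> P = Q.
Proof.
have key (P1 Q1 : {set {set 'I_r}}) : partition P1 [set: 'I_r] ->
    partition Q1 [set: 'I_r] -> nx P1 =1 nx Q1 -> forall x y, same P1 x y -> same Q1 x y.
  move=> p1 q1 e x y; have [m] := ubnP (cdist r x y); elim: m x => // m IH x lt_m xy.
  have [->|ne] := eqVneq y (nx P1 x); first by rewrite e nx_same.
  apply: (same_trans q1 (y := nx P1 x)); first by rewrite e nx_same.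
  apply: IH; last by apply: (same_trans p1) xy; rewrite same_sym // nx_same.
  have := nx_min p1 xy; have : cdist r x y != cdist r x (nx P1 x).
    by apply: contra ne => /eqP/cdist_inj->.
  move: lt_m; have := ltn_ord x; have := ltn_ord y; have := ltn_ord (nx P1 x).
  by rewrite /cdist; do ?case: ifP; lia.
move=> pP pQ e; apply: eq_same => // x y; apply/idP/idP; apply: key => // z; by rewrite e.
Qed.

Lemma same_singletons r (x y : 'I_r) : same (singletons r) x y = (x == y).
Proof.
apply/(sameP (partition_singletons r))/eqP => [[_ /imsetP[z _ ->]]|->].
  by rewrite !inE => /andP[/eqP-> /eqP->].
by exists [set y]; rewrite ?set11 // imset_f.
Qed.

Lemma nx_singletons r (p : 'I_r) : nx (singletons r) p = p.
Proof.
have pS := partition_singletons r; apply: nxE => //; first exact: same_refl.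
by move=> x; rewrite same_singletons => /eqP->.
Qed.

Lemma nx_top r (p : 'I_r) : partition [set [set: 'I_r]] [set: 'I_r] ->
  nx [set [set: 'I_r]] p = ordS p.
Proof.
move=> pT; have st x y : same [set [set: 'I_r]] x y.
  by apply/(sameP pT); exists [set: 'I_r]; rewrite ?inE.
apply: nxE => // x _; rewrite /cdist /=.
have := ltn_ord p; have := ltn_ord x => lx lp.
have [e|ne] := eqVneq (p.+1 : nat) r; first by rewrite e modnn; do ?case: ifP; lia.
by rewrite modn_small; [do ?case: ifP; lia|lia].
Qed.

Lemma ltn_enum_val r (B : {set 'I_r}) (x y : 'I_#|B|) : (enum_val x < enum_val y) = (x < y).
Proof.
have srt : sorted (fun i j : 'I_r => i < j) (enum B).
  rewrite /enum_mem sorted_filter //; first by move=> i j l; exact: ltn_trans.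
  by rewrite -enumT -(@sorted_map _ _ val ltn) val_enum_ord iota_ltn_sorted.
have mono (u v : 'I_#|B|) : u < v -> enum_val u < enum_val v.
  move=> uv; have d := enum_val u; rewrite (enum_val_nth d u) (enum_val_nth d v).
  by apply: (sorted_ltn_nth _ _ srt) => //; rewrite ?inE -?cardE //; move=> i j l; exact: ltn_trans.
apply/idP/idP => [h|]; last exact: mono.
rewrite ltnNge; apply/negP; rewrite leq_eqVlt => /orP[/eqP e|/mono].
  by rewrite (val_inj e) ltnn in h.
by rewrite ltnNge ltnW.
Qed.

Lemma same_restrict r (B : {set 'I_r}) (P : {set {set 'I_r}}) x y :
  partition P [set: 'I_r] -> same (restrict B P) x y = same P (enum_val x) (enum_val y).
Proof.
move=> pP; apply/(sameP (partition_restrict B pP))/(sameP pP) => [[_ /imsetP[C /setIdP[CP _] ->]]|].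
  by rewrite !inE => h; exists C.
case=> C CP /andP[xC yC]; exists [set z : 'I_#|B| | enum_val z \in C].
  apply: mem_restrict => //; apply/set0Pn; exists (enum_val x).
  by rewrite inE xC enum_valP.
by rewrite !inE xC.
Qed.

Lemma nx_restrict r (B : {set 'I_r}) (P : {set {set 'I_r}}) x :
  partition P [set: 'I_r] -> (forall u v, u \in B -> same P u v -> v \in B) ->
  enum_val (nx (restrict B P) x) = nx P (enum_val x).
Proof.
move=> pP clB; have pR := partition_restrict B pP.
have nB : nx P (enum_val x) \in B by apply: clB (enum_valP x) (nx_same pP _).
suff -> : nx (restrict B P) x = enum_rank_in nB (nx P (enum_val x)) by rewrite enum_rankK_in.
apply: nxE => //; first by rewrite same_restrict // enum_rankK_in // nx_same.
move=> y; rewrite same_restrict // => /(nx_min pP).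
have := enum_rankK_in nB nB; set q := enum_rank_in _ _ => <-.
by rewrite !cdist_leE !ltn_enum_val.
Qed.

Lemma noncrossing_restrict r (B : {set 'I_r}) (P : {set {set 'I_r}}) :
  partition P [set: 'I_r] -> noncrossing P -> noncrossing (restrict B P).
Proof.
move=> pP nc; apply: same_noncrossing; first exact: partition_restrict.
move=> i j l m ij jl lm; rewrite !same_restrict //.
by apply: noncrossing_same; rewrite ?ltn_enum_val.
Qed.

Lemma refines_restrict r (B : {set 'I_r}) (P Q : {set {set 'I_r}}) :
  partition P [set: 'I_r] -> partition Q [set: 'I_r] ->
  refines Q P -> refines (restrict B Q) (restrict B P).
Proof.
move=> pP pQ /(refinesE pP pQ) h; apply/refinesE; try exact: partition_restrict.
by move=> x y; rewrite !same_restrict //; apply: h.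
Qed.

Lemma noncrossing_singletons r : noncrossing (singletons r).
Proof.
apply: same_noncrossing (partition_singletons r) _ => i j l m ij jl lm.
by rewrite !same_singletons => /eqP e; rewrite e in ij; lia.
Qed.

Lemma refines_singletons r (P : {set {set 'I_r}}) : partition P [set: 'I_r] ->
  refines (singletons r) P.
Proof.
move=> pP; apply/refinesE => // [|x y]; first exact: partition_singletons.
by rewrite same_singletons => /eqP->; exact: same_refl.
Qed.

Lemma refines_trans r (P Q S : {set {set 'I_r}}) : refines Q P -> refines S Q -> refines S P.
Proof.
move=> /forall_inP QP /forall_inP SQ; apply/forall_inP => B /SQ/exists_inP[C /QP/exists_inP[D DP CD] BC].
by apply/exists_inP; exists D => //; exact: subset_trans CD.
Qed.

(** * The label word of a chain *)

(** Listing the partitions from the finest to the coarsest makes the labels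
    after [p] run backwards through the points beyond [p], so that the groups of
    different points can be concatenated without crossings. *)
Definition lab r (c : seq {set {set 'I_r}}) (p : 'I_r) : seq 'I_r :=
  p :: [seq nx P p | P <- rev c].

Definition labels r (c : seq {set {set 'I_r}}) : seq 'I_r :=
  flatten [seq lab c p | p <- enum 'I_r].

Lemma size_lab r (c : seq {set {set 'I_r}}) p : size (lab c p) = (size c).+1.
Proof. by rewrite /= size_map size_rev. Qed.

Lemma size_flatten_map (T U : Type) k (G : T -> seq U) s : (forall x, size (G x) = k) ->
  size (flatten (map G s)) = k * size s.
Proof. by move=> h; elim: s => [|x s IH] /=; rewrite ?muln0 // size_cat h IH mulnS. Qed.

Lemma sorted_enum_ord r (A : {pred 'I_r}) : sorted (fun i j : 'I_r => i < j) (enum A).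
Proof.
rewrite /enum_mem sorted_filter //; first by move=> i j l; exact: ltn_trans.
by rewrite -enumT -(@sorted_map _ _ val ltn) val_enum_ord iota_ltn_sorted.
Qed.

Lemma eq_sorted_ord r (s t : seq 'I_r) : sorted (fun i j : 'I_r => i < j) s ->
  sorted (fun i j : 'I_r => i < j) t -> s =i t -> s = t.
Proof.
apply: irr_sorted_eq; first by move=> i j l; exact: ltn_trans.
by move=> i; rewrite ltnn.
Qed.

(** [B] lies in a single gap of [A]. *)
Lemma enum_setU_insert r (A B : {set 'I_r}) m :
  (forall p x : 'I_r, p \in A -> x \in B -> p < m -> p < x) ->
  (forall p x : 'I_r, p \in A -> x \in B -> m <= p -> x < p) ->
  enum (A :|: B) = [seq p : 'I_r <- enum A | p < m] ++ enum B ++ [seq p : 'I_r <- enum A | m <= p].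
Proof.
move=> lo hi; apply: eq_sorted_ord; first exact: sorted_enum_ord.
  have tr : transitive (fun i j : 'I_r => i < j) by move=> i j l; exact: ltn_trans.
  have pw (C : {set 'I_r}) (q : pred 'I_r) :
      pairwise (fun i j : 'I_r => i < j) [seq p <- enum C | q p].
    by rewrite -sorted_pairwise //; apply: sorted_filter => //; exact: sorted_enum_ord.
  rewrite sorted_pairwise // !pairwise_cat !pw -[enum B](filter_predT) pw !andbT filter_predT allrel_catr -andbA /=.
  apply/and3P; split.
  - apply/allrelP => p x; rewrite mem_filter !mem_enum => /andP[pm pA] xB; exact: lo.
  - apply/allrelP => p x; rewrite mem_filter mem_enum mem_filter mem_enum => /andP[pm pA] /andP[mx xA].
    exact: leq_trans mx.
  - apply/allrelP => p x; rewrite mem_enum mem_filter mem_enum => pB /andP[mx xA]; exact: hi.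
move=> x; rewrite mem_enum in_setU !mem_cat mem_enum mem_filter mem_enum mem_filter mem_enum.
by case: (leqP m x); case: (x \in A); case: (x \in B).
Qed.

Lemma enum_split r (A : {set 'I_r}) m :
  enum A = [seq p : 'I_r <- enum A | p < m] ++ [seq p : 'I_r <- enum A | m <= p].
Proof.
have := @enum_setU_insert r A set0 m; rewrite setU0 enum_set0 cat0s; apply=> p x _; by rewrite inE.
Qed.

Lemma size_enum_lt r (A : {set 'I_r}) m :
  size [seq p : 'I_r <- enum A | p < m] = #|[set p in A | p < m]|.
Proof.
rewrite cardE; apply: perm_size; apply: uniq_perm; [exact: (filter_uniq _ (enum_uniq _))|exact: enum_uniq|].
by move=> x; rewrite mem_filter !mem_enum inE andbC.
Qed.

Section Blocks.
Variables (k r : nat) (P : {set {set 'I_r}}) (G : 'I_r -> seq 'I_r) (mu : {set 'I_r} -> seq bool).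
Hypotheses (pP : partition P [set: 'I_r]) (ncP : noncrossing P).
Hypothesis sG : forall p, size (G p) = k.+1.
Hypothesis GP : forall p, {subset G p <= pblock P p}.
Let word (A : {set 'I_r}) := flatten [seq G p | p <- enum A].
Hypothesis ncG : forall B, B \in P -> noncr (word B).
Hypothesis fuG : forall B, B \in P -> full k (word B).
Hypothesis muG : forall B, B \in P -> mu B = firsts (word B).

(** The blocks come with increasing minima, so by non-crossing a new block lies in
    one gap of the union of the earlier ones, and its labels are new.  Inserting
    its path at the prescribed place is inserting its labelled word there. *)
Lemma insert_blocks_firsts :
  [/\ (foldl (insert_block k mu) (set0, [::]) (blocks_by_min P)).2
        = firsts (flatten [seq G p | p <- enum 'I_r]),
      noncr (flatten [seq G p | p <- enum 'I_r])
    & full k (flatten [seq G p | p <- enum 'I_r])].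
Proof.
have [/eqP cP tP P0] := and3P pP.
have srt : sorted (fun B C : {set 'I_r} => block_min B <= block_min C) (blocks_by_min P).
  by apply: sort_sorted => B C; exact: leq_total.
have memP B : (B \in blocks_by_min P) = (B \in P) by rewrite mem_sort mem_enum.
have unP : uniq (blocks_by_min P) by rewrite sort_uniq enum_uniq.
have cvP : \bigcup_(B <- blocks_by_min P) B = [set: 'I_r].
  by rewrite -cP /cover -big_enum; apply: perm_big; rewrite perm_sort.
have {}srt : pairwise (fun B C : {set 'I_r} => block_min B <= block_min C) (blocks_by_min P).
  by rewrite -sorted_pairwise // => B C D; exact: leq_trans.
have {}memP : {subset blocks_by_min P <= P} by move=> B; rewrite memP.
have minP B : B \in P -> exists2 i : 'I_r, i \in B & block_min B = i.
  by move=> BP; apply: block_min_in; apply: contraNneq P0 => <-.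
have wordE (A : {set 'I_r}) x : x \in word A -> exists2 p, p \in A & same P p x.
  case/flattenP=> _ /mapP[p + ->] /GP px; rewrite mem_enum => pA.
  by exists p.
have key s : uniq s -> {subset s <= P} ->
   pairwise (fun B C : {set 'I_r} => block_min B <= block_min C) s ->
   let st := foldl (insert_block k mu) (set0, [::]) s in
   [/\ st.1 = \bigcup_(B <- s) B, st.2 = firsts (word st.1), noncr (word st.1)
     & full k (word st.1)].
  elim/last_ind: s => [|s B IHs].
    move=> _ _ _ /=; rewrite big_nil /word enum_set0 /=; split=> //.
  rewrite rcons_uniq => /andP[Bs us] sP; rewrite pairwise_rcons => /andP[/allP hB ps].
  have {IHs} := IHs us _ ps.
  case=> [C Cs|]; first by apply: sP; rewrite mem_rcons inE Cs orbT.
  rewrite foldl_rcons /=; case: (foldl _ _ s) => cov w /= ecov -> ncw fuw.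
  have BP : B \in P by apply: sP; rewrite mem_rcons inE eqxx.
  have [b bB mB] := minP B BP.
  have covE p : p \in cov -> exists C, [/\ C \in P, C != B, p \in C & block_min C <= b].
    rewrite ecov; elim: {ecov ps us} s hB sP Bs => [|C s IH] hB sP Bs.
      by rewrite big_nil inE.
    rewrite big_cons inE => /orP[pC|]; last first.
      apply: IH => [D Ds|D|]; first by apply: hB; rewrite inE Ds orbT.
        by rewrite mem_rcons inE => /orP[/eqP->//|Ds]; apply: sP; rewrite mem_rcons !inE Ds !orbT.
      by move: Bs; rewrite inE negb_or => /andP[].
    exists C; split=> //; first by apply: sP; rewrite mem_rcons !inE eqxx orbT.
      by move: Bs; rewrite inE negb_or eq_sym => /andP[].
    by rewrite -mB; apply: hB; rewrite mem_head.
  have hi (p x : 'I_r) : p \in cov -> x \in B -> block_min B <= p -> x < p.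
    move=> /covE[C [CP neCB pC mCb]] xB; rewrite mB => le_bp.
    have npB : p \notin B.
      by apply: contra neCB => pB; rewrite -(def_pblock tP CP pC) (def_pblock tP BP pB).
    have lt_bp : b < p.
      rewrite ltn_neqAle le_bp andbT; apply: contra npB => /eqP e.
      by rewrite -(val_inj e).
    rewrite ltnNge; apply/negP => le_px.
    have lt_px : p < x.
      rewrite ltn_neqAle le_px andbT; apply: contra npB => /eqP e.
      by rewrite (val_inj e).
    have [i iC mC] := minP C CP.
    have lt_ib : i < b.
      rewrite ltn_neqAle -[X in _ && X]/(i <= b) -{2}mC mCb andbT.
      apply: contra neCB => /eqP e.
      by rewrite -(def_pblock tP CP iC) (val_inj e) (def_pblock tP BP bB).
    have := noncrossing_same pP ncP lt_ib lt_bp lt_px.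
    rewrite -!(same_block pP _ CP iC) -(same_block pP _ BP bB) pC xB => /(_ isT isT) bC.
    by case/eqP: neCB; rewrite -(def_pblock tP CP bC) (def_pblock tP BP bB).
  have lo (p x : 'I_r) : p \in cov -> x \in B -> p < block_min B -> p < x.
    by move=> _ xB lt_p; apply: leq_trans lt_p _; exact: block_min_le.
  have eU := enum_setU_insert lo hi; have eC := enum_split cov (block_min B).
  set a := [seq p : 'I_r <- enum cov | p < block_min B] in eU eC.
  set d := [seq p : 'I_r <- enum cov | block_min B <= p] in eU eC.
  have wU : word (cov :|: B) = flatten (map G a) ++ word B ++ flatten (map G d).
    by rewrite /word eU !map_cat !flatten_cat.
  have wC : word cov = flatten (map G a) ++ flatten (map G d).
    by rewrite /word eC map_cat flatten_cat.
  have dis x : x \in word B -> x \notin word cov.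
    move=> /wordE[p pB px]; apply/negP => /wordE[q qcov qx].
    have [C [CP neCB qC _]] := covE q qcov.
    have pq : same P p q by apply: (same_trans pP px); rewrite same_sym.
    case/eqP: neCB; rewrite -(def_pblock tP CP qC) -(def_pblock tP BP pB).
    by apply/esym/eqP; rewrite -same_pblockE.
  split.
  - by rewrite -cats1 big_cat big_seq1 ecov.
  - rewrite muG // wU wC /insert_at -size_enum_lt -/a -(size_flatten_map a sG).
    rewrite firsts_cat take_size_cat ?size_firsts // drop_size_cat ?size_firsts //.
    rewrite firsts_cat firsts_after_cat; congr (_ ++ _ ++ _).
      by rewrite firsts_disjoint // => x /dis; rewrite wC mem_cat negb_or => /andP[].
    rewrite firsts_after_disjoint // => x xd; apply/negP => /dis.
    by rewrite wC mem_cat xd orbT.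
  - rewrite wU; apply: noncr_insert; [by rewrite -wC|exact: ncG|].
    by move=> x /dis; rewrite wC.
  - rewrite wU; apply: full_insert; [by rewrite -wC|exact: fuG|].
    by move=> x /dis; rewrite wC.
have [] := key _ unP memP srt.
rewrite cvP => -> -> ; rewrite /word.
have -> : enum [set: 'I_r] = enum 'I_r by apply: eq_enum => x; rewrite !inE.
by [].
Qed.

End Blocks.

(** * theta reads the first occurrences of the label word *)
Definition chain_seq r (c : seq {set {set 'I_r}}) :=
  all (@is_nc r) c && sorted (fun P Q => refines Q P) c.

Lemma chain_seq_nc r (c : seq {set {set 'I_r}}) P : chain_seq c -> P \in c ->
  partition P [set: 'I_r] /\ noncrossing P.
Proof. by move=> /andP[/allP h _] /h/andP. Qed.

Lemma refines_rel_trans r : transitive (fun P Q : {set {set 'I_r}} => refines Q P).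
Proof. by move=> Q P S QP SQ; exact: refines_trans QP SQ. Qed.

Lemma chain_seq_head r (P Q : {set {set 'I_r}}) c : chain_seq (P :: c) ->
  Q \in P :: c -> refines Q P.
Proof.
move=> ch; have [pP _] := chain_seq_nc ch (mem_head _ _).
rewrite inE => /orP[/eqP->|Qc]; first by apply/refinesE.
have /andP[_] := ch; rewrite sorted_pairwise; last exact: refines_rel_trans.
by case/andP=> /allP h _; exact: h.
Qed.

Lemma firsts_blocks (T : eqType) k (s : seq T) : uniq s ->
  let w := flatten [seq nseq k.+1 x | x <- s] in
  [/\ firsts w = flatten (nseq (size s) (true :: nseq k false)), noncr w & full k w].
Proof.
elim: s => [|x s IH] //= /andP[xs /IH[ef nc fu]].
have dis y : y \in nseq k.+1 x -> y \notin flatten [seq nseq k.+1 z | z <- s].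
  have mS (u v : T) : u \in nseq k.+1 v -> u = v by rewrite mem_nseq => /eqP.
  by move/mS=> ->; apply/negP=> /flattenP[_ /mapP[z zs ->]] /mS e; rewrite e zs in xs.
have e : x :: nseq k x ++ flatten [seq x0 :: nseq k x0 | x0 <- s]
       = nseq k.+1 x ++ flatten [seq nseq k.+1 z | z <- s] by [].
rewrite e; split.
- rewrite firsts_cat -[RHS]/((true :: nseq k false) ++ flatten _) -ef; congr (_ ++ _); last first.
    by apply: firsts_disjoint => y ys; apply/negP => /dis; rewrite ys.
  rewrite /firsts /= firsts_after_sub ?size_nseq //.
  by move=> y; rewrite mem_nseq inE => /andP[].
- exact: (noncr_insert (a := [::]) nc (@noncr_nseq _ k.+1 x) dis).
- exact: (full_insert (a := [::]) fu (@full_nseq _ k x) dis).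
Qed.

Lemma rot_enum r : rot 1 (enum 'I_r) = [seq ordS p | p <- enum 'I_r].
Proof.
apply: (inj_map val_inj); rewrite map_rot val_enum_ord -map_comp.
rewrite (eq_map (g := (fun i => i.+1 %% r) \o val)) // map_comp val_enum_ord.
case: r => // r; have e : iota 0 r.+1 = rcons (iota 0 r) r by rewrite -addn1 iotaD cats1.
rewrite [in RHS]e map_rcons modnn /= rot1_cons; congr rcons.
rewrite -[1]addn0 iotaDl; apply/eq_in_map => i; rewrite mem_iota add0n /= => lt_ir.
by rewrite add1n modn_small.
Qed.

(** Rotation by one letter moves the head of every group to the end of the group
    before it. *)
Lemma rot_flatten_groups (T : Type) (U : Type) (f : T -> U) (Y : T -> seq U) s :
  rot 1 (flatten [seq f x :: Y x | x <- s]) =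
  flatten [seq rcons (Y z.1) (f z.2) | z <- zip s (rot 1 s)].
Proof.
case: s => // x s; rewrite [flatten _]/= !rot1_cons.
suff key l : rcons (Y x ++ flatten [seq f z :: Y z | z <- s]) (f l) =
    flatten [seq rcons (Y z.1) (f z.2) | z <- zip (x :: s) (rcons s l)] by exact: key.
elim: s x => [|z s IH] x /=; first by rewrite !cats0.
by rewrite -IH cat_rcons !rcons_cat /= rcons_cat.
Qed.

Lemma zip_map_r (T U : Type) (f : T -> U) s : zip s (map f s) = [seq (x, f x) | x <- s].
Proof. by elim: s => //= x s ->. Qed.

Lemma labels_rot1 r (c : seq {set {set 'I_r}}) :
  rot 1 (labels c) = flatten [seq rcons [seq nx P p | P <- rev c] (ordS p) | p <- enum 'I_r].
Proof.
rewrite /labels /lab (@rot_flatten_groups _ _ id) rot_enum zip_map_r -map_comp.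
by congr flatten; apply: eq_map.
Qed.

(** The singletons repeat [p] and the one-block partition leads to [p + 1], the
    head of the next group: the groups of one word are those of the other,
    delimited one letter further. *)
Lemma labels_prime r (c : seq {set {set 'I_r}}) : partition [set [set: 'I_r]] [set: 'I_r] ->
  labels ([set [set: 'I_r]] :: c) = rot 1 (labels (rcons c (singletons r))).
Proof.
move=> pT; rewrite labels_rot1 /labels; congr flatten; apply: eq_map => p.
by rewrite /lab rev_cons rev_rcons map_rcons /= nx_top // nx_singletons.
Qed.

Lemma enum_block r (B : {set 'I_r}) : enum B = [seq enum_val x | x <- enum 'I_#|B|].
Proof.
apply: eq_sorted_ord; first exact: sorted_enum_ord.
  rewrite sorted_map (eq_sorted (e' := fun x y : 'I_#|B| => x < y)); first exact: sorted_enum_ord.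
  by move=> x y /=; rewrite ltn_enum_val.
move=> x; rewrite mem_enum; apply/idP/mapP => [xB|[y _ ->]]; last exact: enum_valP.
by exists (enum_rank_in xB x); rewrite ?mem_enum // enum_rankK_in.
Qed.

Lemma labels_restrict r (B : {set 'I_r}) (c : seq {set {set 'I_r}}) :
  (forall P, P \in c -> partition P [set: 'I_r]) ->
  (forall P u v, P \in c -> u \in B -> same P u v -> v \in B) ->
  flatten [seq lab c p | p <- enum B] = map enum_val (labels [seq restrict B P | P <- c]).
Proof.
move=> pc cB; rewrite enum_block /labels map_flatten -!map_comp; congr flatten.
apply: eq_map => x /=; congr cons; rewrite -map_rev -!map_comp.
apply/eq_in_map => P /=; rewrite mem_rev => Pc.
by rewrite nx_restrict //; [exact: pc|move=> u v; exact: cB].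
Qed.

Lemma chain_seq_restrict r (B : {set 'I_r}) (c : seq {set {set 'I_r}}) :
  chain_seq c -> chain_seq [seq restrict B P | P <- c].
Proof.
move=> ch; have pc P : P \in c -> _ := chain_seq_nc ch.
apply/andP; split.
  apply/allP=> _ /mapP[P /pc[pP ncP] ->]; apply/andP; split; first exact: partition_restrict.
  exact: noncrossing_restrict.
have /andP[_] := ch; case: c pc {ch} => //= P c pc.
elim: c P pc => //= Q c IH P pc /andP[PQ srt].
have [pP _] := pc P (mem_head _ _); have [pQ _] := pc Q (mem_behead (s := P :: _) (mem_head _ _)).
by rewrite refines_restrict //= IH // => S Sc; apply: pc; rewrite inE Sc orbT.
Qed.

Lemma chain_seq_prime r (c : seq {set {set 'I_r}}) : chain_seq c ->
  chain_seq (rcons (behead c) (singletons r)).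
Proof.
case: c => [|P c] ch; first by rewrite /chain_seq /= /is_nc partition_singletons noncrossing_singletons.
have {ch} : chain_seq c.
  have /andP[/= /andP[_ h1] h2] := ch; rewrite /chain_seq h1; exact: path_sorted h2.
rewrite /=; case/andP=> h1 h2; apply/andP; split.
  by rewrite all_rcons h1 andbT /is_nc partition_singletons noncrossing_singletons.
case: c h1 h2 => // Q c /allP h1 /= h2; rewrite rcons_path h2 /=.
by apply: refines_singletons; case/andP: (h1 _ (mem_last Q c)).
Qed.

Definition represents r k (w : seq bool) (c : seq {set {set 'I_r}}) :=
  [/\ w = firsts (labels c), noncr (labels c) & full k (labels c)].

Lemma represents_trivial k r (c : seq {set {set 'I_r}}) : size c = k ->
  all (pred1 (singletons r)) c ->
  represents k (flatten (nseq r (true :: nseq k false))) c.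
Proof.
move=> sc /all_pred1P ec; have [] := @firsts_blocks _ k (enum 'I_r) (enum_uniq _).
rewrite size_enum_ord /represents /labels.
suff -> : [seq lab c p | p <- enum 'I_r] = [seq nseq k.+1 x | x <- enum 'I_r] by [].
by apply: eq_map => p; rewrite /lab ec sc rev_nseq map_nseq nx_singletons.
Qed.

(** The label word of the chain that ends in the singletons starts with the same
    label twice.  When the first copy is rotated away, the second one becomes a
    first occurrence and the rotated copy an old label. *)
Lemma represents_prime k r (c : seq {set {set 'I_r}}) w : 0 < r ->
  partition [set [set: 'I_r]] [set: 'I_r] ->
  represents k w (rcons c (singletons r)) ->
  represents k (shift_steps w) ([set [set: 'I_r]] :: c).
Proof.
move=> r0 pT [-> nc fu]; rewrite /represents labels_prime //.
split; [|exact: noncr_rot|exact: full_rot].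
have [x [t ->]] : exists x t, labels (rcons c (singletons r)) = x :: x :: t.
  rewrite /labels; have : enum 'I_r != [::] by rewrite -size_eq0 size_enum_ord -lt0n.
  case: (enum 'I_r) => // x s _; exists x; rewrite /= rev_rcons /= nx_singletons.
  by eexists.
rewrite rot1_cons /firsts /= mem_head shift_stepsE; congr cons.
rewrite -!cats1 firsts_after_cat /= mem_head; congr (_ ++ _).
by apply: eq_firsts_after => y; rewrite !inE; case: eqP.
Qed.

(** Here [d] bounds the number of partitions other than the singletons.  A
    one-block head becomes a trivial last component, which lowers [d]; a general
    head needs one more level of recursion to fall under that case. *)
Lemma theta_rec_labels d f k r (c : seq {set {set 'I_r}}) :
  size c = k -> d <= k -> 2 * d < f -> chain_seq c ->
  all (pred1 (singletons r)) (drop d c) -> represents k (theta_rec f k c) c.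
Proof.
elim: d => [|d IHd] in f r c *.
  by case: f => // f sc _ _ _; rewrite drop0 /= => tc; rewrite tc; exact: represents_trivial.
have prime f' r' (c' : seq {set {set 'I_r'}}) :
  size c' = k -> d < k -> 2 * d < f' -> 0 < r' -> chain_seq c' ->
  head set0 c' = [set [set: 'I_r']] ->
  all (pred1 (singletons r')) (drop d.+1 c') ->
  represents k (shift_steps (theta_rec f' k (rcons (behead c') (singletons r')))) c'.
  move=> sc lt_dk lt_f r0 ch hd tc.
  have := IHd f' r' (rcons (behead c') (singletons r')).
  rewrite size_rcons size_behead sc prednK; last exact: leq_trans lt_dk.
  move=> /(_ erefl (ltnW lt_dk) lt_f (chain_seq_prime ch)).
  case: c' sc ch hd tc => [|P c'] sc ch hd tc; first by move: lt_dk; rewrite -sc.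
  rewrite /= in hd *; rewrite drop_rcons; last by rewrite -ltnS -[(size c').+1]/(size (P :: c')) sc.
  rewrite all_rcons /= eqxx tc => /(_ isT) rep; rewrite hd; apply: represents_prime => //.
  by rewrite -hd; case: (chain_seq_nc ch (mem_head _ _)).
move=> sc lt_dk lt_f ch tc; case: f lt_f => [|f] // lt_f.
rewrite [theta_rec _ _ _]/=; case: ifP => [|ntriv]; first exact: represents_trivial.
case: ifP => [/andP[/eqP hd r2]|_].
  by apply: prime => //; [lia|exact: ltnW].
case: c sc ch tc {ntriv} => [|P c] sc ch tc; first by move: lt_dk; rewrite -sc.
have [pP ncP] := chain_seq_nc ch (mem_head _ _).
have pc Q : Q \in P :: c -> partition Q [set: 'I_r] by case/(chain_seq_nc ch).
have ref Q : Q \in P :: c -> forall x y, same Q x y -> same P x y.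
  by move=> Qc; apply/(refinesE pP (pc Q Qc)); exact: chain_seq_head ch Qc.
have clB B : B \in P -> forall Q u v, Q \in P :: c -> u \in B -> same Q u v -> v \in B.
  by move=> BP Q u v Qc uB /(ref _ Qc); rewrite -(same_block pP _ BP uB).
have repB B : B \in P ->
  represents k (theta_rec f k [seq restrict B Q | Q <- P :: c]) [seq restrict B Q | Q <- P :: c].
  move=> BP; set cB := [seq restrict B Q | Q <- P :: c].
  have scB : size cB = k by rewrite size_map.
  have chB : chain_seq cB by exact: chain_seq_restrict.
  have tcB : all (pred1 (singletons #|B|)) (drop d.+1 cB).
    rewrite -map_drop all_map; apply/allP=> Q /(allP tc) /= /eqP->.
    by rewrite restrict_singletons.
  have B0 : 0 < #|B|.
    by case/and3P: pP => _ _; rewrite card_gt0; apply: contraNneq => <-.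
  case: f lt_f => [|f] lt_f; first by move: lt_f; clear; lia.
  rewrite [theta_rec _ _ _]/= -/cB; case: ifP => [|ntriv]; first by move=> triv; exact: (represents_trivial scB triv).
  have hB : head set0 cB = [set [set: 'I_#|B|]] by rewrite /= restrict_block.
  rewrite -[restrict B P]/(head set0 cB) hB eqxx /=; case: ifP => [B2|B1].
    by apply: (prime f #|B| cB) => //; move: lt_f; clear; lia.
  case/negP: ntriv; rewrite -[X in is_true X]/(all (pred1 (singletons #|B|)) cB).
  apply/allP=> Q Qc /=; apply/eqP/partition_ord1; first by rewrite leqNgt B1.
  by case: (chain_seq_nc chB Qc).
have LB B : B \in P -> flatten [seq lab (P :: c) p | p <- enum B]
    = map enum_val (labels [seq restrict B Q | Q <- P :: c]).
  by move=> BP; apply: labels_restrict => // Q u v; exact: clB.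
have [||B BP|B BP|B BP|ef nc fu] := @insert_blocks_firsts k r P (lab (P :: c))
    (fun B => theta_rec f k [seq restrict B Q | Q <- P :: c]) pP ncP.
- by move=> p; rewrite size_lab sc.
- move=> p x; rewrite inE => /orP[/eqP->|/mapP[Q + ->]]; first exact: same_refl.
  by rewrite mem_rev => Qc; apply: (ref Q Qc); apply: nx_same; exact: pc.
- by rewrite LB //; apply: noncr_map; [exact: enum_val_inj|case: (repB B BP)].
- by rewrite LB //; apply: full_map; [exact: enum_val_inj|case: (repB B BP)].
- have [-> _ _] := repB B BP; rewrite LB // firsts_map //.
  by move=> x y _ _; exact: enum_val_inj.
by split.
Qed.

Lemma kchain_chain_seq n k (c : kchain n k) : chain_seq [seq nc_part P | P <- c].
Proof.
apply/andP; split; first by rewrite all_map; apply/allP=> P _; exact: ncP.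
by rewrite sorted_map; exact: kchainP.
Qed.

Lemma theta_labels n k (c : kchain n k) :
  represents k (theta c) [seq nc_part P | P <- c].
Proof.
have sc : size [seq nc_part P | P <- c] = k by rewrite size_map size_tuple.
apply: (@theta_rec_labels k) => //; first exact: kchain_chain_seq.
by rewrite -{1}sc drop_size.
Qed.

(** * theta is injective *)
Lemma eq_flatten_groups (T U : eqType) (G H : T -> seq U) s :
  (forall x, size (G x) = size (H x)) ->
  flatten (map G s) = flatten (map H s) -> {in s, G =1 H}.
Proof.
move=> sz; elim: s => //= x s IH /eqP; rewrite eqseq_cat // => /andP[/eqP e /eqP/IH h].
by move=> y; rewrite inE => /orP[/eqP->|/h].
Qed.

(** The label words of two chains with the same path differ by a renaming [f].  In
    both of them the [p]-th group starts with [p], so [f] is the identity, and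
    the groups record all the successors. *)
Lemma theta_inj n k : 0 < n -> injective (@theta n k).
Proof.
move=> n0 c c' e; pose u0 : 'I_n := Ordinal n0.
have [ec ncc fuc] := theta_labels c; have [ec' ncc' fuc'] := theta_labels c'.
have [|f _ ef] := firsts_iso u0 ncc fuc ncc' fuc'; first by rewrite -ec -ec' e.
have sc (d : kchain n k) : size [seq nc_part P | P <- d] = k by rewrite size_map size_tuple.
have eg p : lab [seq nc_part P | P <- c'] p = map f (lab [seq nc_part P | P <- c] p).
  apply: (@eq_flatten_groups _ _ (lab _) (map f \o lab _) (enum 'I_n)).
  - by move=> x /=; rewrite !size_map !size_rev !sc.
  - by rewrite [RHS]/= [in RHS]map_comp -[RHS]/(flatten (map (map f) _)) -map_flatten.
  - by rewrite mem_enum.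
have fid : f =1 id by move=> p; have := eg p => /= -[<-].
apply: val_inj; apply: val_inj; apply: (inj_map val_inj).
apply: (@eq_from_nth _ set0); first by rewrite !sc.
move=> i lt_i; have part (d : kchain n k) : partition (nth set0 [seq nc_part P | P <- d] i) [set: 'I_n].
  have := kchain_chain_seq d => /chain_seq_nc h.
  by apply: (proj1 (h _ _)); apply: mem_nth; rewrite sc -(sc c).
apply: nx_inj; try exact: part.
move=> p; have := eg p; rewrite (eq_map fid) map_id /lab !map_rev => -[] /(congr1 rev).
rewrite !revK => /(congr1 (nth p ^~ i)).
by rewrite !(nth_map set0) ?sc -?(sc c).
Qed.

(** * Inserting a point into a non-crossing partition *)
Section InsertPoint.
Variables (n : nat) (q : 'I_n.+1).
Implicit Types (o : option 'I_n) (P : {set {set 'I_n}}).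

(** The new point [q] joins the block of [p] if [o = Some p] and is a block by
    itself if [o = None]; two points are equivalent when their keys agree. *)
Definition point_key o P (x : 'I_n.+1) : option {set 'I_n} :=
  omap (pblock P) (if unlift q x is Some y then Some y else o).

Definition insert_point o P : {set {set 'I_n.+1}} :=
  preim_partition (point_key o P) [set: 'I_n.+1].

Lemma insert_point_partition o P : partition (insert_point o P) [set: 'I_n.+1].
Proof. exact: preim_partitionP. Qed.

Lemma same_insert o P x y :
  same (insert_point o P) x y = (point_key o P x == point_key o P y).
Proof.
rewrite /same /insert_point /preim_partition pblock_equivalence_partition ?inE //.
by move=> a b c _ _ _; split=> // /eqP->.
Qed.

Lemma lift_cases (x : 'I_n.+1) : x = q \/ exists y, x = lift q y.
Proof. by case: (unliftP q x) => [y ->|->]; [right; exists y|left]. Qed.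

Lemma same_lift o P x y : partition P [set: 'I_n] ->
  same (insert_point o P) (lift q x) (lift q y) = same P x y.
Proof. by move=> pP; rewrite same_insert /point_key !liftK /= same_pblockE. Qed.

Lemma same_new o P y : partition P [set: 'I_n] ->
  same (insert_point o P) q (lift q y) = if o is Some p then same P p y else false.
Proof.
by move=> pP; rewrite same_insert /point_key liftK unlift_none; case: o => //= p; rewrite same_pblockE.
Qed.

Lemma same_lift_new o P y : partition P [set: 'I_n] ->
  same (insert_point o P) (lift q y) q = if o is Some p then same P p y else false.
Proof. by move=> pP; rewrite same_sym ?same_new //; exact: insert_point_partition. Qed.

Lemma lt_lift (x y : 'I_n) : (lift q x < lift q y) = (x < y).
Proof. by rewrite /= /bump; do 2!case: leqP => ? /=; apply/idP/idP; lia. Qed.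

Lemma lt_lift_new (x : 'I_n) : (lift q x < q) = (x < q).
Proof. by rewrite /= /bump; case: leqP => ? /=; apply/idP/idP; lia. Qed.

Lemma lt_new_lift (x : 'I_n) : (q < lift q x) = (q <= x).
Proof. by rewrite /= /bump; case: leqP => ? /=; apply/idP/idP; lia. Qed.

(** A new point placed directly after a member of its block cannot create a
    crossing, nor can a new singleton. *)
Definition predecessor_of o := if o is Some p then (p : 'I_n).+1 == q :> nat else true.

(** If [q] joins the block of [p], sending [q] to [p] is weakly increasing, and a
    crossing of the new partition would be sent to one of [P]. *)
Lemma noncrossing_insert o P : predecessor_of o -> partition P [set: 'I_n] ->
  noncrossing P -> noncrossing (insert_point o P).
Proof.
move=> oq pP nc; apply: same_noncrossing; first exact: insert_point_partition.
have pI := insert_point_partition o P.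
case: o oq pI => [p /= /eqP pq|_] pI i j l m ij jl lm.
  pose g (x : 'I_n.+1) : 'I_n := if unlift q x is Some y then y else p.
  have sg x y : same (insert_point (Some p) P) x y = same P (g x) (g y).
    rewrite same_insert same_pblockE // /point_key /g.
    by case: (unlift q x) => [?|]; case: (unlift q y).
  have mono (x y : 'I_n.+1) : x < y -> g x <= g y.
    rewrite /g; case: (unliftP q x) => [x' ->|->]; case: (unliftP q y) => [y' ->|->] //.
    - by rewrite lt_lift => /ltnW.
    - by rewrite lt_lift_new -pq.
    - by rewrite lt_new_lift -pq => /ltnW.
  rewrite !sg => il jm; have := mono _ _ lm; have := mono _ _ jl; have := mono _ _ ij.
  rewrite leq_eqVlt => /orP[/eqP/val_inj-> _ _|gij]; first exact: same_refl.
  rewrite leq_eqVlt => /orP[/eqP/val_inj-> //|gjl].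
  rewrite leq_eqVlt => /orP[/eqP/val_inj e|glm].
    by apply: (same_trans pP il); rewrite e same_sym.
  exact: noncrossing_same gij gjl glm il jm.
have [ei|[i' ei]] := lift_cases i; have [el|[l' el]] := lift_cases l.
- by move: (ltn_trans ij jl); rewrite ei el ltnn.
- by rewrite ei el same_new.
- by rewrite ei el same_lift_new.
have [ej|[j' ej]] := lift_cases j; have [em|[m' em]] := lift_cases m.
- by move: (ltn_trans jl lm); rewrite ej em ltnn.
- by rewrite ej em same_new.
- by rewrite ej em same_lift_new.
rewrite ei ej el em !same_lift // in ij jl lm *; rewrite !lt_lift in ij jl lm.
exact: noncrossing_same.
Qed.

Lemma refines_insert o o' P Q : partition P [set: 'I_n] -> partition Q [set: 'I_n] ->
  (o' = None) \/ (o = o') -> refines Q P -> refines (insert_point o' Q) (insert_point o P).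
Proof.
move=> pP pQ oo /(refinesE pP pQ) h; apply/refinesE; try exact: insert_point_partition.
move=> x y; have [->|[x' ->]] := lift_cases x; have [->|[y' ->]] := lift_cases y.
- by move=> _; apply: same_refl; exact: insert_point_partition.
- by rewrite !same_new //; case: oo => [->//|->]; case: o' => // p; exact: h.
- by rewrite !same_lift_new //; case: oo => [->//|->]; case: o' => // p; exact: h.
- by rewrite !same_lift //; exact: h.
Qed.

Lemma nx_insert_none P x : partition P [set: 'I_n] ->
  nx (insert_point None P) (lift q x) = lift q (nx P x).
Proof.
move=> pP; have pI := insert_point_partition None P; apply: nxE => //.
  by rewrite same_lift // nx_same.
move=> y; have [->|[y' ->]] := lift_cases y; first by rewrite same_lift_new.
by rewrite same_lift // => /(nx_min pP); rewrite !cdist_leE !lt_lift.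
Qed.

Lemma nx_insert_none_new P : partition P [set: 'I_n] -> nx (insert_point None P) q = q.
Proof.
move=> pP; have pI := insert_point_partition None P; apply: nxE => //; first exact: same_refl.
by move=> y; have [->|[y' ->]] := lift_cases y; rewrite ?same_new.
Qed.

Variable p : 'I_n.
Hypothesis pq : p.+1 = q.

Lemma nx_insert_pred P : partition P [set: 'I_n] ->
  nx (insert_point (Some p) P) (lift q p) = q.
Proof.
move=> pP; have pI := insert_point_partition (Some p) P; apply: nxE => //.
  by rewrite same_lift_new // same_refl.
move=> y; have [->//|[y' ->]] := lift_cases y.
rewrite same_lift // => _; rewrite cdist_leE lt_lift !lt_lift_new -pq ltnS leqnn -leqNgt -leqNgt.
by case: (leqP p.+1 y'); case: (ltnP p y') => //; lia.
Qed.

Lemma nx_insert_new P : partition P [set: 'I_n] ->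
  nx (insert_point (Some p) P) q = lift q (nx P p).
Proof.
move=> pP; have pI := insert_point_partition (Some p) P; apply: nxE => //.
  by rewrite same_new // nx_same.
move=> y; have [->|[y' ->]] := lift_cases y => [_|].
  by rewrite cdist_leE ltnn; case: (q < _).
rewrite same_new // => /(nx_min pP).
by rewrite !cdist_leE !lt_lift !lt_new_lift -pq.
Qed.

Lemma nx_insert_other P x : partition P [set: 'I_n] -> x != p ->
  nx (insert_point (Some p) P) (lift q x) = lift q (nx P x).
Proof.
move=> pP xp; have pI := insert_point_partition (Some p) P; apply: nxE => //.
  by rewrite same_lift // nx_same.
move=> y; have [->|[y' ->]] := lift_cases y; last first.
  by rewrite same_lift // => /(nx_min pP); rewrite !cdist_leE !lt_lift.
rewrite same_lift_new // same_sym // => /(nx_min pP).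
rewrite !cdist_leE !lt_lift !lt_lift_new !lt_new_lift -pq.
have : x != p :> nat by [].
set z := nx P x; case: (ltnP x z) => xz; lia.
Qed.

End InsertPoint.

(** * theta is surjective *)
Definition insert_chain n (q : 'I_n.+1) t (o : option 'I_n) (c : seq {set {set 'I_n}}) :=
  map (insert_point q o) (take t c) ++ map (insert_point q None) (drop t c).

Lemma chain_seq_insert n (q : 'I_n.+1) t o (c : seq {set {set 'I_n}}) :
  predecessor_of q o -> chain_seq c -> chain_seq (insert_chain q t o c).
Proof.
move=> oq ch; have pc P : P \in c -> _ := chain_seq_nc ch.
have /andP[_] := ch; rewrite sorted_pairwise; last exact: refines_rel_trans.
rewrite -{1}(cat_take_drop t c) pairwise_cat => /and3P[cross lo hi].
have inl P : P \in take t c -> P \in c by exact: mem_take.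
have inr P : P \in drop t c -> P \in c by exact: mem_drop.
apply/andP; split.
  rewrite all_cat !all_map; apply/andP; split; apply/allP => P /= Pc.
    have [pP nP] := pc P (inl P Pc).
    by rewrite /is_nc insert_point_partition noncrossing_insert.
  have [pP nP] := pc P (inr P Pc).
  by rewrite /is_nc insert_point_partition noncrossing_insert.
rewrite sorted_pairwise; last exact: refines_rel_trans.
rewrite /insert_chain pairwise_cat !pairwise_map; apply/and3P; split.
- apply/allrelP => _ _ /mapP[P Pc ->] /mapP[Q Qc ->].
  have [pP _] := pc P (inl P Pc); have [pQ _] := pc Q (inr Q Qc).
  by apply: refines_insert => //; [left|exact: (allrelP cross)].
- apply: (@sub_in_pairwise _ (mem (take t c)) _ _ _ _ _ lo) => [P Q Pc Qc /= PQ|]; last exact/allP.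
  have [pP _] := pc P (inl P Pc); have [pQ _] := pc Q (inl Q Qc).
  by apply: refines_insert => //; right.
- apply: (@sub_in_pairwise _ (mem (drop t c)) _ _ _ _ _ hi) => [P Q Pc Qc /= PQ|]; last exact/allP.
  have [pP _] := pc P (inr P Pc); have [pQ _] := pc Q (inr Q Qc).
  by apply: refines_insert => //; left.
Qed.

Lemma enum_ord_lift n (q : 'I_n.+1) : enum 'I_n.+1 =
  map (lift q) [seq x : 'I_n <- enum 'I_n | x < q] ++
  q :: map (lift q) [seq x : 'I_n <- enum 'I_n | q <= x].
Proof.
apply: eq_sorted_ord; first exact: sorted_enum_ord.
  have tr m : transitive (fun i j : 'I_m => i < j) by move=> i j l; exact: ltn_trans.
  rewrite sorted_pairwise // pairwise_cat /=.
  have pw (f : pred 'I_n) : pairwise (fun i j : 'I_n.+1 => i < j) (map (lift q) [seq x <- enum 'I_n | f x]).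
    rewrite -sorted_pairwise // sorted_map (eq_sorted (e' := fun x y : 'I_n => x < y)).
      by apply: sorted_filter => //; exact: sorted_enum_ord.
    by move=> x y; exact: lt_lift.
  rewrite !pw /= !andbT allrel_consr -andbA; apply/and3P; split.
  - by apply/allP => _ /mapP[x + ->]; rewrite mem_filter lt_lift_new => /andP[].
  - apply/allrelP => _ _ /mapP[x + ->] /mapP[y + ->].
    by rewrite mem_filter => /andP[xq _]; rewrite mem_filter => /andP[qy _]; rewrite lt_lift (leq_trans xq).
  - by apply/allP => _ /mapP[x + ->]; rewrite mem_filter lt_new_lift => /andP[].
move=> x; rewrite mem_enum mem_cat; apply/esym.
have [->|[y ->]] := lift_cases q x; first by rewrite mem_head orbT.
rewrite in_cons.
rewrite !mem_map; [|exact: lift_inj|exact: lift_inj].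
rewrite mem_filter mem_enum mem_filter mem_enum; case: (leqP q y) => //= _.
by rewrite orbT.
Qed.

Lemma enum_ord_split n m : enum 'I_n =
  [seq x : 'I_n <- enum 'I_n | x < m] ++ [seq x : 'I_n <- enum 'I_n | m <= x].
Proof.
by have := @enum_split n [set: 'I_n] m; rewrite (eq_enum (B := 'I_n)) // => x; rewrite !inE.
Qed.

Lemma size_filter_lt n m : m <= n -> size [seq x : 'I_n <- enum 'I_n | x < m] = m.
Proof.
move=> le_mn; rewrite -(size_map val) -(@filter_map _ _ val (fun x => x < m)) val_enum_ord.
rewrite -(subnKC le_mn) iotaD filter_cat size_cat add0n.
rewrite (_ : filter _ (iota 0 m) = iota 0 m); last first.
  by apply/all_filterP/allP => x; rewrite mem_iota.
rewrite (_ : filter _ (iota m _) = [::]) ?size_iota ?addn0 //.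
apply/eqP; rewrite -(negbK (_ == _)) -has_filter; apply/hasPn => x.
by rewrite mem_iota -leqNgt => /andP[].
Qed.

Lemma map_nseqP (T U : eqType) (f : T -> U) (s : seq T) y :
  {in s, forall x, f x = y} -> map f s = nseq (size s) y.
Proof.
move=> h; rewrite -(size_map f); apply/all_pred1P/allP => _ /mapP[x /h <- ->].
by rewrite /= eqxx.
Qed.

(** The [k.+1] copies of the new point [q] are contiguous: [t] of them are the
    successors of the preceding point in the [t] coarsest partitions, the others
    open the group of [q].  Every offset is of the form [k.+1 * q - t] with
    [t <= k], so that a leaf can be inserted anywhere. *)
Lemma labels_insert n k (q : 'I_n.+1) t o (c : seq {set {set 'I_n}}) :
  size c = k -> t <= k -> predecessor_of q o -> (0 < t -> o != None) ->
  (forall P, P \in c -> partition P [set: 'I_n]) ->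
  exists A B, [/\ labels (insert_chain q t o c) = map (lift q) A ++ nseq k.+1 q ++ map (lift q) B,
    labels c = A ++ B & size A = k.+1 * q - t].
Proof.
move=> sc le_tk oq ot pc; have injl := @lift_inj _ q.
set c' := insert_chain q t o c.
have prev : rev c' = map (insert_point q None) (rev (drop t c)) ++ map (insert_point q o) (rev (take t c)).
  by rewrite /c' /insert_chain rev_cat !map_rev.
have inl P : P \in rev (take t c) -> partition P [set: 'I_n].
  by rewrite mem_rev => /mem_take/pc.
have inr P : P \in rev (drop t c) -> partition P [set: 'I_n].
  by rewrite mem_rev => /mem_drop/pc.
have labrev x : lab c x = x :: [seq nx P x | P <- rev (drop t c)] ++ [seq nx P x | P <- rev (take t c)].
  by rewrite /lab -{1}(cat_take_drop t c) rev_cat map_cat.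
have hdr x : [seq nx P (lift q x) | P <- map (insert_point q None) (rev (drop t c))]
    = [seq lift q (nx P x) | P <- rev (drop t c)].
  by rewrite -map_comp; apply/eq_in_map => P /inr pP /=; rewrite nx_insert_none.
have new : [seq nx P q | P <- map (insert_point q None) (rev (drop t c))] = nseq (k - t) q.
  rewrite -sc -size_drop -size_rev -map_comp; apply: map_nseqP => P /inr pP /=.
  by rewrite nx_insert_none_new.
have std x : (forall P, partition P [set: 'I_n] -> 0 < t -> nx (insert_point q o P) (lift q x) = lift q (nx P x)) ->
    lab c' (lift q x) = map (lift q) (lab c x).
  move=> h; rewrite labrev /lab prev map_cat hdr /= map_cat -!map_comp; congr (_ :: _ ++ _).
  apply/eq_in_map => P Pt /=; apply: h; first exact: inl.
  by move: Pt; rewrite mem_rev; case: (t) => //; rewrite take0.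
have size_groups s : size (flatten [seq lab c x | x <- s]) = k.+1 * size s.
  by apply: size_flatten_map => x; rewrite size_lab sc.
have [t0|t0] := posnP t.
  exists (flatten [seq lab c x | x <- [seq x : 'I_n <- enum 'I_n | x < q]]),
    (flatten [seq lab c x | x <- [seq x : 'I_n <- enum 'I_n | q <= x]]).
  split.
  - rewrite /labels (enum_ord_lift q) map_cat flatten_cat /= !map_flatten -!map_comp.
    congr (flatten _ ++ _ :: _ ++ flatten _).
    + by apply: eq_map => x /=; apply: std => P _; rewrite t0.
    + by move: new; rewrite prev t0 take0 cats0 subn0.
    + by apply: eq_map => x /=; apply: std => P _; rewrite t0.
  - by rewrite /labels -flatten_cat -map_cat -enum_ord_split.
  - by rewrite size_groups size_filter_lt -1?ltnS // t0 subn0.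
case: o ot oq c' prev std => [p|] ot oq c' prev std; last by have := ot t0.
have pq : p.+1 = q by exact/eqP.
have elo : [seq x : 'I_n <- enum 'I_n | x < q] = rcons [seq x : 'I_n <- enum 'I_n | x < p] p.
  apply: eq_sorted_ord.
  - by apply: sorted_filter; [move=> i j l; exact: ltn_trans|exact: sorted_enum_ord].
  - rewrite sorted_pairwise; last by move=> i j l; exact: ltn_trans.
    rewrite -cats1 pairwise_cat /= andbT allrel1r; apply/andP; split.
      by apply/allP => x; rewrite mem_filter => /andP[].
    rewrite -sorted_pairwise; last by move=> i j l; exact: ltn_trans.
    by apply: sorted_filter; [move=> i j l; exact: ltn_trans|exact: sorted_enum_ord].
  - move=> x; rewrite mem_rcons inE mem_filter mem_enum mem_filter mem_enum !andbT -pq ltnS.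
    by rewrite leq_eqVlt.
set hd := p :: [seq nx P p | P <- rev (drop t c)].
set tl := [seq nx P p | P <- rev (take t c)].
exists (flatten [seq lab c x | x <- [seq x : 'I_n <- enum 'I_n | x < p]] ++ hd),
  (tl ++ flatten [seq lab c x | x <- [seq x : 'I_n <- enum 'I_n | q <= x]]).
have shd : size hd = (k - t).+1 by rewrite /= size_map size_rev size_drop sc.
split.
- have e1 : lab c' (lift q p) = map (lift q) hd ++ nseq t q.
    rewrite /lab prev map_cat hdr /hd /= -!map_comp; congr (_ :: _ ++ _).
    rewrite -[in RHS](@size_takel t _ c) ?sc // -size_rev.
    by apply: map_nseqP => P /inl pP /=; rewrite nx_insert_pred.
  have e2 : lab c' q = nseq (k.+1 - t) q ++ map (lift q) tl.
    rewrite /lab prev map_cat new subSn //= -!map_comp; congr (_ :: _ ++ _).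
    by apply/eq_in_map => P /inl pP /=; rewrite nx_insert_new.
  have e3 l : flatten (map (lab c') (lift q p :: q :: l)) =
      lab c' (lift q p) ++ lab c' q ++ flatten (map (lab c') l) by [].
  rewrite /labels (enum_ord_lift q) elo map_rcons cat_rcons map_cat flatten_cat e3 e1 e2.
  rewrite !map_cat !map_flatten -!map_comp.
  rewrite -[k.+1 in RHS](subnKC (leqW le_tk)) nseqD -!catA.
  congr (flatten _ ++ _ ++ _ ++ _ ++ _ ++ flatten _).
  + apply/eq_in_map => x /=; rewrite mem_filter => /andP[xp _]; apply: std => P pP _.
    by apply: nx_insert_other => //; apply: contraTneq xp => ->; rewrite ltnn.
  + apply/eq_in_map => x /=; rewrite mem_filter => /andP[xp _]; apply: std => P pP _.
    by apply: nx_insert_other => //; apply: contraTneq xp => ->; rewrite -pq ltnn.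
- rewrite /labels [in LHS](enum_ord_split n q) elo map_cat map_rcons flatten_cat flatten_rcons.
  by rewrite (labrev p) -/tl -cat_cons -/hd -!catA.
- by rewrite size_cat size_groups size_filter_lt ?shd -?pq ?mulnS; [lia|exact: ltnW].
Qed.

Lemma split_last_true (w : seq bool) : true \in w -> exists a m, w = a ++ true :: nseq m false.
Proof.
elim/last_ind: w => // w b IH; rewrite mem_rcons inE; case: b => /=.
  by move=> _; exists w, 0; rewrite cats1.
by move=> /IH[a [m ->]]; exists a, m.+1; rewrite rcons_cat /= -cats1 -[[:: false]]/(nseq 1 false) -nseqD addn1.
Qed.

Lemma kchain_of_seq n k (c : seq {set {set 'I_n}}) : size c = k -> chain_seq c ->
  exists d : kchain n k, [seq nc_part P | P <- d] = c.
Proof.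
move=> sc /andP[/allP cnc srt].
have e : map val (pmap (insub : _ -> option (nc n)) c) = c.
  rewrite (pmap_filter (insubK _)); apply/all_filterP/allP => P Pc /=.
  by rewrite isSome_insub; exact: cnc.
have st : size (pmap (insub : _ -> option (nc n)) c) == k by rewrite -(size_map val) e sc.
have srt' : sorted (fun P Q : nc n => refines Q P) (Tuple st) by have := srt; rewrite -{1}e sorted_map.
by exists (KChain srt').
Qed.

(** Remove the last up step together with [k] of the right steps that follow it,
    and insert the corresponding leaf into the chain found by induction. *)
Lemma kdyck_firsts n k (w : seq bool) : is_kdyck k n w ->
  exists2 c : seq {set {set 'I_n}}, size c = k /\ chain_seq c & w = firsts (labels c).
Proof.
elim: n w => [|n IH] w dw.
  have sz := size_kdyck dw; exists (nseq k (singletons 0)); last first.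
    by rewrite /labels (size0nil (size_enum_ord 0)) /=; apply: size0nil; rewrite sz muln0.
  rewrite size_nseq; split=> //; apply/andP; split.
    apply/allP => P; rewrite mem_nseq => /andP[_ /eqP->].
    by rewrite /is_nc partition_singletons noncrossing_singletons.
  elim: (k) => // -[|m] //= h; rewrite h andbT.
  by apply: refines_singletons; exact: partition_singletons.
have [wU wR wP] := is_kdyckP _ _ _ dw.
have [|a [m ew]] := @split_last_true w; first by rewrite -has_pred1 has_count wU.
have cUf j b : count_mem b (nseq j false) = (b == false) * j by rewrite count_mem_nseq.
have aU : count_mem true a = n by move: wU; rewrite ew count_cat /= cUf /=; lia.
have aR : count_mem false a + m = k * n.+1 by rewrite -wR ew count_cat /= cUf /= mul1n.
have ale : count_mem false a <= k * n.
  by have := wP (size a); rewrite ew take_size_cat // aU.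
have km : k <= m by move: aR; rewrite mulnS; lia.
have em : m = k + (m - k) by rewrite subnKC.
set b := nseq (m - k) false.
have dw' : is_kdyck k n (a ++ b).
  have bU : count_mem true b = 0 by rewrite cUf.
  have bR : count_mem false b = m - k by rewrite cUf mul1n.
  rewrite mulnS in aR.
  have aR0 : count_mem false a + (m - k) = k * n by lia.
  apply/is_kdyckP; rewrite !count_cat bU bR aU; split; [lia|lia|].
  move=> i; rewrite take_cat; case: ltnP => [lt_i|le_i].
    by have := wP i; rewrite ew take_cat lt_i.
  have := leq_count_subseq (pred1 false) (take_subseq b (i - size a)).
  by rewrite bR !count_cat aU mulnDr -aR0 => h; apply: leq_trans (leq_addr _ _); rewrite leq_add2l.
have [c [sc ch] ec] := IH _ dw'.
have sab : size a <= k.+1 * n by rewrite -(size_kdyck dw') size_cat leq_addr.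
(* The smallest point whose group starts at or after the place of the leaf. *)
pose q0 := (size a + k) %/ k.+1.
have lt_q : q0 < n.+1.
  by rewrite /q0 ltn_divLR // mulSn mulnC; lia.
have hq : size a <= k.+1 * q0 /\ k.+1 * q0 - size a <= k.
  rewrite /q0 mulnC; have := divn_eq (size a + k) k.+1; have := ltn_pmod (size a + k) (ltn0Sn k); lia.
pose q := Ordinal lt_q; pose t := k.+1 * q0 - size a.
pose o : option 'I_n := if t == 0 then None else insub q0.-1.
have t_q : 0 < t -> 0 < q0 by rewrite /t; case: (q0) => //; rewrite muln0.
have oE : 0 < t -> exists p : 'I_n, o = Some p /\ p.+1 = q0.
  move=> t0; rewrite /o -[t == 0]negbK -lt0n t0 /=; have := t_q t0 => q1.
  have lt_p : q0.-1 < n by lia.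
  by exists (Ordinal lt_p); rewrite insubT /= prednK.
have oq : predecessor_of q o.
  have [t0|/oE[p [-> /= ->]] //] := posnP t; by rewrite /o t0.
have ot : 0 < t -> o != None by case/oE => p [->].
have [|A [B [eL eAB sA]]] := labels_insert sc (proj2 hq) oq ot.
  by move=> P /(chain_seq_nc ch)[].
exists (insert_chain q t o c).
  split; last exact: chain_seq_insert.
  by rewrite size_cat !size_map -size_cat cat_take_drop.
have sAa : size A = size a by rewrite sA /t subKn //; case: hq.
have injl : injective (lift q) by exact: lift_inj.
have qn (s : seq 'I_n) : q \notin map (lift q) s.
  by apply/negP => /mapP[x _ e]; have := neq_lift q x; rewrite -e eqxx.
move: ec; rewrite eAB firsts_cat => /eqP; rewrite eqseq_cat ?size_firsts // => /andP[/eqP ea /eqP eb].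
rewrite eL firsts_cat firsts_after_cat firsts_map; last by move=> x y _ _; exact: injl.
rewrite -ea ew em nseqD /= qn; congr (_ ++ _ :: _ ++ _).
  by rewrite firsts_after_sub ?size_nseq // => x; rewrite mem_nseq mem_rcons inE => /andP[_ ->].
rewrite -/(nseq k.+1 q) firsts_after_disjoint ?firsts_after_map -?eb //.
  by move=> x y _ _; exact: injl.
by move=> x xB; apply/negP; rewrite -[q :: _]/(nseq k.+1 q) mem_nseq => /= /eqP e; rewrite e (negbTE (qn B)) in xB.
Qed.

Lemma theta_surj n k (D : kdyck n k) : exists c : kchain n k, theta c = D.
Proof.
have [c [sc ch] ew] := kdyck_firsts (kdyckP D).
have [d ed] := kchain_of_seq sc ch; exists d; apply: val_inj; apply: val_inj.
by have [ed' _ _] := theta_labels d; move: ed'; rewrite ed -ew.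
Qed.

(** * Rotation and the complement *)
Lemma nc_partition n (P : nc n) : partition P [set: 'I_n].
Proof. by case/andP: (ncP P). Qed.

Lemma nc_noncrossing n (P : nc n) : noncrossing P.
Proof. by case/andP: (ncP P). Qed.

Lemma same_rot n (P : nc n) (x y : 'I_n) : same (rot_part P) (ord_pred x) (ord_pred y) = same P x y.
Proof.
have pR : partition (rot_part P) [set: 'I_n] := nc_partition (Rot P).
have injp : injective (@ord_pred n) := @ord_pred_inj n.
apply/(sameP pR)/(sameP (nc_partition P)) => [[_ /imsetP[B BP ->]]|[B BP xyB]].
  by rewrite !(mem_imset _ _ injp) => h; exists B.
exists [set ord_pred i | i in B]; first exact: imset_f.
by rewrite !(mem_imset _ _ injp).
Qed.

Lemma cdist_pred n (p x : 'I_n) : cdist n (ord_pred p) (ord_pred x) = cdist n p x.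
Proof.
rewrite /cdist !val_ord_pred; have := ltn_ord p; have := ltn_ord x => lx lp.
case: (eqVneq (p : nat) 0) => p0; case: (eqVneq (x : nat) 0) => x0; case: ltnP => ?; case: ltnP => ?; lia.
Qed.

Lemma nx_rot n (P : nc n) (x : 'I_n) : nx (rot_part P) (ord_pred x) = ord_pred (nx P x).
Proof.
have pR : partition (rot_part P) [set: 'I_n] := nc_partition (Rot P).
apply: nxE => //; first by rewrite same_rot nx_same // nc_partition.
move=> y; rewrite -[y]ordSK same_rot !cdist_pred; apply: nx_min.
exact: nc_partition.
Qed.

Lemma rot_groups n k (T : Type) (G : 'I_n -> seq T) : 0 < n -> (forall x, size (G x) = k) ->
  rot k (flatten [seq G x | x <- enum 'I_n]) = flatten [seq G x | x <- rot 1 (enum 'I_n)].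
Proof.
case: n G => // n G _ sG; case: (enum 'I_n.+1) => [|x s] /=; first by [].
by rewrite rot1_cons -(sG x) rot_size_cat map_rcons flatten_rcons.
Qed.

Lemma labels_rot n k (c : seq (nc n)) : 0 < n -> size c = k ->
  labels [seq nc_part (Rot P) | P <- c] = map (@ord_pred n) (rot k.+1 (labels [seq nc_part P | P <- c])).
Proof.
move=> n0 sc; rewrite /labels rot_groups //; last by move=> x; rewrite size_lab size_map sc.
rewrite map_flatten -map_comp rot_enum -map_comp; congr flatten; apply: eq_map => p /=.
rewrite ordSK; congr (_ :: _); rewrite -!map_rev -!map_comp; apply: eq_map => P /=.
by rewrite -nx_rot ordSK.
Qed.

Lemma refines_rot n (P Q : nc n) : refines Q P -> refines (Rot Q) (Rot P).
Proof.
move=> /(refinesE (nc_partition P) (nc_partition Q)) h; apply/refinesE; try exact: nc_partition.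
by move=> x y; rewrite -[x]ordSK -[y]ordSK /= !same_rot; exact: h.
Qed.

Lemma rotate_chain_sorted n k (c : kchain n k) :
  sorted (fun P Q : nc n => refines Q P) (map_chain (@Rot n) c).
Proof.
rewrite /= sorted_map; apply: sub_sorted (kchainP c) => P Q; exact: refines_rot.
Qed.

Definition rotate_chain n k (c : kchain n k) : kchain n k := KChain (rotate_chain_sorted c).

Lemma promotion_iter n k (D : kdyck n k) (T : eqType) (s : seq T) m : noncr s -> full k s ->
  D = firsts s :> seq bool ->
  [/\ iter m (@promotion n k) D = firsts (iter m (rot 1) s) :> seq bool,
    noncr (iter m (rot 1) s) & full k (iter m (rot 1) s)].
Proof.
move=> nc fu e; elim: m => //= m [IHe IHn IHf].
by split; [exact: promotion_firsts|exact: noncr_rot|exact: full_rot].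
Qed.

Lemma iter_rot1 (T : Type) (s : seq T) m : m <= size s -> iter m (rot 1) s = rot m s.
Proof.
elim: m => [|m IH] lt_m; first by rewrite rot0.
by rewrite iterS IH -?rotS // ltnW.
Qed.

(** The [k.+1] promotions move the whole group of the first point to the end, where
    it is the group of the last point after rotation. *)
Lemma theta_rotate n k (c : kchain n k) : 0 < n ->
  theta (rotate_chain c) = iter k.+1 (@promotion n k) (theta c).
Proof.
move=> n0; have [ec ncc fuc] := theta_labels c; have [er _ _] := theta_labels (rotate_chain c).
have [ep _ _] := promotion_iter k.+1 ncc fuc ec.
apply: val_inj; apply: val_inj; rewrite [LHS]er [RHS]ep iter_rot1.
  rewrite /= -map_comp (@labels_rot n k c n0 (size_tuple c)) firsts_map // => x y _ _.
  exact: ord_pred_inj.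
rewrite -size_firsts -ec (size_kdyck (kdyckP _)); exact: leq_pmulr.
Qed.

(** Rotating a label word by its full length shows that promotion has finite
    order. *)
Lemma promotion_inj n k : 0 < n -> injective (@promotion n k).
Proof.
move=> n0 D D' e; have cyc (E : kdyck n k) : iter (k.+1 * n) (@promotion n k) E = E.
  have [c ec] := theta_surj E; have [el ncc fuc] := theta_labels c.
  rewrite ec in el; have [ep _ _] := promotion_iter (k.+1 * n) ncc fuc el.
  have sz : size (labels [seq nc_part P | P <- c]) = k.+1 * n.
    by rewrite -size_firsts -el (size_kdyck (kdyckP _)).
  have rotid : rot (k.+1 * n) (labels [seq nc_part P | P <- c]) = labels [seq nc_part P | P <- c].
    by rewrite -sz rot_size.
  by apply: val_inj; apply: val_inj; rewrite [LHS]ep iter_rot1 ?rotid ?sz.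
rewrite -[D]cyc -[D']cyc; have : 0 < k.+1 * n by rewrite muln_gt0.
by case: (k.+1 * n) => // m _; rewrite !iterSr e.
Qed.

Lemma same_su n (P : {set {set 'I_n}}) i j : same (su_part P) i j = same_region P i j.
Proof.
rewrite /same /su_part pblock_equivalence_partition ?inE //.
exact: same_region_equiv.
Qed.

Section Kreweras.
Variables (n : nat) (P : nc n) (r : 'I_n).
Let m := nx P r.
Let pP := nc_partition P.
Let ncrP := nc_noncrossing P.

(** A block with points both inside and outside of the gap between [r] and its
    successor [m] would cross the block of [r]. *)
Lemma gap_closed x y : same P x y -> cdist n r x < cdist n r m -> cdist n r y < cdist n r m.
Proof.
move=> xy inx; rewrite ltnNge; apply/negP => outy.
have rx : same P r x = false by apply/negP => /(nx_min pP); rewrite -/m leqNgt inx.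
have rm : same P r m by exact: nx_same.
have ym : y != m by apply: contraFneq rx => e; rewrite (same_trans pP rm) // -e same_sym.
have yr : y != r by apply: contraFneq rx => e; rewrite same_sym // -e.
have cr (a b c d : 'I_n) : a < b -> b < c -> c < d -> same P a c -> same P b d ->
    ((a == r) || (a == m)) && ((b == x) || (b == y)) || ((b == r) || (b == m)) && ((a == x) || (a == y)) -> False.
  move=> ab bc cd ac bd; have := noncrossing_same pP ncrP ab bc cd ac bd => sab.
  have tm z : (z == r) || (z == m) -> same P r z by case/orP=> /eqP->; rewrite ?same_refl.
  have tx z : (z == x) || (z == y) -> same P x z by case/orP=> /eqP->; rewrite ?same_refl.
  case/orP=> /andP[/tm h1 /tx h2]; move/negP: rx; apply.
    by apply: (same_trans pP h1); apply: (same_trans pP sab); rewrite same_sym.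
  by apply: (same_trans pP h1); rewrite same_sym //; apply: (same_trans pP h2).
have ny : y != m :> nat by []. have ny' : y != r :> nat by [].
have sym1 : same P m r by rewrite same_sym.
have sym2 : same P y x by rewrite same_sym.
move: inx outy; rewrite /cdist; have := ltn_ord r; have := ltn_ord x; have := ltn_ord y.
have := ltn_ord m => lm ly lx lr.
case: (ltnP r x) => rx'; case: (ltnP r m) => rm'; case: (ltnP r y) => ry' h1 h2.
- by apply: (cr r x m y) => //; rewrite ?eqxx ?orbT //; move: lm ly lx lr rx' rm' ry' h1 h2 ny ny'; clear; lia.
- by apply: (cr y r x m) => //; rewrite ?eqxx ?orbT //; move: lm ly lx lr rx' rm' ry' h1 h2 ny ny'; clear; lia.
- by move: lm ly lx lr rx' rm' ry' h1 h2 ny ny'; clear; lia.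
- by apply: (cr m y r x) => //; rewrite ?eqxx ?orbT //; move: lm ly lx lr rx' rm' ry' h1 h2 ny ny'; clear; lia.
- by move: lm ly lx lr rx' rm' ry' h1 h2 ny ny'; clear; lia.
- by move: lm ly lx lr rx' rm' ry' h1 h2 ny ny'; clear; lia.
- by move: lm ly lx lr rx' rm' ry' h1 h2 ny ny'; clear; lia.
- by apply: (cr x m y r) => //; rewrite ?eqxx ?orbT //; move: lm ly lx lr rx' rm' ry' h1 h2 ny ny'; clear; lia.
Qed.

(** The chord from the primed point just after [r] to the one just before [m]
    cuts off the gap between [r] and [m], which is a union of blocks; the chords
    to the primed points met on the way from one to the other separate [r] from
    [m]. *)
Lemma nx_su : nx (su_part P) (rev_ord r) = rev_ord (ord_pred m).
Proof.
have pS : partition (su_part P) [set: 'I_n] := nc_partition (SU P).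
have lr := ltn_ord r; have lm := ltn_ord m.
apply: nxE => //.
  rewrite same_su; apply/same_regionP => B x y BP xB yB.
  have xy : same P x y by apply/(sameP pP); exists B; rewrite ?xB.
  have yx : same P y x by rewrite same_sym.
  have e : (cdist n r x < cdist n r m) = (cdist n r y < cdist n r m).
    by apply/idP/idP; exact: gap_closed.
  have key z : side (rev_ord r) (rev_ord (ord_pred m)) z =
      (cdist n r z < cdist n r m) (+) ((m <= r) && (m != 0 :> nat)).
    rewrite /side !rev_ordK val_ord_pred /cdist; have := ltn_ord z => lz.
    case: (eqVneq (m : nat) 0) => m0.
      have -> : (n.-1 < z) = false by move: lz; clear; lia.
      rewrite m0 andbF; case: (ltnP r z) => ?; rewrite /= ?subn0; case: ltnP => ? //; exfalso; lia.
    move: lr lm lz m0; clear => lr lm lz m0.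
    rewrite andbT; case: (ltnP r z) => ?; case: (ltnP m.-1 z) => ?; case: (ltnP r m) => ?;
      rewrite /=; case: ltnP => ? //; exfalso; lia.
  by rewrite !key e.
move=> x; rewrite same_su leqNgt => /same_regionP h; apply/negP.
have /(sameP pP)[B BP /andP[rB mB]] : same P r m by exact: nx_same.
have := h B r m BP rB mB; rewrite /side rev_ordK ltnn addFb => e.
have vr (u : 'I_n) : rev_ord u = n - u.+1 :> nat by [].
have := val_ord_pred m; move: (ord_pred m) => pm epm.
move: e; rewrite /cdist !vr; have := ltn_ord x; move: (n - x.+1) (subnK (ltn_ord x)) => z ez lx.
have lpm := ltn_ord pm; move: lr lm epm ez lx lpm; clear => lr lm epm ez lx lpm; move: epm; case: (eqVneq (m : nat) 0) => m0 epm.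
  rewrite m0; case: (ltnP z r) => ?; rewrite ?ltn0 //= => _.
  case: ifP => ?; case: ifP => ?; lia.
case: (ltnP z r) => ?; case: (ltnP r m) => ?; case: (ltnP z m) => ? //= _;
  case: ifP => ?; case: ifP => ?; lia.
Qed.

End Kreweras.

Lemma refines_su n (P Q : nc n) : refines Q P -> refines (SU P) (SU Q).
Proof.
move=> /(refinesE (nc_partition P) (nc_partition Q)) h; apply/refinesE; try exact: nc_partition.
move=> i j; rewrite /= !same_su => /same_regionP sP; apply/same_regionP => B x y BQ xB yB.
have /(sameP (nc_partition P))[C CP /andP[xC yC]] : same P x y.
  by apply: h; apply/(sameP (nc_partition Q)); exists B; rewrite ?xB.
exact: sP CP xC yC.
Qed.

Lemma su_chain_sorted n k (c : kchain n k) :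
  sorted (fun P Q : nc n => refines Q P) (rev_map_chain (@SU n) c).
Proof.
rewrite /= rev_sorted sorted_map; apply: sub_sorted (kchainP c) => P Q; exact: refines_su.
Qed.

Definition su_chain n k (c : kchain n k) : kchain n k := KChain (su_chain_sorted c).

Lemma rev_flatten (T : Type) (s : seq (seq T)) : rev (flatten s) = flatten (rev (map rev s)).
Proof.
elim: s => //= x s IH; rewrite rev_cat IH rev_cons flatten_rcons //.
Qed.

Lemma rev_flatten_groups (T U : Type) (G : T -> seq U) s :
  rev (flatten [seq G x | x <- s]) = flatten [seq rev (G x) | x <- rev s].
Proof. by rewrite rev_flatten -map_comp -map_rev. Qed.

Lemma rev_enum_ord n : rev (enum 'I_n) = map (@rev_ord n) (enum 'I_n).
Proof.
case: n => [|n]; first by rewrite (size0nil (size_enum_ord 0)).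
apply: (@eq_from_nth _ ord0); first by rewrite size_rev size_map.
move=> i; rewrite size_rev size_enum_ord => lt_i.
rewrite nth_rev ?size_enum_ord // (nth_map ord0) ?size_enum_ord //.
by apply: val_inj; rewrite /= !nth_enum_ord // ?subSS //; lia.
Qed.

(** A group of [rot 1 L] consists of the successors of [p] and of [p + 1].  Read
    backwards, it is [p + 1] followed by the successors in the order of the
    reversed chain, and by [nx_su] these are the successors in the complements,
    renamed. *)
Lemma labels_su n (c : seq (nc n)) :
  labels [seq nc_part P | P <- rev (map (@SU n) c)] =
  map (fun x => rev_ord (ord_pred x)) (rev (rot 1 (labels [seq nc_part P | P <- c]))).
Proof.
rewrite labels_rot1 rev_flatten_groups rev_enum_ord map_flatten -map_comp -map_comp.
congr flatten; apply: eq_map => p /=.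
rewrite rev_rcons /= ordSK rev_ordK; congr cons.
rewrite !map_rev !revK -!map_comp; apply: eq_map => P /=.
by rewrite -nx_su rev_ordK.
Qed.

Lemma theta_su n k (c : kchain n k) : theta (su_chain c) = evacuation (promotion (theta c)).
Proof.
have [ec ncc fuc] := theta_labels c; have [er _ _] := theta_labels (su_chain c).
have ep := promotion_firsts ncc fuc ec.
have ee := evacuation_firsts (noncr_rot ncc) (@full_rot _ k 1 _ fuc) ep.
apply: val_inj; apply: val_inj; rewrite [LHS]er [RHS]ee /= labels_su firsts_map //.
by move=> x y _ _ /rev_ord_inj/ord_pred_inj.
Qed.

(** * Greedy matchings and the effect of a shift *)

(** An entry of a permutation: its value and its position. *)
Definition item := (nat * nat)%type.

(** Row insertion seen from its result.  Both lists increase; the items of [E] are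
    appended to the first row when they are read, those of [F] bump the smallest
    larger entry there, if there is one.  An item [e] with [e.1 < f.1] stays in
    the first row for ever, and [f] with [f.2 < e.2] comes too early to find any
    larger entry. *)
Fixpoint greedy (E : seq item) : seq item -> seq (item * item) :=
  if E is e :: E' then
    fix greedyF F := if F is f :: F' then
      if e.1 < f.1 then greedy E' F
      else if f.2 < e.2 then greedyF F'
      else (e, f) :: greedy E' F'
    else [::]
  else fun=> [::].

Definition bumped (G : seq (item * item)) := [seq g.1.1 | g <- G].
Definition bumpers (G : seq (item * item)) := [seq g.2.2 | g <- G].

Lemma greedy_cons e E f F : greedy (e :: E) (f :: F) =
  if e.1 < f.1 then greedy E (f :: F)
  else if f.2 < e.2 then greedy (e :: E) F else (e, f) :: greedy E F.
Proof. by []. Qed.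

Lemma greedy_nil E : greedy E [::] = [::].
Proof. by case: E. Qed.

(** The effect of [Dyck2] on the items of the inverse permutation, see
    [wex_next]; [j] is the position given to the first item. *)
Fixpoint shift_up j (L : seq item) : seq item :=
  if L is e :: L' then (e.1, j) :: shift_up e.2 L' else [::].

Definition incr (p : item -> nat) : rel item := fun e f => p e < p f.

(** An item [e] of [E] that [f'] is too large to bump comes before [f].  For the
    lists of interest this expresses that every entry of a 321-avoiding
    permutation other than the weak excedances follows a larger entry, see
    [old_locked]. *)
Definition locked (E : seq item) : rel item :=
  fun f f' => all (fun e => (e.1 < f'.1) ==> (e.2 < f.2)) E.

Lemma sub_locked E e f F : path (locked (e :: E)) f F -> path (locked E) f F.
Proof. by apply: sub_path => f1 f2 /andP[]. Qed.

Lemma last_incr p (x : item) s : path (incr p) x s -> p x <= p (last x s).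
Proof.
elim: s x => //= y s IH x /andP[xy /IH]; apply: leq_trans; exact: ltnW.
Qed.

(** The common last item is a sentinel, larger than everything else in both
    coordinates. *)
Record synchronized e E f F : Prop := Synchronized {
  sync_val : path (incr fst) e E;
  sync_pos : path (incr snd) e E;
  sync_pos' : path (incr snd) f F;
  sync_val' : path (incr fst) f F;
  sync_last : last e E = last f F;
  sync_locked : path (locked (e :: E)) f F }.

Lemma sync_both e E f F e1 f1 : synchronized e (e1 :: E) f (f1 :: F) -> synchronized e1 E f1 F.
Proof.
by case=> /= /andP[_ ?] /andP[_ ?] /andP[_ ?] /andP[_ ?] ? /andP[_ /sub_locked ?].
Qed.

Lemma sync_left e E f F e1 : synchronized e (e1 :: E) f F -> synchronized e1 E f F.
Proof. by case=> /= /andP[_ ?] /andP[_ ?] ? ? ? /sub_locked ?. Qed.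

Lemma sync_right e E f F f1 : synchronized e E f (f1 :: F) -> synchronized e E f1 F.
Proof. by case=> /= ? ? /andP[_ ?] /andP[_ ?] ? /andP[_ ?]. Qed.

Lemma sync_pos_le e E f F : synchronized e E f F -> e.2 <= (last f F).2.
Proof. by case=> _ sE _ _ <- _; exact: last_incr sE. Qed.

Lemma sync_last_nil e E f F : synchronized e E f F -> f.1 <= e.1 -> e.2 <= f.2 ->
  (E == [::]) = (F == [::]).
Proof.
case=> sE _ sF _ l _ fe ef; case: E F sE sF l => [|e1 E] [|f1 F] //= sE sF l.
  by have := @last_incr snd _ _ (proj2 (andP sF)); rewrite -l; have := proj1 (andP sF); rewrite /incr; lia.
by have := @last_incr fst _ _ (proj2 (andP sE)); rewrite l; have := proj1 (andP sE); rewrite /incr; lia.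
Qed.

Lemma greedy_shift_cons j (e : item) E (f f1 : item) F : j <= f.2 ->
  greedy (shift_up j (e :: E)) (shift_up f.2 (f1 :: F)) =
  if e.1 < f1.1 then greedy (shift_up e.2 E) (shift_up f.2 (f1 :: F))
  else ((e.1, j), (f1.1, f.2)) :: greedy (shift_up e.2 E) (shift_up f1.2 F).
Proof.
move=> le_jf; rewrite -[shift_up j _]/((e.1, j) :: shift_up e.2 E).
by rewrite -[shift_up f.2 _]/((f1.1, f.2) :: shift_up f1.2 F) greedy_cons [(_, _).2 < _]ltnNge le_jf.
Qed.

(** How the matchings before and after the shift compare once they have parted.
    In the first statement [e] is bumped before the shift only; in the second
    one the position of [f] bumps after the shift only.  The position of the
    sentinel, which bumps before the shift only, restores the balance.  The
    statements are proved together because either situation can turn into the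
    other one. *)
Lemma greedy_shift m :
  (forall e E f F, size E + size F < m -> synchronized e E f F -> f.1 <= e.1 ->
    let old := greedy (e :: E) (f :: F) in
    let new := greedy (shift_up e.2 E) (shift_up f.2 F) in
    bumped old = e.1 :: bumped new /\
    bumpers old = rcons (bumpers new) (last f F).2) /\
  (forall j e E f f1 F, size E + size F < m -> synchronized e E f1 F ->
     f.2 < f1.2 -> locked (e :: E) f f1 -> j <= f.2 ->
    let old := greedy (e :: E) (f1 :: F) in
    let new := greedy (shift_up j (e :: E)) (shift_up f.2 (f1 :: F)) in
    bumped old = bumped new /\
    f.2 :: bumpers old = rcons (bumpers new) (last f1 F).2).
Proof.
elim: m => [|m [IHA IHB]]; first by split.
have A e E f F : size E + size F < m.+1 -> synchronized e E f F -> f.1 <= e.1 ->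
    let old := greedy (e :: E) (f :: F) in
    let new := greedy (shift_up e.2 E) (shift_up f.2 F) in
    bumped old = e.1 :: bumped new /\
    bumpers old = rcons (bumpers new) (last f F).2.
  move=> lt_m sy le_fe; rewrite greedy_cons ltnNge le_fe /=.
  case: (ltnP f.2 e.2) => [fe|ef].
    case: F lt_m sy => [|f1 F] lt_m sy; first by have := sync_pos_le sy; rewrite /= leqNgt fe.
    have /andP[/allP/(_ e (mem_head _ _)) lk _] := sync_locked sy.
    have le_f1e : f1.1 <= e.1 by rewrite leqNgt; apply/negP => lt; move: lk; rewrite lt /= ltnNge (ltnW fe).
    have -> : greedy (shift_up e.2 E) (shift_up f.2 (f1 :: F)) = greedy (shift_up e.2 E) (shift_up f1.2 F).
      case: E {lt_m lk} sy => // e1 E sy; have /andP[lt_ee1 _] := sync_val sy.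
      by rewrite [LHS]greedy_cons /= ltnNge (leq_trans le_f1e (ltnW lt_ee1)) /= fe.
    apply: IHA => //; first by move: lt_m; rewrite /= addnS ltnS.
    exact: sync_right sy.
  have := sync_last_nil sy le_fe ef; case: E F lt_m sy => [|e1 E] [|f1 F] //= lt_m sy _.
  have /andP[lk _] := sync_locked sy; have /andP[lt_ff1 _] := sync_pos' sy.
  have lt_m' : size E + size F < m by move: lt_m; lia.
  have lk' : locked (e1 :: E) f f1 by case/andP: lk.
  by have [-> <-] := IHB e.2 e1 E f f1 F lt_m' (sync_both sy) lt_ff1 lk' ef.
split=> // j e E f f1 F lt_m sy lt_ff1 lk le_jf.
rewrite greedy_shift_cons //; cbv zeta; case: (ltnP e.1 f1.1) => [lt_ef1|le_f1e]; last first.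
  by have [eA1 eA2] := A e E f1 F lt_m sy le_f1e; rewrite eA1 eA2.
have -> : greedy (e :: E) (f1 :: F) = greedy E (f1 :: F) by rewrite greedy_cons lt_ef1.
case: E lt_m sy lk => [|e1 E] lt_m sy lk.
  by have := last_incr (sync_val' sy); rewrite -(sync_last sy) /= leqNgt lt_ef1.
case/andP: lk; rewrite lt_ef1 /= => lt_ef lk.
exact: IHB (sync_left sy) lt_ff1 lk (ltnW lt_ef).
Qed.

(** As long as the heads of the two lists are matched, the shift has no effect on
    the values that are bumped and the positions that bump; [E0] and [F0] consist
    of these heads.  At the first head [f0] that finds nothing to bump, the shift
    gives it a partner and its position becomes a bumping one; at the first [e0]
    that is out of reach for the next item of [F], the shift separates it from
    its partner and its value is no longer bumped.  By [greedy_shift] nothing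
    else changes, except for the sentinel. *)
Lemma greedy_shift_flip j e E f F : synchronized e E f F -> f.1 <= e.1 -> j <= f.2 -> F != [::] ->
  let old := greedy (e :: E) (f :: F) in
  let new := greedy (shift_up j (e :: E)) (shift_up f.2 F) in
  exists E0 e0 E2 F0 f0 F2 r, [/\ e :: E = E0 ++ e0 :: E2, f :: F = F0 ++ f0 :: F2,
    size E0 = size F0 &
    [/\ all (fun x => x.2 < f0.2) E0, f0.2 < e0.2, bumped new = bumped old,
       bumpers old = map snd F0 ++ r & rcons (bumpers new) (last f F).2 = map snd F0 ++ f0.2 :: r]
    \/ [/\ all (fun x => e0.1 < x.1) F2, f0.1 <= e0.1 < (last f F).1, rcons (bumpers new) (last f F).2 = bumpers old,
       bumped old = map fst E0 ++ e0.1 :: r & bumped new = map fst E0 ++ r]].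
Proof.
elim: F E e f j => // f1 F IH E e f j sy le_fe le_jf _ old new.
have /andP[/= lt_ff1 _] := sync_pos' sy.
have /andP[lk _] := sync_locked sy.
have eo : old = if f.2 < e.2 then greedy (e :: E) (f1 :: F) else (e, f) :: greedy E (f1 :: F).
  by rewrite /old greedy_cons ltnNge le_fe.
have en := greedy_shift_cons e E f1 F le_jf; rewrite -/new in en.
case: (ltnP f.2 e.2) eo => [lt_fe|le_ef] eo.
  have le_f1e : f1.1 <= e.1.
    by rewrite leqNgt; apply/negP => lt; case/andP: lk; rewrite lt /= ltnNge (ltnW lt_fe).
  rewrite ltnNge le_f1e /= in en.
  have [eA1 eA2] := proj1 (greedy_shift (size E + size F).+1) e E f1 F (ltnSn _) (sync_right sy) le_f1e.
  exists [::], e, E, [::], f, (f1 :: F), (bumpers old); split=> //; left; split=> //.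
    by rewrite eo eA1 en.
  by rewrite eo eA2 en.
have ne : E != [::] by rewrite (sync_last_nil sy le_fe le_ef).
have lt_eN : e.2 < (last f (f1 :: F)).2.
  exact: leq_ltn_trans le_ef (leq_trans lt_ff1 (last_incr (proj2 (andP (sync_pos' sy))))).
case: E ne sy lk @old @new eo en => // e1 E _ sy lk old new eo en.
case: (ltnP e.1 f1.1) en => [lt_ef1|le_f1e] en.
  have lk' : locked (e1 :: E) f f1 by case/andP: lk.
  have [eB1 eB2] := proj2 (greedy_shift (size E + size F).+1) e.2 e1 E f f1 F (ltnSn _) (sync_both sy) lt_ff1 lk' le_ef.
  exists [::], e, (e1 :: E), [::], f, (f1 :: F), (bumped new); split=> //; right; split=> //.
  - apply/allP => x xF; apply: leq_trans lt_ef1 _; move: xF; rewrite inE => /orP[/eqP->//|xF].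
    have /andP[_ sF] := sync_val' sy; apply: ltnW.
    by apply: (allP (order_path_min _ sF)) => // u v w; exact: ltn_trans.
  - by rewrite le_fe (leq_trans lt_ef1) // (last_incr (proj2 (andP (sync_val' sy)))).
  - by rewrite eo en -eB2.
  - by rewrite eo en /= -eB1.
have F0 : F != [::].
  case: F sy lt_eN lt_ff1 le_f1e {IH old new eo en lk} => // sy lt_eN lt_ff1 le_f1e.
  have lt_ee1 : e.1 < e1.1 by case/andP: (sync_val sy).
  have := last_incr (sync_val (sync_left sy)); rewrite (sync_last (sync_left sy)) /= => le1.
  by move: (leq_trans lt_ee1 le1); rewrite ltnNge le_f1e.
have le_f1e1 : f1.1 <= e1.1.
  by apply: leq_trans le_f1e _; apply: ltnW; case/andP: (sync_val sy).
have [E0 [e0 [E2 [F0' [f0 [F2 [r [eE eF sz h]]]]]]]] :=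
  IH E e1 f1 e.2 (sync_both sy) le_f1e1 (leq_trans le_ef (ltnW lt_ff1)) F0.
exists (e :: E0), e0, E2, (f :: F0'), f0, F2, r; split; rewrite ?eE ?eF //= ?sz //.
rewrite eo en; case: h => [[lE lt0 e1' e2' e3']|[lF le0 e1' e2' e3']]; [left|right]; split=> //.
- rewrite /= lE andbT; apply: leq_ltn_trans le_ef _.
  have : f0 \in f1 :: F by rewrite eF mem_cat mem_head orbT.
  rewrite inE => /orP[/eqP->//|f0F]; have /andP[_ sF] := sync_pos' sy.
  apply: ltn_trans lt_ff1 _; apply: (allP (order_path_min _ sF)) => // u v w; exact: ltn_trans.
- by rewrite /= e1'.
- by rewrite /= e2'.
- by rewrite /= e3'.
- by rewrite /= e1'.
- by rewrite /= e2'.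
- by rewrite /= e3'.
Qed.

(** * Peaks and valleys of Dyck paths *)
Fixpoint corners_from (a b : bool) (x y : nat) (prev : bool) (w : seq bool) : seq (nat * nat) :=
  if w is c :: w' then
    (if (prev == a) && (c == b) then [:: (x, y)] else [::])
      ++ corners_from a b (x + ~~ c) (y + c) c w'
  else [::].

Lemma cornersE a b c w : corners a b (c :: w) = corners_from a b (~~ c) c c w.
Proof.
suff key u prev v : [seq path_point (rcons u prev ++ v) t | t <- iota (size u).+1 (size v)
    & (nth false (rcons u prev ++ v) t.-1 == a) && (nth false (rcons u prev ++ v) t == b)]
  = corners_from a b (count_mem false (rcons u prev)) (count_mem true (rcons u prev)) prev v.
  by have := key [::] c w; rewrite /corners /= addn0 addn0 => ->; case: c.
elim: v u prev => //= d v IH u prev.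
rewrite -cat_rcons -(size_rcons u prev).
have e1 : nth false (rcons (rcons u prev) d ++ v) (size u) = prev.
  by rewrite cat_rcons nth_cat size_rcons ltnSn nth_rcons ltnn eqxx.
have e2 : nth false (rcons (rcons u prev) d ++ v) (size (rcons u prev)) = d.
  by rewrite cat_rcons nth_cat ltnn subnn.
rewrite e1 e2.
have eT := IH (rcons u prev) d.
have cU (e : bool) : count_mem e (rcons (rcons u prev) d) = count_mem e (rcons u prev) + (d == e).
  by rewrite -[in LHS]cats1 count_cat /= addn0.
rewrite !cU in eT; have -> : (~~ d : nat) = (d == false) by case: (d).
have -> : (d : nat) = (d == true) by case: (d).
rewrite -eT; case: ifP => _ //=; congr cons.
by rewrite /path_point cat_rcons take_size_cat.
Qed.

(** The end at [(n, n)] of a path that passes through [(x, y)], given by the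
    valleys that remain. *)
Fixpoint valley_word n x y (vl : seq (nat * nat)) : seq bool :=
  if vl is v :: vl' then nseq (v.2 - y) true ++ nseq (v.1 - x) false ++ valley_word n v.1 v.2 vl'
  else nseq (n - y) true ++ nseq (n - x) false.

Fixpoint valley_seq n x y (vl : seq (nat * nat)) : bool :=
  if vl is v :: vl' then [&& x < v.1, y < v.2, v.1 <= v.2 & valley_seq n v.1 v.2 vl']
  else (x < n) && (y < n).

Lemma corners_from_run a b x y c j w : a != b ->
  corners_from a b x y c (nseq j c ++ w) =
  corners_from a b (x + ~~ c * j) (y + c * j) c w.
Proof.
move=> ne; elim: j x y => [|j IH] x y /=; first by rewrite !muln0 !addn0.
have -> : (c == a) && (c == b) = false by apply/andP=> -[/eqP ea /eqP eb]; rewrite -ea -eb eqxx in ne.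
by rewrite /= IH !mulnS !addnA.
Qed.

Lemma corners_from_up a b x y z w : a != b -> y < z ->
  corners_from a b x y false (nseq (z - y) true ++ w) =
  (if (a == false) && (b == true) then [:: (x, y)] else [::]) ++ corners_from a b x z true w.
Proof.
move=> ne lt_yz; have -> : z - y = (z - y.+1).+1 by lia.
rewrite /= corners_from_run // addn0 mul0n mul1n addn0 addn1 subnKC //.
by rewrite eq_sym [true == _]eq_sym.
Qed.

Lemma corners_from_right a b x y z w : a != b -> x < z ->
  corners_from a b x y true (nseq (z - x) false ++ w) =
  (if (a == true) && (b == false) then [:: (x, y)] else [::]) ++ corners_from a b z y false w.
Proof.
move=> ne lt_xz; have -> : z - x = (z - x.+1).+1 by lia.
rewrite /= corners_from_run // addn0 mul0n mul1n addn0 addn1 subnKC //.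
by rewrite eq_sym [false == _]eq_sym.
Qed.

Lemma peaks_from n x y vl : valley_seq n x y vl ->
  corners_from true false x y false (valley_word n x y vl)
  = zip (x :: unzip1 vl) (rcons (unzip2 vl) n).
Proof.
elim: vl x y => [|v vl IH] x y /=.
  case/andP=> xn yn; rewrite corners_from_up // -[nseq (n - x) false]cats0.
  by rewrite corners_from_right.
case/and4P=> xv yv _ /IH h.
by rewrite corners_from_up // corners_from_right // h.
Qed.

Lemma valleys_from n x y vl : valley_seq n x y vl ->
  corners_from false true x y false (valley_word n x y vl) = (x, y) :: vl.
Proof.
elim: vl x y => [|v vl IH] x y /=.
  case/andP=> xn yn; rewrite corners_from_up // -[nseq (n - x) false]cats0.
  by rewrite corners_from_right.
case/and4P=> xv yv _ /IH h.
by rewrite corners_from_up // corners_from_right // h -surjective_pairing.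
Qed.

Lemma valley_word_head n x y vl : valley_seq n x y vl ->
  exists w, valley_word n x y vl = true :: w.
Proof.
have nS j z : j < z -> nseq (z - j) true = true :: nseq (z - j.+1) true.
  by move=> lt_jz; have -> : z - j = (z - j.+1).+1 by lia.
case: vl => [|v vl] /=; first by case/andP=> _ yn; rewrite nS //; eexists.
by case/and4P=> _ yv _ _; rewrite nS //; eexists.
Qed.

Lemma peaks_valley_word n vl : valley_seq n 0 0 vl ->
  peaks (valley_word n 0 0 vl) = zip (0 :: unzip1 vl) (rcons (unzip2 vl) n).
Proof.
move=> vv; have [w ew] := valley_word_head vv.
by rewrite /peaks -(peaks_from vv) ew cornersE.
Qed.

Lemma valleys_valley_word n vl : valley_seq n 0 0 vl ->
  valleys (valley_word n 0 0 vl) = vl.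
Proof.
move=> vv; have [w ew] := valley_word_head vv.
by have := valleys_from vv; rewrite /valleys ew cornersE /= => -[].
Qed.

Definition stays_above x y w :=
  forall i, x + count_mem false (take i w) <= y + count_mem true (take i w).

Lemma stays_above_up x y j w : x <= y -> stays_above x (y + j) w ->
  stays_above x y (nseq j true ++ w).
Proof.
move=> le_xy h i; rewrite take_cat size_nseq; case: ltnP => [lt_i|le_i].
  by rewrite take_nseq ?(ltnW lt_i) // !count_mem_nseq /=; lia.
rewrite !count_cat !count_mem_nseq /= mul1n; have := h (i - j).
by set A := count_mem false _; set B := count_mem true _; lia.
Qed.

Lemma stays_above_right x y j w : x + j <= y -> stays_above (x + j) y w ->
  stays_above x y (nseq j false ++ w).
Proof.
move=> le_xy h i; rewrite take_cat size_nseq; case: ltnP => [lt_i|le_i].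
  by rewrite take_nseq ?(ltnW lt_i) // !count_mem_nseq /=; lia.
rewrite !count_cat !count_mem_nseq /= mul1n; have := h (i - j).
by set A := count_mem false _; set B := count_mem true _; lia.
Qed.

Lemma valley_word_above n x y vl : x <= y -> valley_seq n x y vl ->
  [/\ stays_above x y (valley_word n x y vl),
      count_mem true (valley_word n x y vl) = n - y
    & count_mem false (valley_word n x y vl) = n - x].
Proof.
elim: vl x y => [|v vl IH] x y le_xy /=.
  case/andP=> xn yn; rewrite !count_cat !count_mem_nseq /= !mul1n addn0; split=> //.
  apply: stays_above_up => //; rewrite -[nseq (n - x) false]cats0.
  rewrite subnKC; last exact: ltnW.
  apply: stays_above_right; first by lia.
  by rewrite (subnKC (ltnW xn)).
case/and4P=> xv yv le_v vv; have [h hU hR] := IH _ _ le_v vv.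
have [vn1 vn2] : v.1 <= n /\ v.2 <= n.
  elim: (vl) v.1 v.2 vv {h hU hR le_v xv yv IH} => [|u vl' IH'] p q /=; first by case/andP=> *; split; apply: ltnW.
  by case/and4P=> pu qu _ /IH'[]; lia.
rewrite !count_cat !count_mem_nseq /= hU hR !mul1n !mul0n; split; [|by lia|by lia].
apply: stays_above_up => //; rewrite subnKC ?(ltnW yv) //.
apply: stays_above_right; first by lia.
by rewrite subnKC ?(ltnW xv).
Qed.

Lemma valley_word_kdyck n vl : valley_seq n 0 0 vl -> is_kdyck 1 n (valley_word n 0 0 vl).
Proof.
move=> /(valley_word_above (leqnn 0))[h hU hR]; apply/is_kdyckP; split.
- by rewrite hU subn0.
- by rewrite hR subn0 mul1n.
- by move=> i; rewrite mul1n; have := h i.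
Qed.

Lemma valley_word_parse n x y w : x <= y -> y < n -> stays_above x y w ->
  count_mem true w = n - y -> count_mem false w = n - x -> ohead w = Some true ->
  exists2 vl, valley_seq n x y vl & w = valley_word n x y vl.
Proof.
have [m] := ubnP (size w); elim: m x y w => // m IH x y w lt_m le_xy yn ab wU wR hw.
have [j [w1 [ew hw1]]] := leading_run true w; have [i [w2 [ew1 hw2]]] := leading_run false w1.
have j0 : 0 < j by case: j ew => // ew; rewrite -[w1]/(nseq 0 true ++ w1) -ew hw in hw1.
have i0 : w2 != [::] -> 0 < i.
  case: i ew1 => // ew1 ne; move: hw1 hw2 ne; rewrite ew1 /=; by case: (w2) => // -[].
move: wU wR; rewrite ew ew1 !count_cat !count_mem_nseq /= !mul1n !mul0n add0n => wU wR.
have [e2|ne2] := eqVneq w2 [::].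
  exists [::]; first by rewrite /= yn (leq_ltn_trans le_xy).
  have ej : n - y = j by move: wU; rewrite e2 /=; lia.
  have ei : n - x = i by move: wR; rewrite e2 /=; lia.
  by rewrite /= ej ei e2 cats0.
have {}i0 := i0 ne2; have hw2' : ohead w2 = Some true by case: (w2) hw2 ne2 => // -[].
have U2 : 0 < count_mem true w2 by case: (w2) hw2' => // -[].
have le2 : x + i <= y + j.
  have := ab (j + i); rewrite ew ew1 catA takel_cat; last by rewrite size_cat !size_nseq.
  by rewrite take_oversize ?size_cat ?size_nseq // !count_cat !count_mem_nseq /=; lia.
have ab2 : stays_above (x + i) (y + j) w2.
  move=> l; have := ab (j + i + l); rewrite ew ew1 catA take_cat size_cat !size_nseq.
  by rewrite ltnNge leq_addr /= addKn !count_cat !count_mem_nseq /=; lia.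
have lt2 : size w2 < m by move: lt_m; rewrite ew ew1 !size_cat !size_nseq; lia.
have [yn2 cU2 cR2] : [/\ y + j < n, count_mem true w2 = n - (y + j) & count_mem false w2 = n - (x + i)].
  by move: wU wR U2; set a := count_mem true w2; set b := count_mem false w2; split; lia.
have [vl vv e] := IH _ _ _ lt2 le2 yn2 ab2 cU2 cR2 hw2'.
exists ((x + i, y + j) :: vl).
  by rewrite /= vv le2 -{1}[x]addn0 -{1}[y]addn0 !ltn_add2l i0 j0.
by rewrite /= !addKn -e.
Qed.

(** Peel off one maximal run of up steps and one of right steps at a time. *)
Lemma kdyck_valley_word n w : 0 < n -> is_kdyck 1 n w ->
  exists2 vl, valley_seq n 0 0 vl & w = valley_word n 0 0 vl.
Proof.
move=> n0 /is_kdyckP[wU wR wP]; apply: valley_word_parse => //.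
- by move=> i; have := wP i; rewrite mul1n.
- by rewrite subn0.
- by rewrite subn0 wR mul1n.
- case: w wU wR wP => [wU|[] //]; first by rewrite -wU in n0.
  by move=> w _ _ /(_ 1); rewrite /= take0.
Qed.

(** * Row insertion into at most two rows *)
Definition rs_step (AB : seq (seq nat) * seq (seq nat)) (z : item) :=
  rs_insert z.1 z.2 AB.1 AB.2.

(** Tableaux have no empty rows. *)
Definition two_rows (r1 r2 : seq nat) : seq (seq nat) :=
  if nilp r2 then if nilp r1 then [::] else [:: r1] else [:: r1; r2].

Lemma row_insert_last x (row : seq nat) : {in row, forall y, y < x} -> row_insert x row = (rcons row x, None).
Proof.
elim: row => //= y row IH h; rewrite ltnNge (ltnW (h y (mem_head _ _))) /= IH // => z zr.
by apply: h; rewrite inE zr orbT.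
Qed.

Lemma row_insert_bump x (X : seq nat) y Z : {in X, forall z, z < x} -> x < y ->
  row_insert x (X ++ y :: Z) = (X ++ x :: Z, Some y).
Proof.
elim: X => [|z X IH] h xy /=; first by rewrite xy.
rewrite ltnNge (ltnW (h z (mem_head _ _))) /= IH // => u uX.
by apply: h; rewrite inE uX orbT.
Qed.

Lemma rs_insert_last x i (r1 r2 b1 b2 : seq nat) : {in r1, forall y, y < x} ->
  (nilp r1 -> nilp r2) -> nilp b1 = nilp r1 -> nilp b2 = nilp r2 ->
  rs_step (two_rows r1 r2, two_rows b1 b2) (x, i) = (two_rows (rcons r1 x) r2, two_rows (rcons b1 i) b2).
Proof.
move=> h n12 n1 n2; rewrite /rs_step /two_rows n1 n2 [(x, i).1]/= [(x, i).2]/= [(_, _).1]/= [(_, _).2]/=.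
have nr (T : Type) (s : seq T) (y : T) : nilp (rcons s y) = false by case: s.
case: (@nilP _ r1) n12 h => [e /(_ isT) -> h|ne _ h] /=; first by rewrite e /= nr; rewrite e in n1; case: (b1) n1.
by case: (nilp r2) => /=; rewrite row_insert_last //= !nr.
Qed.

Lemma rs_insert_bump x i (X : seq nat) y Z (r2 b1 b2 : seq nat) : {in X, forall z, z < x} -> x < y ->
  {in r2, forall z, z < y} -> nilp b1 = false -> nilp b2 = nilp r2 ->
  rs_step (two_rows (X ++ y :: Z) r2, two_rows b1 b2) (x, i) =
  (two_rows (X ++ x :: Z) (rcons r2 y), two_rows b1 (rcons b2 i)).
Proof.
move=> hX xy h2 n1 n2; rewrite /rs_step /two_rows n1 n2 [(x, i).1]/= [(x, i).2]/= [(_, _).1]/= [(_, _).2]/=.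
have nr (T : Type) (s : seq T) (z : T) : nilp (rcons s z) = false by case: s.
have nm (T : Type) (s t : seq T) (z : T) : nilp (s ++ z :: t) = false by case: s.
rewrite !nr !nm; case: (@nilP _ r2) h2 n2 => [-> _ /nilP->|ne h2 _] /=; rewrite row_insert_bump //=.
by rewrite row_insert_last.
Qed.

Lemma foldl_step (T R : Type) (f : R -> T -> R) a z I : foldl f a (z :: I) = foldl f (f a z) I.
Proof. by []. Qed.

(** What remains of an insertion when bumped entries always go to the end of the
    second row: both rows of the insertion tableau and the second row of the
    recording tableau. *)
Definition insert_row (st : seq nat * seq nat * seq nat) (z : item) :=
  let: (r1, r2, b2) := st in
  if has (ltn z.1) r1 then
    let i := find (ltn z.1) r1 in
    (set_nth 0 r1 i z.1, rcons r2 (nth 0 r1 i), rcons b2 z.2)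
  else (rcons r1 z.1, r2, b2).

Lemma insert_row_last (r1 r2 b2 : seq nat) z : {in r1, forall y, y < z.1} ->
  insert_row (r1, r2, b2) z = (rcons r1 z.1, r2, b2).
Proof.
move=> h; rewrite /insert_row; case: ifP => // /hasP[y yr /= zy].
by have := ltn_trans zy (h y yr); rewrite ltnn.
Qed.

Lemma insert_row_bump (X : seq nat) y Z (r2 b2 : seq nat) z : {in X, forall x, x < z.1} -> z.1 < y ->
  insert_row (X ++ y :: Z, r2, b2) z = (X ++ z.1 :: Z, rcons r2 y, rcons b2 z.2).
Proof.
move=> h zy; rewrite /insert_row has_cat /= zy orbT.
have -> : find (ltn z.1) (X ++ y :: Z) = size X.
  rewrite find_cat ifN /= ?zy ?addn0 //; apply/hasPn => x /h xz /=.
  by rewrite -leqNgt ltnW.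
rewrite nth_cat ltnn subnn /=; congr (_, _, _).
by elim: X {h} => //= x X ->.
Qed.

Lemma split_row x (r : seq nat) : sorted ltn r -> x \notin r ->
  {in r, forall y, y < x} \/
  exists X y Z, [/\ r = X ++ y :: Z, {in X, forall z, z < x}, x < y & {in Z, forall z, y < z}].
Proof.
elim: r => [|y r IH] /=; first by left.
move=> sr; rewrite inE negb_or => /andP[ne xr]; case: (ltnP y x) => [yx|xy].
  have [h|[X [y' [Z [-> hX xy' hZ]]]]] := IH (path_sorted sr) xr; [left|right].
    by move=> z; rewrite inE => /orP[/eqP->|/h].
  by exists (y :: X), y', Z; split=> // z; rewrite inE => /orP[/eqP->|/hX].
right; exists [::], y, r; split=> //; first by rewrite ltn_neqAle ne.
by apply/allP; rewrite (order_path_min _ sr) //; exact: ltn_trans.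
Qed.

Definition rows (I : seq item) := foldl insert_row ([::], [::], [::]) I.

Lemma rows_spec I : uniq (map fst I) ->
  let: (r1, r2, b2) := rows I in
  [/\ sorted ltn r1, perm_eq (r1 ++ r2) (map fst I) & {subset b2 <= map snd I}].
Proof.
elim/last_ind: I => // I z IH; rewrite ?map_rcons rcons_uniq => /andP[zI /IH{IH}].
rewrite /rows foldl_rcons; case: (foldl _ _ I) => -[r1 r2] b2 [sr pr sb].
have zr : z.1 \notin r1.
  by apply: contra zI => zr; rewrite -(perm_mem pr) mem_cat zr.
have [h|[X [y [Z [e hX zy hZ]]]]] := split_row sr zr.
  rewrite insert_row_last //; split.
  - rewrite (sorted_pairwise ltn_trans) -cats1 pairwise_cat /= andbT -(sorted_pairwise ltn_trans) sr andbT.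
    by apply/allrelP => u v /h uz; rewrite inE => /eqP->.
  - rewrite ?map_rcons perm_sym perm_rcons perm_sym; apply: (@perm_trans _ (z.1 :: r1 ++ r2)).
      by rewrite cat_rcons -[z.1 :: r2]cat1s perm_catCA.
    by rewrite perm_cons.
  - by move=> u /sb ub; rewrite ?map_rcons mem_rcons inE ub orbT.
rewrite e insert_row_bump //; split.
- move: sr; rewrite e !(sorted_pairwise ltn_trans) !pairwise_cat /= !allrel_consr.
  case/and3P=> /andP[_ h1] h2 /andP[_ h3]; rewrite h1 h2 h3 !andbT.
  apply/andP; split; apply/allP => u uu; first exact: hX.
  by apply: ltn_trans zy _; exact: hZ.
- rewrite ?map_rcons perm_sym perm_rcons perm_sym.
  apply: (@perm_trans _ (z.1 :: y :: X ++ Z ++ r2)).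
    by apply/seq.permP => p; rewrite -?cats1 /= !count_cat /= ?count_cat /=; lia.
  rewrite perm_cons -(permPr pr) e.
  by apply/seq.permP => p; rewrite -?cats1 /= !count_cat /= ?count_cat /=; lia.
- by move=> u; rewrite mem_rcons inE ?map_rcons mem_rcons inE => /orP[->//|/sb->]; rewrite orbT.
Qed.

(** The last position tells whether the last insertion was a bump, as it belongs
    to the recorded row exactly in that case; then the last entry of the second
    row, being the bumped one, shows where the inserted value sits, and the
    insertion can be undone. *)
Lemma rows_inj I I' : uniq (map fst I) -> uniq (map fst I') -> uniq (map snd I) ->
  map snd I = map snd I' -> rows I = rows I' -> I = I'.
Proof.
elim/last_ind: I I' => [|I z IH] I' uI uI' uS eS; first by move=> _; apply/esym/size0nil; rewrite -(size_map snd) -eS.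
case/lastP: I' uI' eS => [|I' z'] uI' eS.
  by have := congr1 size eS; rewrite !size_map size_rcons.
move: uI uI' uS eS; rewrite !map_rcons !rcons_uniq => /andP[zI uI] /andP[zI' uI'] /andP[sI uS].
move=> /rcons_inj[eS ez].
have := rows_spec uI; have := rows_spec uI'; have := IH I' uI uI' uS eS; rewrite /rows !foldl_rcons.
case: (foldl _ _ I) => -[r1 r2] b2; case: (foldl _ _ I') => -[r1' r2'] b2' ih [sr' pr' sb'] [sr pr sb].
have zr : z.1 \notin r1 by apply: contra zI => zr; rewrite -(perm_mem pr) mem_cat zr.
have zr' : z'.1 \notin r1' by apply: contra zI' => zr'; rewrite -(perm_mem pr') mem_cat zr'.
have zb : z.2 \notin b2 by apply: contra sI => /sb.
have zb' : z'.2 \notin b2' by rewrite -ez; apply: contra sI => /sb'; rewrite eS.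
have eqz : z.1 = z'.1 -> z = z' by move: ez; case: (z) (z') => ? ? [? ?] /= -> ->.
have [h|[X [y [Z [e hX zy hZ]]]]] := split_row sr zr;
have [h'|[X' [y' [Z' [e' hX' zy' hZ']]]]] := split_row sr' zr'.
- rewrite !insert_row_last // => -[/rcons_inj[e1 e2] e3 e4].
  by rewrite (eqz e2) ih // e1 e3 e4.
- rewrite insert_row_last // e' insert_row_bump // => -[_ _ e4].
  by rewrite e4 ez mem_rcons mem_head in zb.
- rewrite e insert_row_bump // insert_row_last // => -[_ _ e4].
  by rewrite -e4 -ez mem_rcons mem_head in zb'.
rewrite e e' !insert_row_bump // => -[e1 /rcons_inj[e2 ey] /rcons_inj[e3 _]].
have fl (A : seq nat) (u v : nat) (B : seq nat) : {in A, forall t, t < u} -> u < v -> {in B, forall t, v < t} ->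
    [seq t <- A ++ u :: B | t < v] = rcons A u /\ [seq t <- A ++ u :: B | ~~ (t < v)] = B.
  move=> hA uv hB; rewrite !filter_cat /= uv /= -cats1.
  have a1 : all (fun t => t < v) A by apply/allP => t /hA/ltn_trans; apply.
  have a2 : all (fun t => ~~ (t < v)) B by apply/allP => t /hB tv; rewrite -leqNgt ltnW.
  rewrite (all_filterP a1) (all_filterP a2); split.
    congr (_ ++ _ :: _); apply/eqP; rewrite -(negbK (_ == _)) -has_filter; apply/hasPn => t tB.
    by rewrite (allP a2).
  rewrite -[RHS]cat0s; congr (_ ++ _).
  apply/eqP; rewrite -(negbK (_ == _)) -has_filter; apply/hasPn => t tA.
  by rewrite negbK (allP a1).
rewrite -ey in zy' hZ' e' *.
have [f1 f2] := fl X z.1 y Z hX zy hZ; have [f1' f2'] := fl X' z'.1 y Z' hX' zy' hZ'.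
have /rcons_inj[eX e1'] : rcons X z.1 = rcons X' z'.1 by rewrite -f1 -f1' e1.
have eZ : Z = Z' by rewrite -f2 -f2' e1.
by rewrite (eqz e1') ih // e e' eX eZ e2 e3.
Qed.

Definition exceeds (z : item) := z.2 <= z.1.

(** The order properties of a 321-avoiding permutation that row insertion uses:
    weak excedances are larger than everything before them, and the other
    entries are smaller than everything after them. *)
Definition item_order : rel item :=
  fun z1 z2 => (z1.2 < z2.2) && ((exceeds z2 || ~~ exceeds z1) ==> (z1.1 < z2.1)).

Lemma greedy_skip (Y E F : seq item) (f : item) : {in Y, forall e, e.1 < f.1} ->
  greedy (Y ++ E) (f :: F) = greedy E (f :: F).
Proof.
elim: Y => // e Y IH h; rewrite cat_cons greedy_cons h ?mem_head // IH // => y yY.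
by apply: h; rewrite inE yY orbT.
Qed.

(** The first row splits into entries [X] that are too small to be bumped by any
    future item and the pending weak excedances [pend], which are what
    [greedy] still has in stock. *)
Lemma rs_run (I pend : seq item) (X r2 b1 b2 : seq nat) :
  pairwise item_order I -> sorted ltn (map fst pend) ->
  uniq (X ++ map fst pend ++ map fst I) ->
  (forall x z, x \in X -> z \in I -> x < z.1) ->
  (forall p z, p \in pend -> z \in I -> p.2 < z.2) ->
  (forall p z, p \in pend -> z \in I -> exceeds z -> p.1 < z.1) ->
  (forall x z, x \in r2 -> z \in I -> exceeds z -> x < z.1) ->
  (forall x p, x \in r2 -> p \in pend -> x < p.1) ->
  (nilp (X ++ map fst pend) -> nilp r2) -> nilp b1 = nilp (X ++ map fst pend) -> nilp b2 = nilp r2 ->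
  let G := greedy (pend ++ filter exceeds I) (filter (predC exceeds) I) in
  exists r1' b1', foldl rs_step
       (two_rows (X ++ map fst pend) r2, two_rows b1 b2) I
     = (two_rows r1' (r2 ++ bumped G), two_rows b1' (b2 ++ bumpers G)) /\
   foldl insert_row (X ++ map fst pend, r2, b2) I = (r1', r2 ++ bumped G, b2 ++ bumpers G).
Proof.
elim: I pend X r2 b1 b2 => [|z I IH] pend X r2 b1 b2.
  by cbv zeta => *; rewrite [greedy _ _]greedy_nil !cats0; exists (X ++ map fst pend), b1.
rewrite pairwise_cons => /andP[/allP zI srt] sp un hX hpos hpE h2E h2p n12 n1 n2.
have tl (T : Type) (A : T -> Prop) (P : T -> item -> Prop) :
    (forall x y, A x -> y \in z :: I -> P x y) -> forall x y, A x -> y \in I -> P x y.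
  by move=> h x y Ax yI; apply: h => //; rewrite inE yI orbT.
have [Ez|Fz] := boolP (exceeds z).
  have h1 : {in X ++ map fst pend, forall y, y < z.1}.
    move=> y; rewrite mem_cat => /orP[yX|/mapP[p pp ->]]; first by apply: hX yX _; rewrite mem_head.
    by apply: hpE pp _ Ez; rewrite mem_head.
  have eG : pend ++ filter exceeds (z :: I) = rcons pend z ++ filter exceeds I.
    by rewrite /= Ez cat_rcons.
  have eF : filter (predC exceeds) (z :: I) = filter (predC exceeds) I by rewrite /= Ez.
  have er : rcons (X ++ map fst pend) z.1 = X ++ map fst (rcons pend z).
    by rewrite map_rcons rcons_cat.
  rewrite eG eF [z in z :: I]surjective_pairing !foldl_step rs_insert_last // insert_row_last // er.
  have np (T : Type) (s : seq T) (y : T) : nilp (rcons s y) = false by case: s.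
  apply: IH => //.
  - rewrite map_rcons (sorted_pairwise ltn_trans) -cats1 pairwise_cat /= andbT -(sorted_pairwise ltn_trans) sp andbT.
    by apply/allrelP => u v up; rewrite inE => /eqP->; apply: h1; rewrite mem_cat up orbT.
  - by move: un; rewrite map_rcons cat_rcons.
  - by move=> x y xX yI; apply: hX => //; rewrite inE yI orbT.
  - move=> p y; rewrite mem_rcons inE => /orP[/eqP->|pp] yI; first by case/andP: (zI y yI).
    by apply: hpos => //; rewrite inE yI orbT.
  - move=> p y; rewrite mem_rcons inE => /orP[/eqP->|pp] yI Ey.
      by have /andP[_] := zI y yI; rewrite Ey.
    by apply: hpE => //; rewrite inE yI orbT.
  - by move=> x y xr yI Ey; apply: h2E => //; rewrite inE yI orbT.
  - move=> x p xr; rewrite mem_rcons inE => /orP[/eqP->|pp]; last exact: h2p.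
    by apply: h2E => //; rewrite mem_head.
  - by rewrite -er np.
  - by rewrite -er !np.
have eF : filter (predC exceeds) (z :: I) = z :: filter (predC exceeds) I by rewrite /= Fz.
have eE : filter exceeds (z :: I) = filter exceeds I by rewrite /= (negbTE Fz).
have hXz : {in X, forall x, x < z.1} by move=> x xX; apply: hX => //; rewrite mem_head.
have future e : e \in filter exceeds I -> z.2 < e.2 /\ z.1 < e.1.
  rewrite mem_filter => /andP[Ee eI]; have /andP[? h] := zI e eI; split=> //.
  by rewrite Ee in h.
have zp : z.1 \notin map fst pend.
  apply: contraL un => zp; rewrite !cat_uniq; apply/negP => /and3P[_ _ /and3P[_ /hasPn]].
  by move=> /(_ z.1); rewrite /= mem_head zp => /(_ isT).
have [Y [Z [ep hY hZ]]] : exists Y Z, [/\ pend = Y ++ Z, {in Y, forall e, e.1 < z.1} &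
    forall e Z', Z = e :: Z' -> z.1 < e.1].
  elim: (pend) zp sp => [|p s IHs] /=; first by exists [::], [::].
  rewrite inE negb_or => /andP[ne zs] ss; case: (ltnP p.1 z.1) => [pz|zp'].
    have [Y [Z [-> hY hZ]]] := IHs zs (path_sorted ss); exists (p :: Y), Z; split=> //.
    by move=> e; rewrite inE => /orP[/eqP->|/hY].
  by exists [::], (p :: s); split=> // e Z' [<- _]; rewrite ltn_neqAle ne.
have hXY : {in X ++ map fst Y, forall x, x < z.1}.
  by move=> x; rewrite mem_cat => /orP[/hXz//|/mapP[e /hY ? ->]].
have fut y : y \in I -> z.1 < y.1.
  by move=> yI; have /andP[_] := zI y yI; rewrite Fz orbT.
have hX' x y : x \in rcons (X ++ map fst Y) z.1 -> y \in I -> x < y.1.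
  rewrite mem_rcons inE => /orP[/eqP->|/hXY xz] yI; first exact: fut.
  exact: ltn_trans (fut y yI).
have np (T : Type) (s : seq T) (y : T) : nilp (rcons s y) = false by case: s.
rewrite eE eF ep -catA greedy_skip //.
case: Z ep hZ => [|p Z] ep hZ.
  have -> : greedy ([::] ++ filter exceeds I) (z :: filter (predC exceeds) I)
          = greedy ([::] ++ filter exceeds I) (filter (predC exceeds) I).
    move: future; case: (filter exceeds I) => // e Es /(_ e (mem_head _ _))[ze1 ze2].
    by rewrite [LHS]greedy_cons ltnNge (ltnW ze2) /= ze1.
  have er : rcons (X ++ map fst Y) z.1 = rcons (X ++ map fst Y) z.1 ++ map fst ([::] : seq item) by rewrite cats0.
  rewrite cats0 in ep *; rewrite -ep in n12 n1 *; rewrite ep in hXY hX' er n12 n1 *.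
  rewrite [z in z :: I]surjective_pairing !foldl_step rs_insert_last // insert_row_last // er.
  apply: IH => //.
  - move: un; rewrite ep /= cat_rcons -!catA //.
  - by move=> x y xr yI Ey; apply: h2E => //; rewrite inE yI orbT.
  - by rewrite ?cats0 np.
  - by rewrite ?cats0 !np.
have zp1 := hZ p Z erefl.
have pp : p \in pend by rewrite ep mem_cat mem_head orbT.
have -> : greedy ((p :: Z) ++ filter exceeds I) (z :: filter (predC exceeds) I)
        = (p, z) :: greedy (Z ++ filter exceeds I) (filter (predC exceeds) I).
  rewrite [LHS]greedy_cons ltnNge (ltnW zp1) /= ltnNge (ltnW _) //.
  by apply: hpos => //; rewrite mem_head.
have er : X ++ map fst (Y ++ p :: Z) = (X ++ map fst Y) ++ p.1 :: map fst Z.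
  by rewrite map_cat catA.
have er' : (X ++ map fst Y) ++ z.1 :: map fst Z = rcons (X ++ map fst Y) z.1 ++ map fst Z.
  by rewrite cat_rcons.
have nb1 : nilp b1 = false by rewrite n1 ep er; case: (X ++ _).
have h2p1 : {in r2, forall x, x < p.1} by move=> x xr; exact: h2p.
have sZ : sorted ltn (p.1 :: map fst Z).
  by move: sp; rewrite ep map_cat => /cat_sorted2[].
have := IH Z (rcons (X ++ map fst Y) z.1) (rcons r2 p.1) b1 (rcons b2 z.2).
rewrite -er' er [z in z :: I]surjective_pairing !foldl_step rs_insert_bump // insert_row_bump //; cbv zeta; rewrite !cat_rcons.
apply=> //.
- exact: path_sorted sZ.
- move: un; rewrite ep map_cat -!catA /= => un.
  have : uniq (p.1 :: X ++ map fst Y ++ z.1 :: map fst Z ++ map fst I).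
    rewrite (perm_uniq (s2 := X ++ map fst Y ++ p.1 :: map fst Z ++ z.1 :: map fst I)) //.
    by clear; apply/seq.permP => q; rewrite /= !count_cat /= !count_cat /=; lia.
  by case/andP.
- move=> u y uZ yI; apply: hpos; last by rewrite inE yI orbT.
  by rewrite ep mem_cat inE uZ !orbT.
- move=> u y uZ yI; apply: hpE; last by rewrite inE yI orbT.
  by rewrite ep mem_cat inE uZ !orbT.
- move=> x y; rewrite mem_rcons inE => /orP[/eqP->|xr] yI Ey; last by apply: h2E => //; rewrite inE yI orbT.
  by apply: hpE => //; rewrite inE yI orbT.
- move=> x u; rewrite mem_rcons inE => /orP[/eqP->|xr] uZ; last by apply: h2p => //; rewrite ep mem_cat inE uZ !orbT.
  by apply: (allP (order_path_min ltn_trans sZ)); exact: map_f.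
- by case: (X ++ _).
- by case: (X ++ _) nb1.
- by rewrite !np.
Qed.

(** * The tableaux of a 321-avoiding permutation *)
Definition items n (s : 'S_n) : seq item := [seq ((s i).+1, (i : nat).+1) | i <- enum 'I_n].
Definition wex n (s : 'S_n) := filter exceeds (items s).
Definition dfc n (s : 'S_n) := filter (predC exceeds) (items s).

Lemma items_zip n (s : 'S_n) : zip [seq (s i).+1 | i <- enum 'I_n] (iota 1 n) = items s.
Proof.
rewrite /items -[1]addn0 iotaDl -val_enum_ord -map_comp.
by elim: (enum 'I_n) => //= i e ->.
Qed.

Lemma items_pos n (s : 'S_n) : map snd (items s) = iota 1 n.
Proof. by rewrite -items_zip -/(unzip2 _) unzip2_zip // size_map size_iota size_enum_ord. Qed.

Lemma items_val n (s : 'S_n) : perm_eq (map fst (items s)) (iota 1 n).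
Proof.
rewrite -items_zip -/(unzip1 _) unzip1_zip; last by rewrite size_iota size_map size_enum_ord.
have -> : [seq (s i).+1 | i <- enum 'I_n] = map (fun i : 'I_n => (i : nat).+1) (map s (enum 'I_n)).
  exact: (map_comp (fun i : 'I_n => (i : nat).+1) s).
have -> : iota 1 n = map (fun i : 'I_n => (i : nat).+1) (enum 'I_n).
  by rewrite -[1]addn0 iotaDl -val_enum_ord -(map_comp (addn 1) val).
apply: perm_map; apply: uniq_perm; [|exact: enum_uniq|].
  by rewrite (map_inj_uniq perm_inj) enum_uniq.
move=> i; rewrite mem_enum; apply/mapP; exists (s^-1%g i); first by rewrite mem_enum.
by rewrite permKV.
Qed.

Lemma card_ord_lt n m : m <= n -> #|[set x : 'I_n | x < m]| = m.
Proof.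
move=> le_mn; rewrite -[RHS](size_filter_lt le_mn) cardE; apply: perm_size.
apply: uniq_perm; [exact: enum_uniq|exact: (filter_uniq _ (enum_uniq _))|].
by move=> x; rewrite mem_enum inE mem_filter mem_enum andbT.
Qed.

Lemma card_perm_lt n (s : 'S_n) m : m <= n -> #|[set x : 'I_n | s x < m]| = m.
Proof.
move=> le_mn; have := card_preimset [set x : 'I_n | x < m] (@perm_inj _ s).
by rewrite card_ord_lt // => e; rewrite -[RHS]e; apply: eq_card => x; rewrite !inE.
Qed.

Lemma avoids321P n (s : 'S_n) : avoids321 s ->
  forall i j l : 'I_n, i < j -> j < l -> s j < s i -> s l < s j -> False.
Proof.
by move=> av i j l ij jl ji lj; have /forallP/(_ j)/forallP/(_ l) := forallP av i; rewrite ij jl ji lj.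
Qed.

(** If a larger value came before the weak excedance [j], then by counting some
    value below [s j] would come after it, forming the pattern 321. *)
Lemma wex_increasing n (s : 'S_n) (i j : 'I_n) : avoids321 s -> i < j -> j <= s j -> s i < s j.
Proof.
move=> av ij jsj; rewrite ltnNge leq_eqVlt; apply/negP => /orP[/eqP/val_inj/perm_inj e|ji].
  by rewrite e ltnn in ij.
suff [l jl lj] : exists2 l : 'I_n, j < l & s l < s j by exact: avoids321P av _ _ _ ij jl ji lj.
apply/exists_inP; apply: contraT; rewrite negb_exists_in => /forall_inP h.
have : #|[set x : 'I_n | s x < s j]| <= #|[set x : 'I_n | x < j] :\ i|.
  apply: subset_leq_card; apply/subsetP => x; rewrite !inE => xj.
  apply/andP; split; first by apply: contraTneq xj => ->; rewrite -leqNgt ltnW.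
  rewrite ltn_neqAle leqNgt; apply/andP; split; last by apply: contraL xj; exact: h.
  by apply: contraTneq xj => /val_inj->; rewrite ltnn.
rewrite card_perm_lt ?(ltnW (ltn_ord (s j))) //.
have := cardsD1 i [set x : 'I_n | x < j]; rewrite inE ij card_ord_lt ?(ltnW (ltn_ord j)) //.
by move: (#|_|) => c; lia.
Qed.

Lemma dfc_increasing n (s : 'S_n) (i j : 'I_n) : avoids321 s -> i < j -> s i < i -> s i < s j.
Proof.
move=> av ij sii; rewrite ltnNge leq_eqVlt; apply/negP => /orP[/eqP/val_inj/perm_inj e|ji].
  by rewrite e ltnn in ij.
suff [l li il] : exists2 l : 'I_n, l < i & s i < s l by exact: avoids321P av _ _ _ li ij il ji.
apply/exists_inP; apply: contraT; rewrite negb_exists_in => /forall_inP h.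
have : #|[set x : 'I_n | x < i]| <= #|[set x : 'I_n | s x < s i]|.
  apply: subset_leq_card; apply/subsetP => x; rewrite !inE => xi.
  rewrite ltn_neqAle leqNgt; apply/andP; split; last exact: h.
  by apply: contraTneq xi => /val_inj/perm_inj->; rewrite ltnn.
rewrite card_perm_lt ?(ltnW (ltn_ord (s i))) //.
by rewrite card_ord_lt ?(ltnW (ltn_ord i)) // leqNgt sii.
Qed.

Lemma items_order n (s : 'S_n) : avoids321 s -> pairwise item_order (items s).
Proof.
move=> av; rewrite pairwise_map.
have : pairwise (fun i j : 'I_n => i < j) (enum 'I_n).
  rewrite -sorted_pairwise; first exact: sorted_enum_ord.
  by move=> i j l; exact: ltn_trans.
apply: sub_pairwise => i j ij; rewrite /item_order /exceeds /= !ltnS ij /=; apply/implyP.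
by case/orP => [|]; [exact: wex_increasing|rewrite -ltnNge; exact: dfc_increasing].
Qed.

Definition greedy_word n (V A : seq nat) :=
  [seq v \notin V | v <- iota 1 n] ++ [seq a \in A | a <- rev (iota 1 n)].

Definition perm_rows n (s : 'S_n) := rows (items s).

Lemma rsk_word_greedy n (s : 'S_n) : avoids321 s ->
  let G := greedy (wex s) (dfc s) in
  rsk_word s = greedy_word n (bumped G) (bumpers G) /\
  exists r1, perm_rows s = (r1, bumped G, bumpers G).
Proof.
move=> av G; have [||||||||||r1 [b1 [eRS eR]]] := @rs_run (items s) [::] [::] [::] [::] [::] (items_order av) => //.
  by rewrite (perm_uniq (items_val s)) iota_uniq.
rewrite cat0s -/(wex s) -/(dfc s) -/G !cat0s in eRS eR; split; last by exists r1.
rewrite /rsk_word /RS.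
have -> : iota 1 (size [seq (s i).+1 | i <- enum 'I_n]) = iota 1 n by rewrite size_map size_enum_ord.
rewrite items_zip -/rs_step.
have -> : foldl (fun AB xi => rs_insert xi.1 xi.2 AB.1 AB.2) ([::], [::]) (items s) =
  (two_rows r1 (bumped G), two_rows b1 (bumpers G)) := eRS.
have -> : nth [::] (two_rows r1 (bumped G)) 0 = r1.
  by rewrite /two_rows; case: (nilp (bumped G)) => //; case: (@nilP _ r1) => // ->.
have -> : nth [::] (two_rows b1 (bumpers G)) 1 = bumpers G.
  by rewrite /two_rows; case: (@nilP _ (bumpers G)) => // ->; case: nilp.
have := rows_spec (I := items s); rewrite /rows eR (perm_uniq (items_val s)) iota_uniq.
move=> /(_ isT)[_ pr _]; have pri := perm_trans pr (items_val s).
have un : uniq (r1 ++ bumped G) by rewrite (perm_uniq pri) iota_uniq.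
congr (_ ++ _); apply/eq_in_map => i; rewrite -(perm_mem pri) mem_cat.
move: un; rewrite cat_uniq => /and3P[_ /hasPn dis _].
by have [ir|ir] := boolP (i \in r1); have [ib|ib] := boolP (i \in bumped G) => //; have := dis i ib; rewrite /= ir.
Qed.

Lemma greedy_sub E F : subseq (map fst (greedy E F)) E /\ subseq (map snd (greedy E F)) F.
Proof.
elim: E F => [|e E IHE] F; first by split; rewrite /= ?sub0seq.
elim: F => [|f F IHF]; first by split; rewrite /= ?sub0seq.
rewrite greedy_cons; case: ifP => _.
  by have [h1 h2] := IHE (f :: F); split=> //; exact: (subseq_trans h1 (subseq_cons E e)).
case: ifP => _; first by have [h1 h2] := IHF; split=> //; exact: (subseq_trans h2 (subseq_cons F f)).
by have [h1 h2] := IHE F; rewrite /= !eqxx.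
Qed.

(** A bumping entry is smaller than the bumped one and comes later.  This pairs the
    second rows with entries that are not in them, which is why [greedy_word] is
    a Dyck path. *)
Lemma greedy_inversions E F : {in greedy E F, forall g, g.2.1 <= g.1.1 /\ g.1.2 <= g.2.2}.
Proof.
elim: E F => [|e E IHE] F //; elim: F => [|f F IHF] // g.
rewrite greedy_cons; case: ltnP => fe; first exact: IHE.
case: ltnP => ef; first exact: IHF.
by rewrite inE => /orP[/eqP->|/IHE].
Qed.

Lemma count_ltn_iota m n x : count (fun v => v < x) (iota m n) <= x - m.
Proof.
elim: n m => //= n IH m; have := IH m.+1; case: ltnP => /=; lia.
Qed.

Lemma leq_count_map (T : eqType) (p q : T -> nat) x (s : seq T) : {in s, forall g, q g <= p g} ->
  count (fun v => v < x) (map p s) <= count (fun v => v < x) (map q s).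
Proof.
elim: s => //= g s IH h; apply: leq_add; last by apply: IH => u us; apply: h; rewrite inE us orbT.
have := h g (mem_head _ _); case: ltnP => // lt_p; case: ltnP => //; lia.
Qed.

Section HalfCount.
Variables (E F : seq item) (n : nat).
Let G := greedy E F.
Let GE : subseq (map fst G) E := proj1 (greedy_sub E F).
Let GF : subseq (map snd G) F := proj2 (greedy_sub E F).

Lemma bumped_sub : subseq (bumped G) (map fst E).
Proof. by rewrite /bumped (map_comp fst fst); exact: map_subseq. Qed.

Lemma bumpers_sub : subseq (bumpers G) (map snd F).
Proof. by rewrite /bumpers (map_comp snd snd); exact: map_subseq. Qed.

Lemma bumped_half x : perm_eq (map fst (E ++ F)) (iota 1 n) ->
  2 * count (fun v => v < x) (bumped G) <= x.-1.
Proof.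
move=> pr; apply: leq_trans (_ : _ <= count (fun v => v < x) (map fst (E ++ F))) _; last first.
  by rewrite (seq.permP pr) -subn1 count_ltn_iota.
rewrite mul2n -addnn map_cat count_cat leq_add //; first exact: leq_count_subseq bumped_sub.
apply: leq_trans (leq_count_subseq _ (map_subseq fst GF)).
by rewrite -map_comp; apply: leq_count_map => g /greedy_inversions[].
Qed.

Lemma bumpers_half x : perm_eq (map snd (E ++ F)) (iota 1 n) ->
  2 * count (fun v => v < x) (bumpers G) <= x.-1.
Proof.
move=> pr; apply: leq_trans (_ : _ <= count (fun v => v < x) (map snd (E ++ F))) _; last first.
  by rewrite (seq.permP pr) -subn1 count_ltn_iota.
rewrite mul2n -addnn map_cat count_cat leq_add //; last exact: leq_count_subseq bumpers_sub.
apply: leq_trans (leq_count_subseq _ (map_subseq snd GE)).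
by rewrite -map_comp; apply: leq_count_map => g /greedy_inversions[].
Qed.

End HalfCount.

Lemma count_mem_iota (A : seq nat) m j : uniq A -> {in A, forall a, m <= a} ->
  count (mem A) (iota m j) = count (fun v => v < m + j) A.
Proof.
move=> uA hA; rewrite -!size_filter; apply: perm_size; apply: uniq_perm.
- by rewrite filter_uniq ?iota_uniq.
- by rewrite filter_uniq.
by move=> x; rewrite !mem_filter mem_iota /=; case xA : (x \in A); rewrite ?andbF //= hA // andbT.
Qed.

Lemma greedy_word_kdyck n (V A : seq nat) : uniq V -> uniq A ->
  {in V, forall v, 0 < v <= n} -> {in A, forall a, 0 < a <= n} -> size V = size A ->
  (forall x, 2 * count (fun v => v < x) V <= x.-1) ->
  (forall x, 2 * count (fun v => v < x) A <= x.-1) ->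
  is_kdyck 1 n (greedy_word n V A).
Proof.
move=> uV uA hV hA sVA cV cA; rewrite /greedy_word.
have cF (B : seq nat) i : uniq B -> {in B, forall b, 0 < b <= n} ->
    count (fun v => v \in B) (iota 1 i) = count (fun v => v < i.+1) B.
  by move=> uB hB; rewrite -[i.+1]add1n -count_mem_iota // => b /hB/andP[].
have cC (B : seq nat) i : count (fun v => v \notin B) (iota 1 i) = i - count (fun v => v \in B) (iota 1 i).
  have := count_predC (fun v => v \in B) (iota 1 i); rewrite size_iota /= => e.
  by rewrite -[i in i - _]e addKn.
have all_lt (B : seq nat) : {in B, forall b, 0 < b <= n} -> count (fun v => v < n.+1) B = size B.
  by move=> hB; apply/eqP; rewrite -all_count; apply/allP => b /hB/andP[_]; rewrite ltnS.
have cT (B : seq nat) (r : seq nat) : count_mem true [seq v \in B | v <- r] = count (fun v => v \in B) r.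
  by rewrite count_map; apply: eq_count => v /=; case: (v \in B).
have cT' (B : seq nat) (r : seq nat) : count_mem false [seq v \in B | v <- r] = count (fun v => v \notin B) r.
  by rewrite count_map; apply: eq_count => v /=; case: (v \in B).
have cN (B : seq nat) (r : seq nat) : count_mem true [seq v \notin B | v <- r] = count (fun v => v \notin B) r.
  by rewrite count_map; apply: eq_count => v /=; case: (v \in B).
have cN' (B : seq nat) (r : seq nat) : count_mem false [seq v \notin B | v <- r] = count (fun v => v \in B) r.
  by rewrite count_map; apply: eq_count => v /=; case: (v \in B).
have sV : 2 * size V <= n.
  by have := cV n.+1; rewrite all_lt //= ; lia.
set w1 := [seq v \notin V | v <- iota 1 n]; set w2 := [seq a \in A | a <- rev (iota 1 n)].
have t1 : count_mem true w1 = n - size V by rewrite cN cC cF // all_lt.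
have f1 : count_mem false w1 = size V by rewrite cN' cF // all_lt.
have t2 : count_mem true w2 = size A by rewrite cT count_rev cF // all_lt.
have f2 : count_mem false w2 = n - size A by rewrite cT' count_rev cC cF // all_lt.
apply/is_kdyckP; rewrite !count_cat t1 f1 t2 f2; split; [by lia|by lia|].
move=> i; rewrite mul1n take_cat size_map size_iota; case: ltnP => [lt_in|le_ni].
  rewrite -map_take take_iota (minn_idPl (ltnW lt_in)) cN cN' cC cF //.
  by have := cV i.+1; rewrite /=; lia.
set j := i - n; have e b : count_mem b (take j w2) = count_mem b w2 - count_mem b (drop j w2).
  by rewrite -{2}(cat_take_drop j w2) count_cat addnK.
rewrite !count_cat !e t1 f1 t2 f2 /w2 -map_drop drop_rev size_iota take_iota.
rewrite (minn_idPl (leq_subr _ _)) cT cT' !count_rev cC cF //.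
have := cA (n - j).+1; have := count_size (fun v => v < (n - j).+1) A.
have := leq_subr j n; rewrite -sVA /=; set c := count _ A; lia.
Qed.

(** * Matchings of the inverse permutation *)
Definition flip (z : item) : item := (z.2, z.1).

(** The matching is symmetric under the exchange of values and positions, except
    for the order in which the two tests are made; the hypothesis rules out
    that both succeed. *)
Lemma greedy_transpose E F : {in E & F, forall e f, ~~ ((e.1 < f.1) && (f.2 < e.2))} ->
  greedy (map flip F) (map flip E) = map (fun g => (flip g.2, flip g.1)) (greedy E F).
Proof.
elim: E F => [|e E IHE] F h; first by rewrite greedy_nil.
elim: F h => [|f F IHF] h; first by [].
have ef := h e f (mem_head _ _) (mem_head _ _).
rewrite [map flip _]/= [map flip (e :: E)]/= !greedy_cons [(flip _).1]/= [(flip e).2]/=.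
have hE : {in E & f :: F, forall e f, ~~ ((e.1 < f.1) && (f.2 < e.2))}.
  by move=> x y xE; apply: h; rewrite inE xE orbT.
have hF : {in e :: E & F, forall e f, ~~ ((e.1 < f.1) && (f.2 < e.2))}.
  by move=> x y xE yF; apply: h; rewrite // inE yF orbT.
have hEF : {in E & F, forall e f, ~~ ((e.1 < f.1) && (f.2 < e.2))}.
  by move=> x y xE yF; apply: h; rewrite inE ?xE ?yF orbT.
case: (ltnP f.2 e.2) ef => [fe|ef]; rewrite /= ?andbT ?andbF.
  by move/negbTE=> -> ; exact: IHF.
by move=> _; case: ltnP => fe; [exact: (IHE (f :: F))|rewrite /= IHE].
Qed.

Lemma greedy_map (h : item -> item) E F :
  {in E & F, forall e f, ((h e).1 < (h f).1) = (e.1 < f.1)} ->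
  {in E & F, forall e f, ((h f).2 < (h e).2) = (f.2 < e.2)} ->
  greedy (map h E) (map h F) = map (fun g => (h g.1, h g.2)) (greedy E F).
Proof.
elim: E F => [|e E IHE] F // h1 h2; elim: F h1 h2 => [|f F IHF] // h1 h2.
rewrite [map h (e :: _)]/= [map h (f :: _)]/= !greedy_cons h1 ?mem_head // h2 ?mem_head //.
have sub (p : item -> item -> Prop) : {in e :: E & f :: F, forall e f, p e f} ->
   [/\ {in E & f :: F, forall e f, p e f}, {in e :: E & F, forall e f, p e f} & {in E & F, forall e f, p e f}].
  by move=> H; split=> x y xE yF; apply: H; rewrite // inE ?xE ?yF ?orbT.
have [a1 a2 a3] := sub (fun e f => _ = _) h1; have [b1 b2 b3] := sub (fun e f => _ = _) h2.
case: ifP => _; first exact: (IHE (f :: F)).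
by case: ifP => _; [exact: IHF|rewrite /= IHE].
Qed.

Lemma greedy_rcons_both N E F : {in E, forall e, e.1 < N /\ e.2 < N} -> {in F, forall e, e.1 < N /\ e.2 < N} ->
  greedy (rcons E (N, N)) (rcons F (N, N)) = rcons (greedy E F) ((N, N), (N, N)).
Proof.
elim: E F => [|e E IHE] F hE hF.
  elim: F hF => [|f F IHF] hF; first by rewrite /= ltnn.
  have [f1 f2] := hF f (mem_head _ _).
  rewrite [rcons [::] _]/= [rcons (f :: F) _]/= greedy_cons ltnNge (ltnW f1) /= f2.
  by rewrite -[RHS](IHF _) // => x xF; apply: hF; rewrite inE xF orbT.
have [e1 e2] := hE e (mem_head _ _).
have hE' : {in E, forall e, e.1 < N /\ e.2 < N} by move=> x xE; apply: hE; rewrite inE xE orbT.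
elim: F hF => [|f F IHF] hF.
  rewrite [rcons (e :: E) _]/= [rcons [::] _]/= greedy_cons e1.
  by have := IHE [::] hE'; rewrite [rcons [::] _]/= greedy_nil => ->.
have hF' : {in F, forall e, e.1 < N /\ e.2 < N} by move=> x xF; apply: hF; rewrite inE xF orbT.
rewrite [rcons (e :: E) _]/= [rcons (f :: F) _]/= !greedy_cons.
case: ifP => _; first exact: (IHE (f :: F)).
by case: ifP => _; [exact: IHF|rewrite /= IHE].
Qed.

Lemma greedy_rcons_last N j m E F : {in E, forall e, e.1 < N /\ e.2 <= m} -> j <= m ->
  {in F, forall f, f.1 <= N} ->
  let E' := rcons E (N, j) in
  greedy E' (rcons F (N, m)) =
  greedy E' F ++ (if N \in bumped (greedy E' F) then [::] else [:: ((N, j), (N, m))]).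
Proof.
move=> hE jm; elim: E F hE => [|e E IHE] F hE hF E'; rewrite {}/E'.
  elim: F hF => [|f F IHF] hF; first by rewrite /= ltnn ltnNge jm.
  have f1 := hF f (mem_head _ _).
  rewrite [rcons [::] _]/= [rcons (f :: F) _]/= !greedy_cons ltnNge f1 /=.
  case: ifP => _; last by rewrite /bumped /= inE eqxx.
  by apply: IHF => x xF; apply: hF; rewrite inE xF orbT.
have [e1 e2] := hE e (mem_head _ _).
have hE' : {in E, forall e, e.1 < N /\ e.2 <= m} by move=> x xE; apply: hE; rewrite inE xE orbT.
elim: F hF => [|f F IHF] hF.
  rewrite [rcons (e :: E) _]/= [rcons [::] _]/= greedy_cons e1.
  by have := IHE [::] hE' hF; rewrite /= !greedy_nil.
have hF' : {in F, forall f, f.1 <= N} by move=> x xF; apply: hF; rewrite inE xF orbT.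
rewrite [rcons (e :: E) _]/= [rcons (f :: F) _]/= !greedy_cons.
case: ifP => _; first exact: (IHE (f :: F)).
case: ifP => _; first exact: IHF.
rewrite [LHS](congr1 (cons _) (IHE F hE' hF')) /bumped /= inE.
by rewrite (gtn_eqF e1).
Qed.

Lemma shift_up_rcons j L e : shift_up j (rcons L e) = rcons (shift_up j L) (e.1, last j (map snd L)).
Proof. by elim: L j => //= x L IH j; rewrite IH. Qed.

Lemma sorted_adjacent (T : eqType) (r R : rel T) (L : seq T) : transitive r -> irreflexive r ->
  sorted r L ->
  (forall f f', f \in L -> f' \in L -> r f f' -> {in L, forall g, r g f' -> (g == f) || r g f} -> R f f') ->
  sorted R L.
Proof.
move=> tr ir; elim: L => // f [|f' L] IH // srt h.
have srt' : sorted r (f' :: L) by case/andP: srt.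
have /allP fmin : all (r f) (f' :: L) by apply: order_path_min.
apply/andP; split.
  apply: h; [exact: mem_head|by rewrite inE mem_head orbT|by case/andP: srt|].
  move=> g; rewrite inE => /orP[->//|]; rewrite inE => /orP[/eqP->|gL]; first by rewrite ir.
  have /allP/(_ g gL) f'g := order_path_min tr srt'.
  by move=> gf'; have := tr _ _ _ f'g gf'; rewrite ir.
apply: IH => // g g' gL g'L gg' adj; apply: h => //; [by rewrite in_cons gL orbT|by rewrite in_cons g'L orbT|].
by move=> u; rewrite in_cons => /orP[/eqP->|uL] ug'; [rewrite (fmin g gL) orbT|exact: adj].
Qed.

Section Lists.
Variables (n : nat) (s : 'S_n).
Hypotheses (n0 : 0 < n) (av : avoids321 s).

Lemma mem_items z : z \in items s -> exists i : 'I_n, z = ((s i).+1, i.+1).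
Proof. by case/mapP=> i _ ->; exists i. Qed.

Lemma item_bounds z : z \in items s -> [/\ 0 < z.1, z.1 <= n, 0 < z.2 & z.2 <= n].
Proof. by case/mem_items=> i ->; rewrite /= !ltn_ord. Qed.

Lemma wexP z : z \in wex s -> z \in items s /\ z.2 <= z.1.
Proof. by rewrite mem_filter => /andP[]. Qed.

Lemma dfcP z : z \in dfc s -> z \in items s /\ z.1 < z.2.
Proof. by rewrite mem_filter /= /exceeds -ltnNge => /andP[]. Qed.

Lemma pairwise_sub (r r' : rel item) (p : pred item) : subpred p p ->
  (forall x y, p x -> p y -> r x y -> r' x y) -> pairwise r (items s) -> sorted r' (filter p (items s)).
Proof.
move=> _ h pr; apply: pairwise_sorted.
apply: (@sub_in_pairwise _ p r) (pairwise_filter p pr); last exact: filter_all.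
by move=> x y; exact: h.
Qed.

Lemma wex_sorted : sorted (incr fst) (wex s) /\ sorted (incr snd) (wex s).
Proof.
split; apply: (@pairwise_sub item_order) (items_order av) => // x y px py /andP[h1 h2] //.
by move: h2; rewrite py.
Qed.

Lemma dfc_sorted : sorted (incr fst) (dfc s) /\ sorted (incr snd) (dfc s).
Proof.
split; apply: (@pairwise_sub item_order) (items_order av) => // x y px py /andP[h1 h2] //.
by move: h2; rewrite /= in px; rewrite px orbT.
Qed.

Lemma perm_wex_dfc : perm_eq (wex s ++ dfc s) (items s).
Proof. exact: permEl (perm_filterC _ _). Qed.

Lemma wex_dfc_val : perm_eq (map fst (wex s ++ dfc s)) (iota 1 n).
Proof. exact: perm_trans (perm_map _ perm_wex_dfc) (items_val s). Qed.

Lemma wex_dfc_pos : perm_eq (map snd (wex s ++ dfc s)) (iota 1 n).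
Proof. by rewrite -(items_pos s); exact: perm_map perm_wex_dfc. Qed.

Lemma dfc_bounds z : z \in dfc s -> [/\ 0 < z.1, z.1 < n, 1 < z.2 & z.2 <= n].
Proof. by case/dfcP=> /item_bounds[h1 h2 h3 h4] lt; split=> //; [exact: leq_trans h4|exact: leq_ltn_trans lt]. Qed.

Lemma wex_bounds z : z \in wex s -> [/\ 0 < z.1, z.1 <= n, 0 < z.2 & z.2 <= n].
Proof. by case/wexP=> /item_bounds. Qed.

Lemma wex_val_n : n \in map fst (wex s).
Proof.
have : n \in map fst (wex s ++ dfc s).
  by rewrite (perm_mem wex_dfc_val) mem_iota n0 add1n ltnS leqnn.
rewrite map_cat mem_cat => /orP[//|/mapP[z /dfc_bounds[_ + _ _] e]].
by rewrite -e ltnn.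
Qed.

Lemma wex_pos_1 : 1 \in map snd (wex s).
Proof.
have : 1 \in map snd (wex s ++ dfc s).
  by rewrite (perm_mem wex_dfc_pos) mem_iota leqnn add1n ltnS n0.
rewrite map_cat mem_cat => /orP[//|/mapP[z /dfc_bounds[_ _ + _] e]].
by rewrite -e ltnn.
Qed.

(** There are more positions before [e] than values below that of [e], so some
    entry before [e] is larger; it is a weak excedance since the other entries
    increase. *)
Lemma dfc_blocked e : e \in dfc s -> exists2 w, w \in wex s & w.2 < e.2 /\ e.1 < w.1.
Proof.
case/dfcP=> /mem_items[c ->] /=; rewrite ltnS => sc.
suff [i ic ci] : exists2 i : 'I_n, i < c & s c < s i.
  exists ((s i).+1, i.+1); last by rewrite /= !ltnS.
  rewrite mem_filter; apply/andP; split; last by apply: map_f; rewrite mem_enum.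
  rewrite /exceeds /= ltnS leqNgt; apply/negP => si.
  by have := dfc_increasing av ic si; rewrite ltnNge (ltnW ci).
apply/exists_inP; apply: contraT; rewrite negb_exists_in => /forall_inP h.
have : #|[set x : 'I_n | x < c]| <= #|[set x : 'I_n | s x < s c]|.
  apply: subset_leq_card; apply/subsetP => x; rewrite !inE => xi.
  rewrite ltn_neqAle leqNgt; apply/andP; split; last exact: h.
  by apply: contraTneq xi => /val_inj/perm_inj->; rewrite ltnn.
by rewrite card_perm_lt ?card_ord_lt ?(ltnW (ltn_ord _)) // leqNgt sc.
Qed.

Let N := n.+1.
(** The items of the inverse permutation, in which the two kinds of entries change
    roles, followed by the sentinel [(N, N)]. *)
Definition old_values := rcons (map flip (dfc s)) (N, N).
Definition old_positions := rcons (map flip (wex s)) (N, N).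

Lemma old_sorted (p : item -> nat) L : sorted (incr p) L -> {in L, forall z, p z <= n} -> p (N, N) = N ->
  sorted (incr p) (rcons L (N, N)).
Proof.
case: L => // x L /= srt h pN; rewrite rcons_path srt /= /incr pN.
by rewrite ltnS; apply: h; exact: mem_last.
Qed.

Lemma mem_flip z L : (z \in map flip L) = (flip z \in L).
Proof.
apply/mapP/idP => [[x xL ->]|zL]; first by case: x xL.
by exists (flip z) => //; case: z zL.
Qed.

Lemma sorted_flip L : (sorted (incr fst) (map flip L) = sorted (incr snd) L) *
  (sorted (incr snd) (map flip L) = sorted (incr fst) L).
Proof. by rewrite !sorted_map. Qed.

Lemma old_values_sorted : sorted (incr fst) old_values /\ sorted (incr snd) old_values.
Proof.
have [h1 h2] := dfc_sorted; split; apply: old_sorted; rewrite ?sorted_flip //.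
  by move=> z; rewrite mem_flip => /dfc_bounds[].
by move=> z; rewrite mem_flip => /dfc_bounds[_ /ltnW].
Qed.

Lemma old_positions_sorted : sorted (incr fst) old_positions /\ sorted (incr snd) old_positions.
Proof.
have [h1 h2] := wex_sorted; split; apply: old_sorted; rewrite ?sorted_flip //.
  by move=> z; rewrite mem_flip => /wex_bounds[].
by move=> z; rewrite mem_flip => /wex_bounds[].
Qed.

Lemma incr_trans p : transitive (incr p). Proof. by move=> x y z; exact: ltn_trans. Qed.
Lemma incr_irr p : irreflexive (incr p). Proof. by move=> x; exact: ltnn. Qed.

(** The larger weak excedance before [e] given by [dfc_blocked] comes before [f'],
    hence no later than [f], and the values of weak excedances increase. *)
Lemma old_locked : sorted (locked old_values) old_positions.
Proof.
apply: (sorted_adjacent (@incr_trans fst) (@incr_irr fst) (proj1 old_positions_sorted)).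
move=> f f' fL f'L ff' adj; apply/allP => e; rewrite mem_rcons inE => /orP[/eqP->|].
  apply/implyP => /= lt_N; have : f'.1 <= N.
    move: f'L; rewrite mem_rcons inE => /orP[/eqP->//|]; rewrite mem_flip => /wex_bounds[_ _ _ /leqW//].
  by rewrite leqNgt lt_N.
rewrite mem_flip => /dfc_blocked[w ww [we ew]]; apply/implyP => lt_ef.
have gL : flip w \in old_positions by rewrite mem_rcons inE mem_flip /=; case: w ww {we ew} => ? ? ->; rewrite orbT.
have wf' : incr fst (flip w) f' by exact: ltn_trans we lt_ef.
apply: leq_trans ew _; case/orP: (adj _ gL wf') => [/eqP<-//|wf].
have [_ so] := old_positions_sorted; have [so1 _] := old_positions_sorted.
have : {in old_positions &, forall x y, x.1 < y.1 -> x.2 < y.2}.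
  move=> x y xL yL xy; rewrite ltnNge; apply/negP => yx.
  have ix : index x old_positions < size old_positions by rewrite index_mem.
  have iy : index y old_positions < size old_positions by rewrite index_mem.
  have m1 := sorted_ltn_nth (@incr_trans fst) x so1; have m2 := sorted_ltn_nth (@incr_trans snd) x so.
  case: (ltngtP (index x old_positions) (index y old_positions)) => [lt|lt|eq_i].
  - by have := m2 _ _ ix iy lt; rewrite !nth_index // /incr ltnNge yx.
  - by have := m1 _ _ iy ix lt; rewrite !nth_index // /incr ltnNge (ltnW xy).
  - by move: xy; rewrite -(nth_index x xL) eq_i nth_index // ltnn.
by move=> h; apply: ltnW; exact: (h (flip w) f gL fL wf).
Qed.

End Lists.

(** * The permutation attached to the image under Dyck2 *)
Lemma p_pointsE n (s : 'S_n) : p_points s = [seq (z.2.-1, z.1) | z <- wex s].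
Proof. by rewrite /wex /items filter_map -map_comp. Qed.

Lemma q_pointsE n (s : 'S_n) : q_points s = [seq (z.1, z.2.-1) | z <- dfc s].
Proof.
rewrite /dfc /items filter_map -map_comp /q_points; congr map; apply: eq_filter => i /=.
by rewrite /exceeds /= ltnS -ltnNge.
Qed.

Lemma valley_seq_sorted n x y vl : valley_seq n x y vl ->
  path ltn x (unzip1 vl) /\ path ltn y (unzip2 vl).
Proof.
elim: vl x y => //= v vl IH x y /and4P[xv yv _ /IH[h1 h2]].
by rewrite xv yv.
Qed.

(** A horizontal line of height [h] carries the valley of the position [h + 1] and
    the peak of the value [h]; a vertical line of abscissa [a] carries the valley
    of the value [a] and the peak of the position [a + 1].  Hence this translation
    of items at peaks into items, inverted, at valleys. *)
Definition raise (z : item) : item := (z.1.+1, z.2.-1).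

Lemma shift_up_flip N j L : shift_up j (rcons (map flip L) (N, N)) = zip (rcons (map snd L) N) (j :: map fst L).
Proof. by elim: L j => //= e L IH j; rewrite IH. Qed.

Section Next.
Variables (n : nat) (s s2 : 'S_n) (D2 : kdyck n 1).
Hypotheses (n0 : 0 < n) (av : avoids321 s) (av2 : avoids321 s2).
Hypotheses (vD : perm_eq (valleys D2) (q_points s)) (pD : perm_eq (peaks D2) (p_points s2)).
Let N := n.+1.

(** Each peak of a path has the height of the next valley and the abscissa of the
    previous one.  The valleys are the non-excedances of [s] and the peaks the
    weak excedances of [s2], so one list is the other one with its positions
    moved by one place. *)
Lemma wex_next : map raise (wex s2) = shift_up 0 (old_values s).
Proof.
have [vl vv eD] := kdyck_valley_word n0 (kdyckP D2).
have [p1 p2] := valley_seq_sorted vv.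
have vD' := vD; rewrite eD valleys_valley_word // q_pointsE in vD'.
have pD' := pD; rewrite eD peaks_valley_word // p_pointsE in pD'.
have evl : vl = [seq (z.1, z.2.-1) | z <- dfc s].
  apply: (irr_sorted_eq (@incr_trans snd) (@incr_irr snd)); last exact: perm_mem.
    by have := path_sorted p2; rewrite sorted_map.
  rewrite sorted_map; have [_] := dfc_sorted av.
  apply: (@sub_in_sorted _ [pred z : item | 0 < z.2]); last first.
    by apply/allP => z /dfc_bounds[_ _ /ltnW].
  by move=> x y; rewrite !inE /relpre /incr /=; lia.
have ewex : [seq (z.2.-1, z.1) | z <- wex s2] = zip (0 :: unzip1 vl) (rcons (unzip2 vl) n).
  apply: (irr_sorted_eq (@incr_trans fst) (@incr_irr fst)).
  - rewrite sorted_map; have [_] := wex_sorted av2.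
    apply: (@sub_in_sorted _ [pred z : item | 0 < z.2]); last first.
      by apply/allP => z /wex_bounds[].
    by move=> x y; rewrite !inE /relpre /incr /=; lia.
  - have : sorted ltn (unzip1 (zip (0 :: unzip1 vl) (rcons (unzip2 vl) n))).
      by rewrite unzip1_zip; [exact: p1|rewrite size_rcons /= !size_map].
    by rewrite sorted_map.
  - by apply: perm_mem; rewrite perm_sym.
rewrite /old_values shift_up_flip.
have -> : map raise (wex s2) = [seq (u.2.+1, u.1) | u <- [seq (z.2.-1, z.1) | z <- wex s2]].
  by rewrite -map_comp.
rewrite ewex evl.
have eqz (A B : seq nat) : [seq (u.2.+1, u.1) | u <- zip A B] = zip (map S B) A.
  by elim: A B => [|a A IH] [|b B] //=; rewrite IH.
rewrite eqz map_rcons; congr (zip _ _); last by congr cons; rewrite /unzip1 -map_comp; apply: eq_map.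
congr rcons; rewrite /unzip2 -!map_comp; apply/eq_in_map => z /dfc_bounds[_ _ z2 _] /=.
by rewrite prednK // ltnW.
Qed.

Lemma wex2_values : map S (map fst (wex s2)) = rcons (map snd (dfc s)) N.
Proof.
have e := congr1 unzip1 wex_next; rewrite /old_values shift_up_flip unzip1_zip in e.
  by rewrite -e /unzip1 -!map_comp.
by rewrite size_rcons /= !size_map.
Qed.

Lemma wex2_positions : map predn (map snd (wex s2)) = 0 :: map fst (dfc s).
Proof.
have e := congr1 unzip2 wex_next; rewrite /old_values shift_up_flip unzip2_zip in e.
  by rewrite -e /unzip2 -!map_comp.
by rewrite size_rcons /= !size_map.
Qed.

Lemma sorted_map_succn L : sorted ltn (map S L) = sorted ltn L.
Proof. by rewrite sorted_map; apply: eq_sorted => x y /=; rewrite ltnS. Qed.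

Lemma ltn_irr : irreflexive ltn. Proof. by move=> x; exact: ltnn. Qed.

Lemma wex_cons : exists w W, wex s = w :: W /\ w.2 = 1.
Proof.
have := wex_pos_1 s n0; have [_] := wex_sorted av; have := @wex_bounds n s.
case: (wex s) => // w W h srt; rewrite inE => /orP[/eqP e|/mapP[z zW e]]; exists w, W; split=> //.
have := order_path_min (@incr_trans snd) srt => /allP/(_ z zW); rewrite /incr -e.
by have [_ _ w0 _] := h w (mem_head _ _); rewrite ltnNge w0.
Qed.

Lemma wex_val_rcons : exists Y, map fst (wex s) = rcons Y n.
Proof.
have := wex_val_n s n0; have [+ _] := wex_sorted av; have := @wex_bounds n s.
case/lastP: (wex s) => // W w h srt; rewrite map_rcons mem_rcons inE => /orP[/eqP->|/mapP[z zW e]].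
  by exists (map fst W).
have [|_ wn _ _] := h w; first by rewrite mem_rcons mem_head.
move: srt; rewrite -cats1 (sorted_pairwise (@incr_trans fst)) pairwise_cat => /and3P[/allrelP/(_ z w zW) + _ _].
by rewrite inE eqxx => /(_ isT); rewrite /incr -e ltnNge wn.
Qed.

(** The values and positions left over by [wex_next] are those of the weak
    excedances of [s], and both lists are increasing. *)
Lemma dfc_next w W : wex s = w :: W -> rcons (map raise (dfc s2)) (N, n) =
  shift_up w.1 (rcons (map flip W) (N, N)).
Proof.
move=> ew; have [Y eY] := wex_val_rcons; have [w' [W' [ew' w1]]] := wex_cons.
have {ew' w1} w1 : w.2 = 1 by move: ew' w1; rewrite ew => -[<- _].
have eY' : w.1 :: map fst W = rcons Y n by rewrite -eY ew.
have [sv sp] := wex_sorted av; have [dv dp] := dfc_sorted av2.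
rewrite shift_up_flip eY'.
have ezip (A B : seq nat) a b : size A = size B -> zip (rcons A a) (rcons B b) = rcons (zip A B) (a, b).
  by elim: A B => [|x A IH] [|y B] //= [/IH->].
have sY : size (map snd W) = size Y.
  by have := congr1 size eY'; rewrite /= size_rcons !size_map => -[].
rewrite ezip //; congr rcons.
have uval := wex_dfc_val s; have upos := wex_dfc_pos s.
have uval2 := wex_dfc_val s2; have upos2 := wex_dfc_pos s2.
have memC (A B : seq nat) x : perm_eq (A ++ B) (iota 1 n) -> (x \in B) = (0 < x <= n) && (x \notin A).
  move=> pr; have un : uniq (A ++ B) by rewrite (perm_uniq pr) iota_uniq.
  have := perm_mem pr x; rewrite mem_cat mem_iota add1n ltnS => <-.
  by move: un; rewrite cat_uniq => /and3P[_ /hasPn dis _]; have [xB|xB] := boolP (x \in B);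
    rewrite ?(negbTE (dis x xB)) ?orbT ?orbF ?andbN.
rewrite !map_cat in uval upos uval2 upos2.
have eV : map S (map fst (dfc s2)) = map snd W.
  apply: (irr_sorted_eq ltn_trans ltn_irr).
  - by rewrite sorted_map_succn sorted_map.
  - by rewrite sorted_map; move: sp; rewrite ew => /path_sorted.
  move=> v; have [wv|] := boolP (v \in map snd W).
    have /mapP[z zW ez] := wv; have zw : z \in wex s by rewrite ew inE zW orbT.
    have [_ _ z0 zn] := wex_bounds zw.
    have v1 : 1 < v.
      move: sp; rewrite ew => /(order_path_min (@incr_trans snd))/allP/(_ z zW).
      by rewrite /incr -ez w1.
    rewrite -(prednK (ltnW v1)) mem_map; last by move=> ? ? [].
    rewrite (memC _ _ _ uval2) -(mem_map (f := S)) ?wex2_values ?prednK ?(ltnW v1) //; last by move=> ? ? [].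
    have vn : v <= n by rewrite ez.
    have vb : 0 < v.-1 <= n by clear -v1 vn; lia.
    rewrite vb mem_rcons inE negb_or (ltn_eqF (_ : v < N)) //=.
    have := memC (map snd (dfc s)) (map snd (wex s)) v.
    rewrite perm_catC upos => /(_ isT); rewrite ez (map_f snd zw) => /esym/andP[_].
    by rewrite -ez.
  move=> vW; apply/negP => /mapP[u uF ev].
  move: uF; rewrite (memC _ _ _ uval2) -(mem_map (f := S)) ?wex2_values -?ev; last by move=> ? ? [].
  rewrite mem_rcons inE negb_or => /and3P[/andP[u0 un] vN vd].
  have : v \in map snd (wex s).
    rewrite (memC (map snd (dfc s))) ?vd ?andbT; last by rewrite perm_catC.
    by move: vN; rewrite ev eqSS /= ltn_neqAle => ->.
  by rewrite ew inE (negbTE vW) orbF w1 ev eqSS => /eqP e1; rewrite e1 in u0.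
have eP : map predn (map snd (dfc s2)) = Y.
  have pos2 : map snd (dfc s2) = map S Y.
    apply: (irr_sorted_eq ltn_trans ltn_irr).
    - by rewrite sorted_map.
    - rewrite sorted_map_succn; have : sorted ltn (rcons Y n) by rewrite -eY sorted_map.
      by rewrite -cats1 => /cat_sorted2[].
    have posw : map snd (wex s2) = 1 :: map S (map fst (dfc s)).
      have <- : map S (map predn (map snd (wex s2))) = map snd (wex s2).
        rewrite -[RHS]map_id -[LHS]map_comp; apply/eq_in_map => v /mapP[z /wex_bounds[_ _ z0 _] ->] /=.
        by rewrite prednK.
      by rewrite wex2_positions.
    have YU : uniq (rcons Y n) by rewrite -eY (sorted_uniq ltn_trans ltn_irr) // sorted_map.
    have memY u : (u \in Y) = [&& 0 < u, u < n & u \notin map fst (dfc s)].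
      have : (u \in rcons Y n) = (0 < u <= n) && (u \notin map fst (dfc s)).
        by rewrite -eY; apply: memC; rewrite perm_catC.
      rewrite mem_rcons inE; move: YU; rewrite rcons_uniq => /andP[nY _].
      have [->|un] := eqVneq u n; first by rewrite ltnn andbF (negbTE nY).
      by move=> /= ->; rewrite [u < n]ltn_neqAle un -andbA.
    move=> v; rewrite (memC _ _ _ upos2) posw inE negb_or.
    case: v => [|v].
      by rewrite ltnn /=; apply/esym/negP => /mapP[].
    rewrite !mem_map; try by move=> ? ? [].
    by rewrite memY eqSS /= lt0n; case: (v == 0); rewrite ?andbF.
  by rewrite pos2 -map_comp map_id_in.
rewrite -eV -eP -!map_comp /raise.
by elim: (dfc s2) => //= z L ->.
Qed.

End Next.

(** * A change of one letter is a promotion *)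
Lemma count_lt_iota n c : 0 < c -> c <= n.+1 -> count (fun v => v < c) (iota 1 n) = c.-1.
Proof.
move=> c0 cn; have -> : n = c.-1 + (n.+1 - c) by lia.
rewrite iotaD count_cat (_ : count _ (iota 1 _) = c.-1); last first.
  apply/eqP; rewrite -[X in _ == X](size_iota 1 c.-1) -all_count.
  by apply/allP => v; rewrite mem_iota; lia.
rewrite (_ : count _ _ = 0) ?addn0 //; apply/eqP; rewrite -leqn0 leqNgt -has_count.
by apply/hasPn => v; rewrite mem_iota; lia.
Qed.

Lemma dyck_close n (D : kdyck n 1) u v : D = true :: u ++ false :: v :> seq bool ->
  is_kdyck 1 n (u ++ true :: rcons v false) -> count_mem false u = count_mem true u ->
  promotion D = u ++ true :: rcons v false :> seq bool.
Proof.
move=> eD /is_kdyckP[_ _ ok] bal; apply: promotion_close => //; last by rewrite mul1n.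
move=> i; have := ok (minn i (size u)); rewrite take_min take_size_cat //.
Qed.

Section Row.
Variables (n : nat) (s : 'S_n).
Hypotheses (n0 : 0 < n) (av : avoids321 s).
Let G := greedy (wex s) (dfc s).

Lemma bumped_uniq : uniq (bumped G).
Proof.
apply: subseq_uniq (bumped_sub _ _) _; have [srt _] := wex_sorted av.
by rewrite (sorted_uniq ltn_trans ltnn) // sorted_map.
Qed.

Lemma bumpers_uniq : uniq (bumpers G).
Proof.
apply: subseq_uniq (bumpers_sub _ _) _; have [_ srt] := dfc_sorted av.
by rewrite (sorted_uniq ltn_trans ltnn) // sorted_map.
Qed.

Lemma bumped_bounds : {in bumped G, forall v, 0 < v <= n}.
Proof. by move=> v /(mem_subseq (bumped_sub _ _))/mapP[z /wex_bounds[? ? _ _] ->]; apply/andP. Qed.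

Lemma bumpers_bounds : {in bumpers G, forall v, 1 < v <= n}.
Proof. by move=> v /(mem_subseq (bumpers_sub _ _))/mapP[z /dfc_bounds[_ _ ? ?] ->]; apply/andP. Qed.

Lemma rsk_word_kdyck : is_kdyck 1 n (rsk_word s).
Proof.
have [-> _] := rsk_word_greedy av; apply: greedy_word_kdyck.
- exact: bumped_uniq.
- exact: bumpers_uniq.
- exact: bumped_bounds.
- by move=> v /bumpers_bounds/andP[/ltnW-> ->].
- by rewrite !size_map.
- by move=> x; apply: bumped_half; exact: wex_dfc_val.
- by move=> x; apply: bumpers_half; exact: wex_dfc_pos.
Qed.

Lemma reversed_word_kdyck : is_kdyck 1 n (greedy_word n (bumpers G) (bumped G)).
Proof.
apply: greedy_word_kdyck.
- exact: bumpers_uniq.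
- exact: bumped_uniq.
- by move=> v /bumpers_bounds/andP[/ltnW-> ->].
- exact: bumped_bounds.
- by rewrite !size_map.
- by move=> x; apply: bumpers_half; exact: wex_dfc_pos.
- by move=> x; apply: bumped_half; exact: wex_dfc_val.
Qed.

Lemma old_greedy : greedy (old_values s) (old_positions s) =
  rcons [seq (flip g.2, flip g.1) | g <- G] ((n.+1, n.+1), (n.+1, n.+1)).
Proof.
rewrite /old_values /old_positions greedy_rcons_both.
- rewrite greedy_transpose // => e f /wexP[_ e1] /dfcP[_ f1].
  by apply/negP => /andP[h1 h2]; have := leq_ltn_trans e1 (ltn_trans h1 (ltn_trans f1 h2)); rewrite ltnn.
- by move=> z; rewrite mem_flip => /dfc_bounds[_ /= h2 _ h4]; split; rewrite ltnS // ltnW.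
- by move=> z; rewrite mem_flip => /wex_bounds[_ /= h2 _ h4]; split; rewrite ltnS.
Qed.

Lemma bumped_old : bumped (greedy (old_values s) (old_positions s)) = rcons (bumpers G) n.+1.
Proof. by rewrite old_greedy /bumped map_rcons -map_comp. Qed.

Lemma bumpers_old : bumpers (greedy (old_values s) (old_positions s)) = rcons (bumped G) n.+1.
Proof. by rewrite old_greedy /bumpers map_rcons -map_comp. Qed.

Lemma reversed_word_cons : greedy_word n (bumpers G) (bumped G) =
  true :: [seq v \notin bumpers G | v <- iota 2 n.-1] ++ [seq a \in bumped G | a <- rev (iota 1 n)].
Proof.
rewrite /greedy_word; case: (n) n0 => // m _ /=; congr cons.
by apply/negP => /bumpers_bounds; rewrite ltnn.
Qed.

End Row.

Lemma count_bool (w : seq bool) : count_mem true w + count_mem false w = size w.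
Proof. by elim: w => //= -[] w <-; rewrite ?addnS ?addSn. Qed.

Lemma iota_split m n c : m <= c -> c < m + n -> iota m n = iota m (c - m) ++ c :: iota c.+1 (m + n - c.+1).
Proof.
move=> mc cn; have := iotaD m (c - m) (m + n - c); rewrite subnKC // => h.
rewrite -[c :: _]/(iota c (m + n - c.+1).+1).
have -> : (m + n - c.+1).+1 = m + n - c by lia.
by rewrite -h; congr iota; lia.
Qed.

Lemma count_mem_letters (A r : seq nat) : count_mem true [seq a \in A | a <- r] = count (mem A) r.
Proof. by rewrite count_map; apply: eq_count => v /=; case: (v \in A). Qed.

(** By the last hypothesis the letters after that of [c] are balanced, hence also
    those between the first step and the letter of [c]: the path returns to the
    diagonal there, and not before if the result is to be a Dyck path. *)
Lemma position_flip n (D : kdyck n 1) X (A A' : seq nat) c :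
  D = true :: X ++ [seq a \in A | a <- rev (iota 1 n)] :> seq bool ->
  is_kdyck 1 n (X ++ rcons [seq a \in A' | a <- rev (iota 1 n)] false) ->
  0 < c <= n -> c \notin A -> (forall a, a <= n -> (a \in A') = (a \in A) || (a == c)) ->
  uniq A -> {in A, forall a, 0 < a} -> 2 * count (fun v => v < c) A = c.-1 ->
  promotion D = X ++ rcons [seq a \in A' | a <- rev (iota 1 n)] false :> seq bool.
Proof.
move=> eD kd /andP[c0 cn] cA memA uA A0 cnt.
have eI (B : seq nat) : [seq a \in B | a <- rev (iota 1 n)] =
    [seq a \in B | a <- rev (iota c.+1 (n - c))] ++ (c \in B) :: [seq a \in B | a <- rev (iota 1 c.-1)].
  rewrite (iota_split c0 (_ : c < 1 + n)) ?add1n ?ltnS // subSS subn1.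
  by rewrite rev_cat rev_cons cat_rcons map_cat.
have cA' : c \in A' by rewrite memA // eqxx orbT.
have eA m j : m + j <= n.+1 -> c \notin iota m j ->
   [seq a \in A' | a <- rev (iota m j)] = [seq a \in A | a <- rev (iota m j)].
  move=> mj cm; apply/eq_in_map => a; rewrite mem_rev => am; rewrite memA.
    by rewrite (_ : a == c = false) ?orbF //; apply: contraTF am => /eqP->.
  by move: am; rewrite mem_iota; lia.
rewrite eI cA' !eA in kd *; try by rewrite ?mem_iota; lia.
rewrite rcons_cat rcons_cons catA in kd *.
have dD := kdyckP D; rewrite eD eI (negbTE cA) catA in dD.
rewrite eI (negbTE cA) catA in eD; apply: dyck_close => //.
case/is_kdyckP: dD; rewrite mul1n /= count_cat [in X in _ -> X]count_cat /=.
set v := [seq a \in A | a <- rev (iota 1 c.-1)]; move: (_ ++ _) => u hT hF _.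
have hv : count_mem true v + count_mem false v = c.-1 by rewrite count_bool size_map size_rev size_iota.
have : count_mem true v = count (fun v => v < c) A.
  by rewrite count_mem_letters count_rev count_mem_iota // add1n prednK.
move: hT hF hv cnt; clear; move: (count_mem true v) (count_mem false v) (count_mem true u) (count_mem false u) (count _ A).
lia.
Qed.

Lemma value_flip n (D : kdyck n 1) Y (V V' : seq nat) c :
  D = true :: [seq v \notin V | v <- iota 2 n.-1] ++ Y :> seq bool ->
  is_kdyck 1 n ([seq v \notin V' | v <- iota 2 n.-1] ++ rcons Y false) ->
  1 < c <= n -> c \notin V' -> (forall a, a <= n -> (a \in V) = (a \in V') || (a == c)) ->
  uniq V -> {in V, forall a, 1 < a} -> c = (2 * count (fun v => v < c) V).+2 ->
  promotion D = [seq v \notin V' | v <- iota 2 n.-1] ++ rcons Y false :> seq bool.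
Proof.
move=> eD kd /andP[c1 cn] cV' memV uV V1 cnt.
have eI (B : seq nat) : [seq a \notin B | a <- iota 2 n.-1] =
    [seq a \notin B | a <- iota 2 (c - 2)] ++ (c \notin B) :: [seq a \notin B | a <- iota c.+1 (n - c)].
  rewrite (iota_split c1 (_ : c < 2 + n.-1)) ?map_cat; last by lia.
  by congr (_ ++ _ :: map _ (iota _ _)); lia.
have cV : c \in V by rewrite memV // eqxx orbT.
have eV m j : m + j <= n.+1 -> c \notin iota m j ->
   [seq a \notin V' | a <- iota m j] = [seq a \notin V | a <- iota m j].
  move=> mj cm; apply/eq_in_map => a am; rewrite memV.
    by rewrite (_ : a == c = false) ?orbF //; apply: contraTF am => /eqP->.
  by move: am; rewrite mem_iota; lia.
rewrite eI cV' !eV in kd *; try by rewrite ?mem_iota; lia.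
rewrite -catA cat_cons -rcons_cat in kd *.
rewrite eI cV -catA cat_cons in eD; apply: dyck_close => //.
set u := [seq a \notin V | a <- _].
have hu : count_mem true u + count_mem false u = c - 2 by rewrite count_bool size_map size_iota.
have : count_mem false u = count (fun v => v < c) V.
  rewrite -[in RHS](subnKC c1) -count_mem_iota // count_map; apply: eq_count => v /=.
  by case: (v \in V).
move: hu cnt; clear; move: (count_mem true u) (count_mem false u) (count _ V).
lia.
Qed.

Section Promotion.
Variables (n : nat) (s s2 : 'S_n) (D2 : kdyck n 1).
Hypotheses (n0 : 0 < n) (av : avoids321 s) (av2 : avoids321 s2).
Hypotheses (vD : perm_eq (valleys D2) (q_points s)) (pD : perm_eq (peaks D2) (p_points s2)).
Let N := n.+1.

(** The word of [s2] is read off the matching of the shifted lists.  The letter of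
    the value [n] ends the first half of the word; it becomes that of the position
    [n], because the sentinel of the second list is matched, and contributes the
    position [n], exactly when the value [n] has not been bumped before. *)
Lemma new_greedy w W : wex s = w :: W ->
  let new := greedy (shift_up 0 (old_values s)) (shift_up w.1 (rcons (map flip W) (N, N))) in
  rsk_word s2 = [seq v \notin bumped new | v <- iota 2 n.-1] ++
     rcons [seq a \in bumpers new | a <- rev (iota 1 n)] false.
Proof.
move=> ew new.
have [E [j eE]] : exists E j, map raise (wex s2) = rcons E (N, j).
  rewrite (wex_next n0 av av2 vD pD) /old_values shift_up_rcons /=.
  by eexists; eexists.
have j_n : j < n.
  have : (N, j) \in map raise (wex s2) by rewrite eE mem_rcons mem_head.
  by case/mapP=> z /wex_bounds[_ _ z0 zn] [_ ->]; rewrite -ltnS prednK.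
set G2 := greedy (wex s2) (dfc s2).
pose tail := if N \in map S (bumped G2) then [::] else [:: ((N, j), (N, n))].
have enew : new = [seq (raise g.1, raise g.2) | g <- G2] ++ tail.
  rewrite /new -(wex_next n0 av av2 vD pD) -(dfc_next n0 av av2 vD pD ew) eE greedy_rcons_last.
  - rewrite -eE greedy_map /tail.
    + by rewrite /bumped -!map_comp.
    + by move=> x y _ _; rewrite /= ltnS.
    + move=> x y /wex_bounds[_ _ + _] /dfc_bounds[_ _ + _] /=.
      by case: (x.2) => // ? _; case: (y.2).
  - move=> z zE.
    have [] : z.1 <= N /\ z.2 < n.
      have : z \in map raise (wex s2) by rewrite eE mem_rcons inE zE orbT.
      by case/mapP=> y /wex_bounds[_ ? y0 ?] ->; rewrite /= ltnS -ltnS prednK.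
    have : sorted ltn (map fst (rcons E (N, j))).
      by rewrite -eE -map_comp sorted_map; have [+ _] := wex_sorted av2; apply: sub_sorted.
    rewrite map_rcons -cats1 (sorted_pairwise ltn_trans) pairwise_cat => /and3P[/allrelP/(_ z.1 N) + _ _].
    by rewrite map_f // inE eqxx => /(_ isT isT) h _ h2; split=> //; exact: ltnW.
  - exact: ltnW.
  - by move=> z /mapP[y /dfc_bounds[_ ? _ _] ->] /=; rewrite ltnS ltnW.
have eV : bumped new = map S (bumped G2) ++ map (fun=> N) tail.
  by rewrite enew /bumped map_cat -!map_comp; congr (_ ++ _); rewrite /tail; case: ifP.
have eA : bumpers new = map predn (bumpers G2) ++ map (fun=> n) tail.
  by rewrite enew /bumpers map_cat -!map_comp; congr (_ ++ _); rewrite /tail; case: ifP.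
have [-> _] := rsk_word_greedy av2; rewrite -/G2 /greedy_word.
have ei : iota 1 n = rcons (iota 1 n.-1) n.
  have := iotaD 1 n.-1 1; rewrite addn1 add1n prednK // => ->; exact: cats1.
rewrite {1}ei map_rcons cat_rcons; congr (_ ++ _).
  rewrite (iotaDl 1 1) -map_comp; apply/eq_in_map => v; rewrite mem_iota => /andP[_ vn] /=.
  rewrite eV mem_cat mem_map; last by move=> ? ? [].
  have /negbTE-> : 1 + v \notin map (fun=> N) tail.
    apply/negP => /mapP[x _ e]; move: vn; rewrite add1n in e.
    by case: e => ->; rewrite add1n prednK // ltnn.
  by rewrite orbF.
have nA : 1 \notin bumpers G2 by apply/negP => /bumpers_bounds.
have memA a : a < n -> (a \in bumpers new) = (a.+1 \in bumpers G2).
  move=> an; rewrite eA mem_cat.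
  have /negbTE-> : a \notin map (fun=> n) tail by apply/negP => /mapP[x _ e]; rewrite e ltnn in an.
  rewrite orbF.
  apply/mapP/idP => [[x xB e]|aB]; last by exists a.+1.
  by have /andP[x1 _] := bumpers_bounds xB; rewrite e prednK // ltnW.
have memn : (n \in bumpers new) = (n \notin bumped G2).
  rewrite eA mem_cat /tail (_ : (N \in _) = (n \in bumped G2)); last first.
    exact: (mem_map succn_inj).
  have -> : n \in map predn (bumpers G2) = false.
    apply/mapP => -[x /bumpers_bounds/andP[x1 xn] e]; move: xn.
    by rewrite e -{1}(prednK (ltnW x1)) ltnn.
  by case: ifP; rewrite ?inE ?eqxx.
have -> : false = (0 \in bumpers new) by rewrite memA // (negbTE nA).
rewrite -(map_rcons (fun a => a \in bumpers new)) -rev_cons -memn.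
have -> : 0 :: iota 1 n = rcons (iota 0 n) n.
  by have := iotaD 0 n 1; rewrite addn1 cats1.
rewrite rev_rcons /=; congr cons; rewrite (iotaDl 1 0) -map_rev -map_comp.
by apply/eq_in_map => a; rewrite mem_rev mem_iota => /andP[_ an] /=; rewrite memA.
Qed.

(** [D] has the word of the inverse of [s].  By [greedy_shift_flip] the word of [s2]
    differs from it, apart from a step moved to the other end, in a single letter.
    The pairs matched before it use up all the smaller values, and the positions
    next to them, so that this letter is the one of the first return. *)
Lemma promotion_rsk_word (D : kdyck n 1) :
  D = greedy_word n (bumpers (greedy (wex s) (dfc s))) (bumped (greedy (wex s) (dfc s))) :> seq bool ->
  promotion D = rsk_word s2 :> seq bool.
Proof.
set Vo := bumpers _; set Ao := bumped _; rewrite reversed_word_cons // -/Vo -/Ao => eD.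
have [w [W [ew w1]]] := wex_cons n0 av.
have kd := rsk_word_kdyck av2; have := new_greedy ew; cbv zeta; set new := greedy _ _ => ers.
have [e [E eE]] : exists e E, old_values s = e :: E.
  by rewrite /old_values; case: (dfc s) => [|z L]; do 2 eexists.
have eF : old_positions s = flip w :: rcons (map flip W) (N, N) by rewrite /old_positions ew.
set F := rcons (map flip W) (N, N) in eF.
have lastE : last e E = (N, N) by rewrite -[last e E]/(last e (e :: E)) -eE /old_values last_rcons.
have lastF : last (flip w) F = (N, N) by rewrite last_rcons.
have [oE1 oE2] := old_values_sorted av; have [oF1 oF2] := old_positions_sorted av.
rewrite eE in oE1 oE2; rewrite eF in oF1 oF2.
have sy : synchronized e E (flip w) F.
  split=> //; first by rewrite lastE lastF.
  by have := old_locked av; rewrite eE eF.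
have ew1 : (flip w).1 <= e.1.
  have : e \in old_values s by rewrite eE mem_head.
  rewrite mem_rcons inE => /orP[/eqP->|]; first by rewrite /= w1.
  by rewrite mem_flip => /dfc_bounds[_ _ + _]; rewrite /= w1 => /ltnW.
have Fn : F != [::] by rewrite /F; case: (map _ _).
have := greedy_shift_flip sy ew1 (leq0n _) Fn; rewrite -eE -eF lastF.
cbv zeta; rewrite bumped_old // bumpers_old // -/Vo -/Ao -/new.
move=> [E0 [e0 [E2 [F0 [f0 [F2 [r [eqE eqF sEF]]]]]]]].
have uV := bumpers_uniq av; rewrite -/Vo in uV; have uA := bumped_uniq av; rewrite -/Ao in uA.
have srtE1 : sorted ltn (map fst E0 ++ e0.1 :: map fst E2).
  by rewrite -map_cons -map_cat -eqE eE sorted_map.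
have srtE2 : sorted ltn (map snd E0 ++ e0.2 :: map snd E2).
  by rewrite -map_cons -map_cat -eqE eE sorted_map.
have srtF1 : sorted ltn (map fst F0 ++ f0.1 :: map fst F2).
  by rewrite -map_cons -map_cat -eqF eF sorted_map.
have srtF2 : sorted ltn (map snd F0 ++ f0.2 :: map snd F2).
  by rewrite -map_cons -map_cat -eqF eF sorted_map.
have cntL c (L1 L2 : seq nat) (x : nat) : sorted ltn (L1 ++ x :: L2) -> c <= x -> 
   count (fun v => v < c) (L1 ++ x :: L2) = count (fun v => v < c) L1.
  rewrite (sorted_pairwise ltn_trans) pairwise_cat /= => /and4P[_ _ /allP h _] cx.
  rewrite count_cat /= ltnNge cx /= add0n; rewrite (_ : count _ L2 = 0) ?addn0 //.
  apply/eqP; rewrite -leqn0 leqNgt -has_count; apply/hasPn => y /h xy.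
  by rewrite -leqNgt (leq_trans cx) // ltnW.
have cntA c (L1 L2 : seq nat) (x : nat) : sorted ltn (L1 ++ x :: L2) -> x <= c -> 
   count (fun v => v < c) L1 = size L1.
  rewrite (sorted_pairwise ltn_trans) pairwise_cat => /and3P[/allrelP h _ _] cx.
  apply/eqP; rewrite -all_count; apply/allP => y yL.
  by apply: leq_trans cx; apply: h; rewrite ?mem_head.
have cnt_val c : c <= n.+1 -> count (fun v => v < c) (map snd (old_values s)) +
    count (fun v => v < c) (map snd (old_positions s)) = c.-1.
  case: c => [|c] cn; first by rewrite !count_pred0.
  rewrite -(count_lt_iota _ cn) // -(seq.permP (wex_dfc_val s)) map_cat count_cat addnC.
  by rewrite /old_values /old_positions !map_rcons -!map_comp -!cats1 !count_cat /= ltnNge cn !addn0.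
have cnt_pos c : c <= n.+1 -> count (fun v => v < c) (map fst (old_values s)) +
    count (fun v => v < c) (map fst (old_positions s)) = c.-1.
  case: c => [|c] cn; first by rewrite !count_pred0.
  rewrite -(count_lt_iota _ cn) // -(seq.permP (wex_dfc_pos s)) map_cat count_cat addnC.
  by rewrite /old_values /old_positions !map_rcons -!map_comp -!cats1 !count_cat /= ltnNge cn !addn0.
have bw (w' : seq bool) : count_mem true w' + count_mem false w' = size w'.
  by elim: w' => //= -[] w' <-; rewrite ?addnS ?addSn.
have dD := kdyckP D; rewrite eD in dD; rewrite ers in kd *.
case=> [[h1 h2 h3 h4 h5]|[h1 h2 h3 h4 h5]].
  set c := f0.2 in h1 h2 h5 srtF2.
  have e0N : e0.2 <= N.
    have : e0 \in old_values s by rewrite eqE mem_cat mem_head orbT.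
    rewrite mem_rcons inE => /orP[/eqP->//|]; rewrite mem_flip => /dfc_bounds[_ h _ _].
    by rewrite /= in h; exact: leqW (ltnW h).
  have cn : c <= n by rewrite -ltnS; exact: leq_trans h2 e0N.
  have c0 : 0 < c.
    have : f0 \in old_positions s by rewrite eqF mem_cat mem_head orbT.
    rewrite mem_rcons inE => /orP[/eqP e00|]; first by rewrite /c e00 /= ltnn in cn.
    by rewrite mem_flip => /wex_bounds[].
  have srtA : sorted ltn (map snd F0 ++ c :: r).
    rewrite -h5; apply: (@subseq_sorted _ _ ltn_trans _ (map snd (old_positions s))); last first.
      by rewrite eF sorted_map.
    rewrite eF map_cons lastI last_map lastF -!cats1; apply: cat_subseq => //.
    have := bumpers_sub (shift_up 0 (old_values s)) (shift_up w.1 F); rewrite -/new.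
    have shift_snd (j : nat) L : map snd (shift_up j L) = belast j (map snd L).
      by elim: L j => //= x L IH j; rewrite IH.
    by rewrite shift_snd.
  have memA a : a <= n -> (a \in bumpers new) = (a \in Ao) || (a == c).
    move=> an; have : (a \in rcons (bumpers new) N) = (a \in rcons Ao N) || (a == c).
      by rewrite h4 h5 !mem_cat inE; case: eqP; rewrite ?orbT ?orbF.
    by rewrite !mem_rcons !inE (ltn_eqF (_ : a < N)).
  have cA : c \notin Ao.
    have : c \notin rcons Ao N.
      have := sorted_uniq ltn_trans ltnn srtA; rewrite -cat1s.
      by rewrite (perm_uniq (permEl (perm_catCA _ _ _))) h4 => /andP[].
    by rewrite mem_rcons inE negb_or => /andP[].
  rewrite h3 (_ : [seq v \notin rcons Vo N | v <- _] = [seq v \notin Vo | v <- iota 2 n.-1]) in kd *.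
    apply: (position_flip eD kd) (_ : 0 < c <= n) cA memA uA _ _; first by rewrite c0.
      by move=> z /bumped_bounds/andP[].
    have -> : count (fun v => v < c) Ao = size F0.
      rewrite -(size_map snd F0) -(cntA _ _ _ _ srtA (leqnn c)) -(cntL _ _ _ _ srtA (leqnn c)).
      have : count (fun v => v < c) (rcons Ao N) = count (fun v => v < c) (map snd F0 ++ r) by rewrite h4.
      by rewrite -cats1 !count_cat /= ltnn (ltnNge N) (leqW cn) /= !addn0 add0n.
    rewrite -(cnt_val _ (leqW cn)) eqE eqF !map_cat /=.
    rewrite (cntL c _ _ _ srtE2 (ltnW h2)) (cntL c _ _ _ srtF2 (leqnn c)) (cntA _ _ _ _ srtF2 (leqnn c)) size_map.
    rewrite (_ : count _ _ = size E0) ?sEF ?addnn ?mul2n //.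
    by apply/eqP; rewrite count_map -sEF -all_count.
  apply/eq_in_map => v; rewrite mem_iota mem_rcons inE => /andP[_ vn].
  by rewrite (ltn_eqF (_ : v < N)) //; move: vn; rewrite addSn ltnS add1n prednK.
set c := e0.1 in h1 h2 h4 h5 srtE1; have /andP[fc cN] := h2.
have cD : c \in map snd (dfc s).
  have : e0 \in old_values s by rewrite eqE mem_cat mem_head orbT.
  rewrite mem_rcons inE => /orP[/eqP e00|]; first by rewrite /c e00 /= ltnn in cN.
  by rewrite mem_flip => h; apply/mapP; exists (flip e0).
have c1 : 1 < c by case/mapP: cD => z /dfc_bounds[_ _ ? _] ->.
have srtV : sorted ltn (map fst E0 ++ c :: r).
  rewrite -h4 -cats1; apply: (@subseq_sorted _ _ ltn_trans _ (map fst (old_values s))); last first.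
    by rewrite eE sorted_map.
  rewrite /old_values map_rcons -cats1 -map_comp; apply: cat_subseq => //.
  exact: bumpers_sub.
have eA : bumpers new = Ao by have := h3; rewrite /= => /rcons_inj[].
have memV v : v <= n -> (v \in Vo) = (v \in bumped new) || (v == c).
  move=> vn; have : (v \in rcons Vo N) = (v \in bumped new) || (v == c).
    by rewrite h4 h5 !mem_cat inE; case: eqP; rewrite ?orbT ?orbF.
  by rewrite !mem_rcons !inE (ltn_eqF (_ : v < N)).
have cV : c \notin bumped new.
  have := sorted_uniq ltn_trans ltnn srtV; rewrite -cat1s.
  by rewrite (perm_uniq (permEl (perm_catCA _ _ _))) h5 => /andP[].
rewrite eA in kd *; apply: (value_flip eD kd) (_ : 1 < c <= n) cV memV uV _ _; first by rewrite c1.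
  by move=> z /bumpers_bounds/andP[].
have -> : count (fun v => v < c) Vo = size E0.
  rewrite -(size_map fst E0) -(cntA _ _ _ _ srtV (leqnn c)) -(cntL _ _ _ _ srtV (leqnn c)) -h4.
  by rewrite -cats1 count_cat /= (ltnNge N) (ltnW cN) /= !addn0.
have := cnt_pos _ (ltnW cN); rewrite eqE eqF !map_cat /=.
rewrite (cntL c _ _ _ srtE1 (leqnn c)) (cntA _ _ _ _ srtE1 (leqnn c)) size_map count_cat /=.
rewrite (cntA _ _ _ _ srtF1 fc) size_map -sEF (_ : count _ (map fst F2) = 0); last first.
  apply/eqP; rewrite -leqn0 leqNgt -has_count has_map -all_predC; apply: sub_all h1 => z /= cz.
  by rewrite -leqNgt ltnW.
rewrite (_ : f0.1 < c).
  by rewrite /= addn0 addn1 addnS addnn -mul2n => ->; rewrite prednK // ltnW.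
rewrite ltn_neqAle fc andbT; apply/eqP => efc.
have : f0 \in old_positions s by rewrite eqF mem_cat mem_head orbT.
rewrite mem_rcons inE => /orP[/eqP e00|]; first by rewrite -efc e00 /= ltnn in cN.
rewrite mem_flip => fW; have := perm_uniq (wex_dfc_pos s); rewrite iota_uniq map_cat cat_uniq.
move=> /and3P[_ /hasPn h _]; have /negP[] := h c cD; apply/mapP; exists (flip f0) => //.
Qed.
End Promotion.

(** * Dyck paths and 321-avoiding permutations *)
Definition graph n (s : 'S_n) : seq (nat * nat) := [seq (val i, val (s i)) | i <- enum 'I_n].

Lemma graph_perm n (T : seq (nat * nat)) : perm_eq (unzip1 T) (iota 0 n) ->
  perm_eq (unzip2 T) (iota 0 n) -> exists s : 'S_n, perm_eq T (graph s).
Proof.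
move=> p1 p2; have u1 : uniq (unzip1 T) by rewrite (perm_uniq p1) iota_uniq.
have u2 : uniq (unzip2 T) by rewrite (perm_uniq p2) iota_uniq.
pose f i := nth 0 (unzip2 T) (index i (unzip1 T)).
have sT : size (unzip1 T) = size (unzip2 T) by rewrite !size_map.
have idx i : i < n -> index i (unzip1 T) < size T.
  by move=> lt_i; rewrite -(size_map fst T) index_mem (perm_mem p1) mem_iota.
have fn (i : 'I_n) : f i < n.
  have : f i \in unzip2 T by apply: mem_nth; rewrite -sT size_map idx.
  by rewrite (perm_mem p2) mem_iota.
have finj : injective (fun i : 'I_n => Ordinal (fn i)).
  move=> i j [/eqP]; rewrite /f nth_uniq ?size_map ?idx // => /eqP e; apply: val_inj.
  have mi (l : 'I_n) : (l : nat) \in unzip1 T by rewrite (perm_mem p1) mem_iota add0n ltn_ord.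
  by rewrite /= -(nth_index 0 (mi i)) e nth_index.
exists (perm finj); apply: uniq_perm.
- exact: map_uniq u1.
- by rewrite map_inj_uniq ?enum_uniq // => i j [/val_inj->].
have mem_graph (z : nat * nat) : z \in T -> z.2 = f z.1.
  move=> zT; rewrite /f; set i := index z T; have iT : i < size T by rewrite index_mem.
  have -> : z.1 = nth 0 (unzip1 T) i by rewrite (nth_map z) // nth_index.
  by rewrite index_uniq ?size_map // (nth_map z) // nth_index.
move=> z; apply/idP/mapP => [zT|[i _ ->]].
  have z1 : z.1 < n.
    have : z.1 \in unzip1 T by exact: map_f.
    by rewrite (perm_mem p1) mem_iota.
  exists (Ordinal z1); first by rewrite mem_enum.
  by rewrite permE /= -mem_graph //; case: (z).
rewrite permE /=; have : (i : nat) \in unzip1 T by rewrite (perm_mem p1) mem_iota add0n ltn_ord.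
by case/mapP=> y yT ->; rewrite -mem_graph //; case: (y) yT.
Qed.

Lemma increasing_zip (A B : seq nat) : sorted ltn A -> sorted ltn B ->
  {in zip A B &, forall x y, x.1 < y.1 -> x.2 < y.2}.
Proof.
elim: A B => [|a A IH] [|b B] //= sA sB x y.
have hd (u v : nat) (U : seq nat) : path ltn u U -> v \in U -> u < v.
  by move=> /(order_path_min ltn_trans)/allP; apply.
have z1 z : z \in zip A B -> z.1 \in A /\ z.2 \in B.
  by elim: (A) (B) => [|a' A' IH'] [|b' B'] //=; rewrite !inE => /orP[/eqP->|/IH'[-> ->]]; rewrite ?eqxx ?orbT.
rewrite !inE => /orP[/eqP->|xZ] /orP[/eqP->|yZ] /=; rewrite ?ltnn //.
- by move=> _; apply: hd sB _; case: (z1 _ yZ).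
- by move=> lt; have := hd _ _ _ sA (proj1 (z1 _ xZ)); rewrite ltnNge (ltnW lt).
exact: IH (path_sorted sA) (path_sorted sB) _ _ xZ yZ.
Qed.

(** Two of three letters belong to the same increasing subsequence. *)
Lemma avoids321_increasing n (s : 'S_n) T1 T2 : perm_eq (T1 ++ T2) (graph s) ->
  {in T1 &, forall x y, x.1 < y.1 -> x.2 < y.2} ->
  {in T2 &, forall x y, x.1 < y.1 -> x.2 < y.2} -> avoids321 s.
Proof.
move=> pr h1 h2; apply/forallP => i; apply/forallP => j; apply/forallP => l.
apply/negP => /and4P[ij jl ji lj].
have mem (x : 'I_n) : ((x : nat, s x : nat) \in T1) || ((x : nat, s x : nat) \in T2).
  by rewrite -mem_cat (perm_mem pr); apply: (map_f (fun i => (val i, val (s i)))); rewrite mem_enum.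
have no T (x y : 'I_n) : {in T &, forall x y : nat * nat, x.1 < y.1 -> x.2 < y.2} ->
  (x : nat, s x : nat) \in T -> (y : nat, s y : nat) \in T -> x < y -> s y < s x -> False.
  by move=> h hx hy xy yx; have := h _ _ hx hy xy; rewrite /= ltnNge (ltnW yx).
have il := ltn_trans ij jl; have li := ltn_trans lj ji.
by case/orP: (mem i) => hi; case/orP: (mem j) => hj; case/orP: (mem l) => hl;
  first [exact: no h1 hi hj ij ji | exact: no h2 hi hj ij ji | exact: no h1 hj hl jl lj
    | exact: no h2 hj hl jl lj | exact: no h1 hi hl il li | exact: no h2 hi hl il li].
Qed.

Lemma nth_sorted_count (L : seq nat) i c : sorted ltn L -> i < size L ->
  (nth 0 L i < c) = (i < count (fun v => v < c) L).
Proof.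
elim: L i => //= x L IH i srt; have srt' := path_sorted srt.
case: i => [|i] /= lt_i; last first.
  rewrite IH //; case: (ltnP x c) => xc; first by rewrite ltnS.
  have := lt_i; rewrite ltnS => lt_i'; rewrite add0n.
  have c0 : count (fun v => v < c) L = 0.
    apply/eqP; rewrite -leqn0 leqNgt -has_count; apply/hasPn => y yL.
    by rewrite -leqNgt (leq_trans xc) // ltnW //; have /allP := order_path_min ltn_trans srt; apply.
  by rewrite c0.
case: (ltnP x c) => xc //; rewrite add0n; apply/esym/negbTE; rewrite -leqNgt leqn0 -leqn0 leqNgt -has_count.
apply/hasPn => y yL; rewrite -leqNgt (leq_trans xc) // ltnW //.
by have /allP := order_path_min ltn_trans srt; apply.
Qed.

Definition complement n (A : seq nat) := [seq i <- iota 0 n | i \notin A].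

Lemma perm_complement n (A : seq nat) : uniq A -> {in A, forall a, a < n} ->
  perm_eq (A ++ complement n A) (iota 0 n).
Proof.
move=> uA hA; apply: uniq_perm; [|exact: iota_uniq|].
  rewrite cat_uniq uA filter_uniq ?iota_uniq // andbT; apply/hasPn => x.
  by rewrite mem_filter => /andP[].
move=> x; rewrite mem_cat mem_filter mem_iota add0n /=.
by have [/hA->|] := boolP (x \in A).
Qed.

Lemma complement_sorted n A : sorted ltn (complement n A).
Proof. by apply: sorted_filter; [exact: ltn_trans|exact: iota_ltn_sorted]. Qed.

Lemma count_lt_iota0 n c : c <= n -> count (fun v => v < c) (iota 0 n) = c.
Proof.
move=> cn; have := @count_mem_iota (iota 0 c) 0 n (iota_uniq _ _) (fun _ _ => leq0n _).
rewrite add0n => e; transitivity (count (mem (iota 0 c)) (iota 0 n)).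
  by apply: eq_count => v /=; rewrite mem_iota.
rewrite e -[RHS](size_iota 0 c); apply/eqP; rewrite -all_count; apply/allP => v.
by rewrite mem_iota /= add0n => vc; exact: leq_trans cn.
Qed.

Lemma sorted_rcons_ltn L m : sorted ltn L -> {in L, forall v, v < m} -> sorted ltn (rcons L m).
Proof. by case: L => // x L /= srt h; rewrite rcons_path srt /=; apply: h; exact: mem_last. Qed.

Lemma leq_count_in (T : eqType) (p q : pred T) (L : seq T) : {in L, forall v, p v -> q v} ->
  count p L <= count q L.
Proof.
elim: L => //= x L IH h; apply: leq_add; last by apply: IH => u uL; apply: h; rewrite inE uL orbT.
by case: (p x) (h x (mem_head _ _)) => // ->.
Qed.

Lemma valley_seq_bounds n x y vl : valley_seq n x y vl ->
  {in vl, forall v, [/\ 0 < v.1, v.1 <= v.2 & v.2 < n]}.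
Proof.
elim: vl x y => // v vl IH x y /= /and4P[xv yv vn vv] u; rewrite inE => /orP[/eqP->|uv].
  split=> //; first by exact: leq_ltn_trans xv.
  suff h x' y' l : valley_seq n x' y' l -> y' < n by exact: h vv.
  elim: l x' y' => [|z l IHl] x' y' /=; first by case/andP.
  by case/and4P=> _ yz _ /IHl; exact: ltn_trans.
exact: IH vv _ uv.
Qed.

Lemma valley_seq_intro n x y vl : x < n -> y < n -> path ltn x (unzip1 vl) -> path ltn y (unzip2 vl) ->
  {in vl, forall v, v.1 <= v.2 < n} -> valley_seq n x y vl.
Proof.
elim: vl x y => [|v vl IH] x y xn yn /=; first by rewrite xn yn.
move=> /andP[-> p1] /andP[-> p2] h; have /andP[v1 v2] := h v (mem_head _ _).
by rewrite v1 IH // ?(leq_ltn_trans v1) // => u uv; apply: h; rewrite inE uv orbT.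
Qed.

Lemma peaks_below n x y vl : x <= y -> valley_seq n x y vl ->
  all (fun z => z.1 < z.2) (zip (x :: unzip1 vl) (rcons (unzip2 vl) n)).
Proof.
elim: vl x y => [|v vl IH] x y xy /=; first by case/andP=> ->.
by case/and4P=> _ yv vn /(IH _ _ vn) ->; rewrite (leq_ltn_trans xy).
Qed.

(** The peaks prescribe the values at the positions [xs]; the remaining values go
    to the remaining positions in increasing order.  The path being above the
    diagonal, there are fewer peaks of height at most [c] than of abscissa below
    [c], when [c] is not an abscissa of a peak; hence each remaining value is
    smaller than its position. *)
Lemma p_surj n (D : kdyck n 1) : 0 < n -> exists s : 'S_n, avoids321 s && perm_eq (peaks D) (p_points s).
Proof.
move=> n0; have [vl vv eD] := kdyck_valley_word n0 (kdyckP D).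
have [p1 p2] := valley_seq_sorted vv.
rewrite eD peaks_valley_word //.
have vle := valley_seq_bounds vv.
set xs := 0 :: unzip1 vl; set ys := rcons (unzip2 vl) n; pose zs := map predn ys.
have ys0 : {in ys, forall y, 0 < y <= n}.
  move=> y; rewrite mem_rcons inE => /orP[/eqP->|/mapP[v /vle[v1 v2 v3] ->]]; first by rewrite n0 leqnn.
  by rewrite (leq_trans v1 v2) ltnW.
have srt_xs : sorted ltn xs by [].
have srt_ys : sorted ltn ys.
  apply: sorted_rcons_ltn; first exact: path_sorted p2.
  by move=> y /mapP[v /vle[_ _ v2] ->].
have srt_zs : sorted ltn zs.
  rewrite sorted_map; apply: (@sub_in_sorted _ [pred y | 0 < y]) srt_ys.
    by move=> x y; rewrite !inE /=; lia.
  by apply/allP => y /ys0/andP[].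
have xsn : {in xs, forall x, x < n}.
  move=> x; rewrite inE => /orP[/eqP->//|/mapP[v /vle[_ v1 v2] ->]]; exact: leq_ltn_trans v1 v2.
have zsn : {in zs, forall z, z < n}.
  by move=> z /mapP[y /ys0/andP[y0 yn] ->]; rewrite prednK.
have uxs : uniq xs by rewrite (sorted_uniq ltn_trans ltnn).
have uzs : uniq zs by rewrite (sorted_uniq ltn_trans ltnn).
have px := perm_complement uxs xsn; have pz := perm_complement uzs zsn.
set cs := complement n xs in px; set ds := complement n zs in pz.
have sxz : size xs = size zs by rewrite !size_map size_rcons /= !size_map.
have scd : size cs = size ds.
  by have := perm_size px; rewrite -(perm_size pz) !size_cat sxz => /addnI.
pose T1 := zip xs zs; pose T2 := zip cs ds.
have [s pr] : exists s : 'S_n, perm_eq (T1 ++ T2) (graph s).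
  apply: graph_perm; rewrite /unzip1 /unzip2 map_cat -/(unzip1 _) -/(unzip1 _) -/(unzip2 _) -/(unzip2 _).
    by rewrite !unzip1_zip ?sxz ?scd.
  by rewrite !unzip2_zip ?sxz ?scd.
have T2_lt : {in T2, forall z, z.2 < z.1}.
  move=> z zT; set i := index z T2; have iT : i < size T2 by rewrite index_mem.
  have ic : i < size cs by move: iT; rewrite size_zip scd minnn.
  have id : i < size ds by rewrite -scd.
  have ez : z = (nth 0 cs i, nth 0 ds i) by rewrite -nth_zip // nth_index.
  rewrite ez /= nth_sorted_count ?complement_sorted //; set c := nth 0 cs i.
  have : c \in cs by exact: mem_nth.
  rewrite mem_filter mem_iota add0n /= => /andP[cx cn].
  have c0 : 0 < c by rewrite lt0n; apply: contraNneq cx => ->; exact: mem_head.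
  have ic' : i <= count (fun v => v < c) cs.
    case: (posnP i) => [->//|i0]; have i1 : i.-1 < i by rewrite prednK.
    have i1c := ltn_trans i1 ic; rewrite -{1}(prednK i0) -nth_sorted_count ?complement_sorted //.
    by apply: (sorted_ltn_nth ltn_trans) => //; exact: complement_sorted.
  have := seq.permP px (fun v => v < c); have := seq.permP pz (fun v => v < c).
  rewrite !count_cat count_lt_iota0 ?(ltnW cn) // => e1 e2.
  suff : count (fun v => v < c) zs < count (fun v => v < c) xs.
    by move: ic' e1 e2; clear; move: (count _ cs) (count _ ds) (count _ xs) (count _ zs); lia.
  rewrite /xs /= c0 add1n ltnS /zs count_map /ys -cats1 count_cat /= [n.-1 < c](_ : _ = false) ?addn0; last first.
    by clear -cn n0; lia.
  rewrite !count_map; apply: leq_count_in => v vV /= vc; have [v1 v2 _] := vle v vV.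
  have : v.1 <= c := leq_trans v2 (leq_trans (leqSpred _) vc).
  rewrite leq_eqVlt => /orP[/eqP ec|//]; move: cx; rewrite inE negb_or => /andP[_ /mapP[]].
  by exists v.
exists s; apply/andP; split.
  by apply: avoids321_increasing pr _ _; apply: increasing_zip => //; exact: complement_sorted.
have -> : p_points s = [seq (z.1, z.2.+1) | z <- [seq z <- graph s | z.1 <= z.2]].
  by rewrite /graph filter_map -map_comp.
have -> : zip xs ys = [seq (z.1, z.2.+1) | z <- [seq z <- T1 ++ T2 | z.1 <= z.2]].
  rewrite filter_cat (_ : filter _ T2 = [::]) ?cats0; last first.
    by apply/eqP; rewrite -[_ == _]negbK -has_filter; apply/hasPn => z /T2_lt; rewrite -ltnNge.
  rewrite (_ : filter _ T1 = T1).
    rewrite /T1 /zs; elim: (xs) (ys) ys0 => [|x X IH] [|y Y] //= h.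
    rewrite -IH ?prednK //; first by have /andP[] := h y (mem_head _ _).
    by move=> u uY; apply: h; rewrite inE uY orbT.
  apply/all_filterP; have := peaks_below (leqnn 0) vv; rewrite -/xs -/ys /T1 /zs.
  elim: (xs) (ys) => [|x X IH] [|y Y] //= /andP[xy /IH->]; rewrite andbT.
  by case: (y) xy.
by apply: perm_map; exact: perm_filter.
Qed.

Section PermOfPath.
Variables (n : nat) (n0 : 0 < n).

Lemma p_invP (D : kdyck n 1) : avoids321 (p_inv D) /\ perm_eq (peaks D) (p_points (p_inv D)).
Proof.
have [s hs] := p_surj D n0; rewrite /p_inv; case: pickP => [s' /andP[]//|/(_ s)].
by rewrite hs.
Qed.

Lemma Dyck2P (D : kdyck n 1) : perm_eq (valleys (Dyck2 D)) (q_points (p_inv D)).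
Proof.
rewrite /Dyck2; case: pickP => [//|none]; case: (p_invP D) => av _.
set s := p_inv D in none av *; pose vl := [seq (z.1, z.2.-1) | z <- dfc s].
have vv : valley_seq n 0 0 vl.
  have [s1 s2] := dfc_sorted av; apply: valley_seq_intro => //.
  - rewrite /unzip1 -map_comp; have : sorted ltn (map fst (dfc s)) by rewrite sorted_map.
    have : {in map fst (dfc s), forall z, 0 < z} by move=> u /mapP[z /dfc_bounds[? _ _ _] ->].
    by rewrite (_ : map (fst \o _) _ = map fst (dfc s)) //; case: (map fst _) => //= a L h ->; rewrite h ?mem_head.
  - rewrite /unzip2 -map_comp.
    have srt : sorted ltn (map (snd \o (fun z : item => (z.1, z.2.-1))) (dfc s)).
      rewrite sorted_map; apply: (@sub_in_sorted _ [pred z : item | 0 < z.2]) s2.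
        by move=> x y; rewrite !inE /relpre /incr /=; lia.
      by apply/allP => z /dfc_bounds[_ _ /ltnW].
    have : {in map (snd \o (fun z : item => (z.1, z.2.-1))) (dfc s), forall z, 0 < z}.
      by move=> u /mapP[z /dfc_bounds[_ _ z1 _] ->] /=; rewrite -ltnS prednK // ltnW.
    by move: srt; case: (map _ _) => //= a L -> h; rewrite h ?mem_head.
  move=> u /mapP[z zD ->] /=; have [_ _ z1 zn] := dfc_bounds zD; have [_ lt] := dfcP zD.
  by case: (z.2) z1 zn lt => // m _ mn; rewrite ltnS => ->.
have kd := valley_word_kdyck vv.
have := none (@KDyck n 1 (Tuple (introT eqP (size_kdyck kd))) kd).
by rewrite /= valleys_valley_word // q_pointsE perm_refl.
Qed.

Lemma RSKhatE (D : kdyck n 1) : RSKhat D = rsk_word (p_inv D) :> seq bool.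
Proof.
have [av _] := p_invP D.
by rewrite /RSKhat path_of_wordE rsk_word_kdyck.
Qed.

Lemma greedy_word_inj V A V' A' : {in V ++ A ++ V' ++ A', forall v, 0 < v <= n} ->
  greedy_word n V A = greedy_word n V' A' -> V =i V' /\ A =i A'.
Proof.
move=> h /eqP; rewrite eqseq_cat ?size_map // => /andP[/eqP e1 /eqP e2].
have dom v : (v \in V ++ A ++ V' ++ A') -> v \in iota 1 n by move=> /h; rewrite mem_iota add1n ltnS.
have out (B : seq nat) v : {subset B <= V ++ A ++ V' ++ A'} -> v \notin iota 1 n -> (v \in B) = false.
  by move=> sB; apply: contraNF => /sB/dom.
split=> v; have [vi|vi] := boolP (v \in iota 1 n).
- by apply: negb_inj; by move/eq_in_map: e1; apply.
- by rewrite !(out _ v _ vi) // => u; rewrite !mem_cat => ->; rewrite ?orbT.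
- by move/eq_in_map: e2; apply; rewrite mem_rev.
- by rewrite !(out _ v _ vi) // => u; rewrite !mem_cat => ->; rewrite ?orbT.
Qed.

Lemma first_row_complement (s : 'S_n) r1 V A : perm_rows s = (r1, V, A) ->
  sorted ltn r1 /\ forall v, (v \in r1) = (v \in iota 1 n) && (v \notin V).
Proof.
move=> eR; have uv : uniq (map fst (items s)) by rewrite (perm_uniq (items_val s)) iota_uniq.
have := rows_spec uv; move: eR; rewrite /perm_rows => -> [srt pr _]; split=> // v.
have pri := perm_trans pr (items_val s); rewrite -(perm_mem pri) mem_cat.
have : uniq (r1 ++ V) by rewrite (perm_uniq pri) iota_uniq.
rewrite cat_uniq => /and3P[_ /hasPn dis _].
by have [/dis/negbTE->|] := boolP (v \in V); rewrite ?orbF ?andbT ?andbF.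
Qed.

Lemma bumped_sorted (s : 'S_n) : avoids321 s -> sorted ltn (bumped (greedy (wex s) (dfc s))).
Proof.
move=> av; apply: (subseq_sorted ltn_trans (bumped_sub _ _)).
by rewrite sorted_map; case: (wex_sorted av).
Qed.

Lemma bumpers_sorted (s : 'S_n) : avoids321 s -> sorted ltn (bumpers (greedy (wex s) (dfc s))).
Proof.
move=> av; apply: (subseq_sorted ltn_trans (bumpers_sub _ _)).
by rewrite sorted_map; case: (dfc_sorted av).
Qed.

(** The word determines the second rows, and the first row of the insertion tableau
    is the complement of its second row; [rows_inj] recovers the permutation. *)
Lemma rsk_word_inj (s s' : 'S_n) : avoids321 s -> avoids321 s' -> rsk_word s = rsk_word s' -> s = s'.
Proof.
move=> av av'; have [ew [r1 eR]] := rsk_word_greedy av; have [ew' [r1' eR']] := rsk_word_greedy av'.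
have ltn_irr := ltnn.
rewrite ew ew' => /greedy_word_inj[].
  move=> v; rewrite !mem_cat => /or4P[/bumped_bounds|/bumpers_bounds/andP[/ltnW-> ->]|
    /bumped_bounds|/bumpers_bounds/andP[/ltnW-> ->]] //.
move=> eV eA.
have {}eV := irr_sorted_eq ltn_trans ltnn (bumped_sorted av) (bumped_sorted av') eV.
have {}eA := irr_sorted_eq ltn_trans ltnn (bumpers_sorted av) (bumpers_sorted av') eA.
have [srt mr] := first_row_complement eR; have [srt' mr'] := first_row_complement eR'.
have er : r1 = r1'.
  by apply: (irr_sorted_eq ltn_trans ltnn) => // v; rewrite mr mr' eV.
have uv (t : 'S_n) : uniq (map fst (items t)) by rewrite (perm_uniq (items_val t)) iota_uniq.
have : items s = items s'.
  apply: rows_inj => //; rewrite ?items_pos ?iota_uniq //.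
  by rewrite -/(perm_rows s) -/(perm_rows s') eR eR' er eV eA.
move=> /eq_in_map h; apply/permP => i; apply: val_inj.
by have [] := h i (mem_enum _ i).
Qed.

Lemma peaks_inj (D D' : kdyck n 1) : perm_eq (peaks D) (peaks D') -> D = D'.
Proof.
have [vl vv eD] := kdyck_valley_word n0 (kdyckP D).
have [vl' vv' eD'] := kdyck_valley_word n0 (kdyckP D').
rewrite eD eD' !peaks_valley_word // => pr.
have srt l : valley_seq n 0 0 l -> sorted (incr fst) (zip (0 :: unzip1 l) (rcons (unzip2 l) n)).
  move=> vvl; have [h _] := valley_seq_sorted vvl.
  have : sorted ltn (unzip1 (zip (0 :: unzip1 l) (rcons (unzip2 l) n))).
    by rewrite unzip1_zip; [exact: h|rewrite size_rcons /= !size_map].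
  by rewrite sorted_map.
have e := irr_sorted_eq (@incr_trans fst) (@incr_irr fst) (srt _ vv) (srt _ vv') (perm_mem pr).
have e1 := congr1 unzip1 e; have e2 := congr1 unzip2 e.
rewrite !unzip1_zip ?size_rcons /= ?size_map // in e1.
rewrite !unzip2_zip ?size_rcons /= ?size_map // in e2.
case: e1 => e1; have [{}e2] := rcons_inj e2.
do 2 apply: val_inj; rewrite /= eD eD'; congr valley_word.
by rewrite -(zip_unzip vl) e1 e2 zip_unzip.
Qed.

Lemma RSKhat_inj : injective (@RSKhat n).
Proof.
move=> D D' e; have [av pD] := p_invP D; have [av' pD'] := p_invP D'.
have := congr1 (fun E : kdyck n 1 => E : seq bool) e; rewrite /= !RSKhatE => /(rsk_word_inj av av') es.
by apply: peaks_inj; apply: perm_trans pD _; rewrite es perm_sym.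
Qed.

End PermOfPath.

(** * The Lalanne-Kreweras involution *)

(** A label that occurs twice has one first and one last occurrence. *)
Lemma firsts_rev (T : eqType) (s : seq T) : full 1 s ->
  firsts (rev s) = map negb (rev (firsts s)).
Proof.
move=> fu; apply: (@eq_from_nth _ true).
  by rewrite size_map size_rev !size_firsts size_rev.
have nth_firsts (a b : seq T) x : nth true (firsts (a ++ x :: b)) (size a) = (x \notin a).
  by rewrite firsts_cat nth_cat size_firsts ltnn subnn.
move=> i; rewrite size_firsts size_rev => lt_i.
rewrite (nth_map true) ?size_rev ?size_firsts // nth_rev ?size_firsts //.
set j := size s - i.+1; have lt_j : j < size s by rewrite /j; lia.
case ed : (drop j s) => [|x b].
  by have := congr1 size ed; rewrite size_drop /=; lia.
have sb : size b = i by have := congr1 size ed; rewrite size_drop /= /j; lia.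
have es : s = take j s ++ x :: b by rewrite -ed cat_take_drop.
have sj : size (take j s) = j by rewrite size_takel // ltnW.
have er : rev s = rev b ++ x :: rev (take j s) by rewrite {1}es rev_cat rev_cons cat_rcons.
have := nth_firsts (rev b) (rev (take j s)) x; rewrite size_rev sb -er => ->.
have := nth_firsts (take j s) b x; rewrite -es sj => ->; rewrite mem_rev negbK.
have : x \in s by rewrite es mem_cat mem_head orbT.
move/fu; rewrite {1}es count_cat /= eqxx -!has_pred1 !has_count; lia.
Qed.

(** Inverting a permutation exchanges its two tableaux. *)
Lemma greedy_word_rev n V A : map negb (rev (greedy_word n V A)) = greedy_word n A V.
Proof.
rewrite /greedy_word rev_cat map_cat -!map_rev revK -!map_comp; congr (_ ++ _).
by apply: eq_map => v /=; rewrite negbK.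
Qed.

Section LalanneKreweras.
Variables (n : nat) (n0 : 0 < n).

Lemma RSKhat_Dyck2 (D : kdyck n 1) (L : seq 'I_n) : noncr L -> full 1 L ->
  RSKhat D = firsts L :> seq bool -> RSKhat (Dyck2 D) = firsts (rot 1 (rev L)) :> seq bool.
Proof.
move=> nc fu; rewrite !RSKhatE //; have [av _] := p_invP n0 D; have [av2 pD2] := p_invP n0 (Dyck2 D).
have [-> _] := rsk_word_greedy av => eL.
have kd := reversed_word_kdyck av.
pose D' := @KDyck n 1 (Tuple (introT eqP (size_kdyck kd))) kd.
have <- := promotion_rsk_word n0 av av2 (Dyck2P n0 D) pD2 (D := D') erefl.
apply: promotion_firsts; [exact: noncr_rev|exact: full_rev|].
by rewrite firsts_rev // -eL greedy_word_rev.
Qed.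

(** On label words, [Rot] is a rotation by two letters, and a reversal followed by
    one rotation leads from there to the reversal of [rot 1 L], the label word of
    [SU P]. *)
Lemma LK_Rot (P : nc n) : LK (Rot P) = SU P.
Proof.
have [eP ncP fuP] := theta_labels (chain1 P); set L := labels _ in eP ncP fuP.
have [eR _ _] := theta_labels (chain1 (Rot P)); have [eS _ _] := theta_labels (chain1 (SU P)).
have sL : size L = 2 * n by have := congr1 size eP; rewrite size_firsts size_tuple.
have r2 : rot 2 L = rot 1 (rot 1 L) by rewrite -iter_rot1 // sL; lia.
have {}eR : theta1 (Rot P) = firsts (rot 2 L) :> seq bool.
  rewrite [LHS]eR; have -> := @labels_rot n 1 [:: P] n0 erefl.
  by rewrite firsts_map // => x y _ _ /ord_pred_inj.
have {}eS : theta1 (SU P) = firsts (rev (rot 1 L)) :> seq bool.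
  rewrite [LHS]eS; have -> := @labels_su n [:: P].
  by rewrite firsts_map // => x y _ _ /rev_ord_inj/ord_pred_inj.
set D := finv (@RSKhat n) (theta1 (Rot P)).
have eD : RSKhat D = theta1 (Rot P) := f_finv (@RSKhat_inj n n0) _.
have key : RSKhat (Dyck2 D) = theta1 (SU P).
  have eRD : RSKhat D = firsts (rot 2 L) :> seq bool by rewrite eD.
  have nc2 : noncr (rot 2 L) by rewrite r2; do 2 apply: noncr_rot.
  have eDD := RSKhat_Dyck2 nc2 (@full_rot _ 1 2 _ fuP) eRD.
  by do 2 apply: val_inj; rewrite [LHS]eDD [RHS]eS -rev_rotr r2 rotK.
rewrite /LK -/D key; case: pickP => [Q /eqP eQ|/(_ (SU P))]; last by rewrite eqxx.
by have := theta_inj n0 eQ => /(congr1 (fun c : kchain n 1 => thead c)).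
Qed.

End LalanneKreweras.

Lemma iter_finvK (T : finType) (f : T -> T) m : injective f ->
  cancel (iter m f) (iter m (finv f)).
Proof. by move=> injf x; elim: m => // m IH; rewrite iterSr /= finv_f. Qed.

Theorem proposition6p20 (n k : nat) (hn : 1 <= n) (hk : 1 <= k) :
  exists thetaV : kdyck n k -> kchain n k,
    [/\ cancel (@theta n k) thetaV /\ cancel thetaV (@theta n k),
        forall c : kchain n k,
          map_chain (@Rot n) c
          = thetaV (iter k.+1 (@promotion n k) (theta c)),
        forall c : kchain n k,
          rev_map_chain (@SU n) c
          = thetaV (evacuation (promotion (theta c)))
      & forall c : kchain n k,
          rev_map_chain (@LK n) c
          = thetaV (evacuation (iter k (finv (@promotion n k)) (theta c)))].
Proof.
have surj (D : kdyck n k) : exists c, theta c == D by have [c <-] := theta_surj D; exists c.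
pose thetaV D := xchoose (surj D).
have thetaVK : cancel thetaV (@theta n k) by move=> D; exact: eqP (xchooseP (surj D)).
have thetaK : cancel (@theta n k) thetaV by move=> c; apply: (theta_inj hn); rewrite thetaVK.
have rot_inj : injective (@rotate_chain n k).
  move=> c c' e; apply: (theta_inj hn); have := congr1 (@theta n k) e.
  rewrite !theta_rotate //; elim: k.+1 => //= m IH /(promotion_inj hn); exact: IH.
exists thetaV; split=> // c.
- by rewrite -theta_rotate // thetaK.
- by rewrite -theta_su thetaK.
(* Every chain is the rotation of some chain [d]. *)
have [rotV _ rotVK] := injF_bij rot_inj; rewrite -[c]rotVK; set d := rotV c.
rewrite theta_rotate //.
have -> : iter k (finv (@promotion n k)) (iter k.+1 (@promotion n k) (theta d)) = promotion (theta d).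
  by rewrite iterSr iter_finvK //; exact: promotion_inj.
rewrite -theta_su thetaK; apply: val_inj => /=; congr rev.
by rewrite -map_comp; apply: eq_map => P /=; rewrite LK_Rot.
Qed.
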